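(* Let $T\subset\mathbb{R}^2$ be a nondegenerate triangle with Clough--Tocher split $\mathcal{R}(T)$, and define $$A^0(T)=\mathrm{C}^1\mathrm{P}^3(\mathcal{R}(T),\mathbb{V}),\quad A^1(T)=\mathrm{C}^0_{\mathrm{sven}}\mathrm{P}^2(\mathcal{R}(T),\mathbb{S}),\quad A^2(T)=\mathrm{P}^0(\mathcal{R}(T),\mathbb{R}),$$ with degrees of freedom (DoFs) as follows. - On $A^0(T)$: values at vertices ($3\times2$), values of the gradient at vertices ($3\times4$), integrals of the normal derivative on edges, $\int_E\partial_\nu u$ ($3\times2$). - On $A^1(T)$: values at vertices ($3\times3$); for each edge $E$ the pairings $u\mapsto\int_E\big((u\tau\cdot\tau)\,\psi+\partial_\tau(u\tau\cdot\nu)\,\phi-(u\tau\cdot\nu)\,\partial_\tau\phi-(\partial_\nu u\,\tau\cdot\tau)\,\phi\big)$ for $(\phi,\psi)\in M(E)$ ($3\times3$); and for each edge $E$ the integral $\int_Eu\nu$ ($3\times2$). - On $A^2(T)$: $u\mapsto\int_Tu\phi$ for $\phi$ an affine function on $T$ ($3$). Then: 1. $A^0(T)$ has dimension $24$ and the provided DoFs are unisolvent. 2. $A^1(T)$ has dimension $24$ and the provided DoFs are unisolvent. 3. $A^2(T)$ has dimension $3$ and the provided DoFs are unisolvent. 4. The sequence $A^0(T)\xrightarrow{\mathrm{def}}A^1(T)\xrightarrow{\mathrm{sven}}A^2(T)$ is a resolution of the rigid motions, i.e. $0\to RM\to A^0(T)\to A^1(T)\to A^2(T)\to0$ is exact,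 where $RM$ is the space of rigid motions.
   Context: $\mathbb{V}=\mathbb{R}^2$ (column vectors), $\mathbb{S}$ is the space of symmetric $2\times2$ real matrices. $RM=\{x\mapsto a+b\,(-x_2,x_1)^{T}:a\in\mathbb{V},b\in\mathbb{R}\}$. For a column vector field $u$, $\mathrm{def}\,u$ is the symmetric part of its gradient (Jacobian) matrix. For a matrix field, $\mathrm{sven}\,u=\partial_{22}u_{11}+\partial_{11}u_{22}-\partial_{12}u_{21}-\partial_{21}u_{12}$ (in the distribution sense). The Clough--Tocher split $\mathcal{R}(T)$ is the subdivision of $T$ into three triangles obtained by joining an interior point of $T$ (the central vertex) to the three vertices of $T$. $\mathrm{P}^r$ denotes polynomials of degree at most $r$, and $\mathrm{P}^r(\mathcal{R}(T),\cdot)$ fields that are piecewise $\mathrm{P}^r$ with respect to $\mathcal{R}(T)$. $\mathrm{C}^1\mathrm{P}^3(\mathcal{R}(T),\mathbb{V})$: those of class $\mathrm{C}^1$ on $T$ (vector-valued Clough--Tocher space). $\mathrm{C}^0_{\mathrm{sven}}\mathrm{P}^2(\mathcal{R}(T),\mathbb{S})$: continuous piecewise $\mathrm{P}^2$ symmetric matrix fields $u$ whose distributional $\mathrm{sven}\,u$ is an integrable function on $T$. For an edge $E$ of $T$, $\tau$ is the oriented unit tangent and $\nu$ the unit normal such that $(\tau,\nu)$ is a positively oriented orthonormal basis. $M(E)$ is the space of pairs $(\phi,\psi)$ with $\phi$ an affine function on $E$ and $\psi$ a constant. A set of DoFs on a finite-dimensional space $A$ is unisolvent if the listed linear forms (bases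 being chosen for the test functions) form a basis of the dual $A^\star$. *)

(* Defs.v *)
From HB Require Import structures.
From mathcomp Require Export all_boot all_order all_algebra.
From mathcomp Require Export all_classical all_reals all_analysis.
Import Order.TTheory GRing.Theory Num.Theory.
Import numFieldNormedType.Exports.

Set Implicit Arguments.
Unset Strict Implicit.
Unset Printing Implicit Defensive.

Local Open Scope classical_set_scope.
Local Open Scope ring_scope.

Section LinearAlgebra.
Variables (R : realType) (V : lmodType R).

Definition subspace (A : set V) : Prop :=
  A 0 /\ forall (k : R) (u v : V), A u -> A v -> A (k *: u + v).

Definition is_basis (A : set V) (I : finType) (e : I -> V) : Prop :=
  [/\ forall i, A (e i),
      forall k : I -> R, \sum_i k i *: e i = 0 -> forall i, k i = 0 &
      forall u, A u -> exists k : I -> R, u = \sum_i k i *: e i].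

Definition has_dim (A : set V) (n : nat) : Prop :=
  subspace A /\ exists e : 'I_n -> V, is_basis A e.

Definition dual (A : set V) : set ({u : V | A u} -> R^o) :=
  [set f | forall (k : R) (u v w : {u : V | A u}),
     sval w = k *: sval u + sval v -> f w = k * f u + f v].

End LinearAlgebra.

Arguments dual {R V} A _.

Definition unisolvent (R : realType) (V : lmodType R) (A : set V)
    (I : finType) (l : I -> V -> R) : Prop :=
  is_basis (dual A) (fun i (u : {u : V | A u}) => l i (sval u) : R^o).

Section Plane.
Variable R : realType.
Implicit Types (x v w : 'cV[R]_2).

Definition dot v w : R := v 0 0 * w 0 0 + v 1 0 * w 1 0.

(* The norm carried by matrices in the library is the sup norm. *)
Definition enorm v : R := Num.sqrt (dot v v).

Definition vec2 (s t : R) : 'cV[R]_2 := \col_(k < 2) (if k == 0 then s else t).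

Definition rot v : 'cV[R]_2 := vec2 (- v 1 0) (v 0 0).

Definition e_ (k : 'I_2) : 'cV[R]_2 := delta_mx k 0.

Definition leb2 := (@lebesgue_measure R \x @lebesgue_measure R)%E.

Definition planar (K : set 'cV[R]_2) : set (R * R) :=
  [set z | K (vec2 z.1 z.2)].

Definition integrable2 (K : set 'cV[R]_2) (f : 'cV[R]_2 -> R) : Prop :=
  leb2.-integrable (planar K) (fun z => (f (vec2 z.1 z.2))%:E).

Definition integral2 (K : set 'cV[R]_2) (f : 'cV[R]_2 -> R) : R :=
  \int[leb2]_(z in planar K) f (vec2 z.1 z.2).

Fixpoint Cn (n : nat) (f : 'cV[R]_2 -> R^o) : Prop :=
  continuous f /\
  if n is n'.+1 then
    forall k : 'I_2, (forall x, derivable f x (e_ k)) /\ Cn n' ('D_(e_ k) f)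
  else True.

Definition test_function (K : set 'cV[R]_2) : set ('cV[R]_2 -> R^o) :=
  [set f | [/\ forall n, Cn n f,
               compact (closure [set x | f x != 0]) &
               closure [set x | f x != 0] `<=` K°]].

Definition polyfun (r : nat) {W : lmodType R} : set ('cV[R]_2 -> W) :=
  [set f | exists C : nat -> nat -> W, forall x,
     f x = \sum_(i < r.+1) \sum_(j < (r - i).+1)
             (x 0 0 ^+ i * x 1 0 ^+ j) *: C i j].

Definition grad (u : 'cV[R]_2 -> 'cV[R]_2) x : 'M[R]_2 :=
  \matrix_(k, l) ('D_(e_ l) u x) k 0.

Definition rigid_motions : set ('cV[R]_2 -> 'cV[R]_2) :=
  [set u | exists (p : 'cV[R]_2) (b : R), forall x, u x = p + b *: rot x].

Definition triangle (a : 'I_3 -> 'cV[R]_2) : set 'cV[R]_2 :=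
  [set x | exists2 t : 'I_3 -> R,
     (forall i, 0 <= t i) /\ \sum_i t i = 1 & x = \sum_i t i *: a i].

Definition nondegenerate_triangle (a : 'I_3 -> 'cV[R]_2) : Prop :=
  \det (row_mx (a 1 - a 0) (a 2 - a 0)) != 0.

End Plane.

(* A piecewise polynomial field on the Clough--Tocher split is the family
   [u] of its three polynomial pieces, [u i] being the piece on [ct a c i]. *)
Notation field R W := ('I_3 -> 'cV[R]_2 -> W) (only parsing).

Section CloughTocher.
Variables (R : realType) (a : 'I_3 -> 'cV[R]_2) (c : 'cV[R]_2).

(* The subtriangle opposite to [a i], containing the edge opposite to [a i]. *)
Definition ct (i : 'I_3) : set 'cV[R]_2 := triangle [eta a with i |-> c].

Definition PP (r : nat) {W : lmodType R} : set (field R W) :=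
  [set u | forall i, polyfun r (u i)].

Definition glues (W : Type) (u : field R W) (g : 'cV[R]_2 -> W) : Prop :=
  forall i x, ct i x -> g x = u i x.

Definition C0 {W : normedModType R} : set (field R W) :=
  [set u | exists2 g : 'cV[R]_2 -> W,
     glues u g & {within triangle a, continuous g}].

(* Class C^1 on the closed triangle: C^1 in the interior, the function and its
   first derivatives extending continuously up to the boundary. *)
Definition C1 {W : normedModType R} : set (field R W) :=
  [set u | exists g : 'cV[R]_2 -> W,
     [/\ glues u g, {within triangle a, continuous g} &
       forall k : 'I_2, exists2 h : 'cV[R]_2 -> W,
         {within triangle a, continuous h} &
         forall x, (triangle a)° x -> derivable g x (e_ R k) /\
                                      'D_(e_ R k) g x = h x]].

Definition bintegral (w : field R R) : R := \sum_i integral2 (ct i) (w i).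

(* Integration by parts carries no sign, [sven] being of second order. *)
Definition sven_eq (u : field R 'M[R]_2) (w : field R R) : Prop :=
  forall f : 'cV[R]_2 -> R^o, test_function (triangle a) f ->
    bintegral (fun i x =>
        u i x 0 0 * 'D_(e_ R 1) ('D_(e_ R 1) f) x
      + u i x 1 1 * 'D_(e_ R 0) ('D_(e_ R 0) f) x
      - u i x 1 0 * 'D_(e_ R 0) ('D_(e_ R 1) f) x
      - u i x 0 1 * 'D_(e_ R 1) ('D_(e_ R 0) f) x)
    = bintegral (fun i x => w i x * f x).

Definition sven_integrable (u : field R 'M[R]_2) : Prop :=
  exists2 f : 'cV[R]_2 -> R,
    integrable2 (triangle a) f & sven_eq u (fun _ => f).

Definition A0 : set (field R 'cV[R]_2) := PP 3 `&` C1.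

Definition A1 : set (field R 'M[R]_2) :=
  [set u | [/\ PP 2 u, forall i x, (u i x)^T = u i x,
               C0 u & sven_integrable u]].

Definition A2 : set (field R R^o) := PP 0.

Definition def_ (u : field R 'cV[R]_2) : field R 'M[R]_2 :=
  fun i x => 2^-1 *: (grad (u i) x + (grad (u i) x)^T).

End CloughTocher.

Section DegreesOfFreedom.
Variables (R : realType) (a : 'I_3 -> 'cV[R]_2) (c : 'cV[R]_2).

(* Edge [i] joins the vertices other than [a i], with the orientation given
   by [o i]. *)
Variable o : 'I_3 -> bool.

Definition edge_src (i : 'I_3) : 'cV[R]_2 :=
  if o i then a (ord_pred i) else a (ordS i).

Definition edge_tgt (i : 'I_3) : 'cV[R]_2 :=
  if o i then a (ordS i) else a (ord_pred i).

Definition elen (i : 'I_3) : R := enorm (edge_tgt i - edge_src i).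

Definition tau (i : 'I_3) : 'cV[R]_2 :=
  (elen i)^-1 *: (edge_tgt i - edge_src i).

Definition nu (i : 'I_3) : 'cV[R]_2 := rot (tau i).

Definition edge_pt (i : 'I_3) (s : R) : 'cV[R]_2 := edge_src i + s *: tau i.

Definition edge_integral (i : 'I_3) (f : R -> R) : R :=
  \int[@lebesgue_measure R]_(s in `[0, elen i]) f s.

(* Functions on an edge are written in the arclength coordinate [s] of
   [edge_pt], so that the tangential derivative is d/ds. *)
Definition edge_tests : set ((R -> R^o) * R^o) :=
  [set m | exists k l : R, forall s, m.1 s = k + l * s].

Definition edge_pairing (i : 'I_3) (m : (R -> R^o) * R^o)
    (u : 'cV[R]_2 -> 'M[R]_2) : R :=
  let t := tau i in let n := nu i in
  edge_integral i (fun s => let x := edge_pt i s in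
      dot (u x *m t) t * m.2
    + 'D_t (fun y => dot (u y *m t) n : R^o) x * m.1 s
    - dot (u x *m t) n * derive1 m.1 s
    - dot ('D_n u x *m t) t * m.1 s).

(* The piece used at the vertex [a j] is one of the two whose subtriangle
   contains [a j]; both give the same value on [C1], resp. [C0], fields. *)
Definition at_vertex (W : Type) (u : field R W) (j : 'I_3) : 'cV[R]_2 -> W :=
  u (ordS j).

Definition dofs0 (d : 'I_3 * 'I_2 + 'I_3 * ('I_2 * 'I_2) + 'I_3 * 'I_2)
    (u : field R 'cV[R]_2) : R :=
  match d with
  | inl (inl (j, k)) => at_vertex u j (a j) k 0
  | inl (inr (j, (k, l))) => grad (at_vertex u j) (a j) k l
  | inr (i, k) => edge_integral i (fun s => ('D_(nu i) (u i) (edge_pt i s)) k 0)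
  end.

Definition sym_coord (M : 'M[R]_2) (k : 'I_3) : R :=
  tnth [tuple M 0 0; M 0 1; M 1 1] k.

Definition dofs1 (bM : 'I_3 -> 'I_3 -> (R -> R^o) * R^o)
    (d : 'I_3 * 'I_3 + 'I_3 * 'I_3 + 'I_3 * 'I_2)
    (u : field R 'M[R]_2) : R :=
  match d with
  | inl (inl (j, k)) => sym_coord (at_vertex u j (a j)) k
  | inl (inr (i, k)) => edge_pairing i (bM i k) (u i)
  | inr (i, k) => edge_integral i (fun s => (u i (edge_pt i s) *m nu i) k 0)
  end.

Definition dofs2 (bP : 'I_3 -> 'cV[R]_2 -> R^o) (k : 'I_3)
    (u : field R R^o) : R :=
  bintegral a c (fun i x => u i x * bP k x).

End DegreesOfFreedom.

(* Main.v *)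
(* Let [h_i] be the affine function vanishing on the edge [i] and equal to 1 at
   the central vertex.  Integrating by parts twice, the distribution [sven u] of
   a continuous piecewise quadratic field is its piecewise value plus a density
   on the spokes; smooth bumps concentrating on a spoke show that [sven u] is
   integrable only if this density vanishes.

   Unisolvence: when all degrees of freedom vanish, the piece [u_i] is divisible
   by [h_i ^ 2] (in [A0]) or by [h_i] (in [A1]).  The conditions on the spokes
   then make the cofactor vanish at the vertices, hence a further factor [h_i]
   splits off, the last cofactor being a constant common to the three pieces,
   which the conditions at the central vertex force to be zero; in [A1], this
   uses that a symmetric matrix is zero if its quadratic form vanishes in three
   directions.  Since the degrees of freedom are jointly injective, it remains
   to exhibit 24 independent fields.  In [A0] these are the monomials and four
   Clough--Tocher functions.  In [A1] they are the deformations of a complement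
   of the rigid motions, together with one bubble in each cell, on which [sven]
   is a nonzero constant.  As [sven] kills deformations, this basis also gives
   exactness at [A1] and [A2]. *)
Require Import Defs.
From mathcomp Require Import all_boot all_order all_algebra.
From mathcomp Require Import all_classical all_reals all_analysis.
From mathcomp Require Import measurable_realfun ring lra.
Import Order.TTheory GRing.Theory Num.Theory.
Import numFieldNormedType.Exports.
Local Open Scope classical_set_scope.
Local Open Scope ring_scope.
Set Implicit Arguments.
Unset Strict Implicit.
Unset Printing Implicit Defensive.

(** Each piece is a polynomial on the whole plane, so a condition valid on an open piece of a spoke
    or an edge holds on the full line carrying it. It may therefore be divided by a factor that is
    nonzero on the open spoke and then read at both ends. The normalisation [hat i c = 1] is chosen
    for this: on the spoke c + s [spoke k], the functions [hat] of the two adjacent cells are both 1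
    - s, so their powers cancel from every matching condition. Reading the result at s = 1 concerns
    a vertex of the triangle, reading it at s = 0 concerns the central vertex.

    The bumps that concentrate on a spoke have height at most 1 and a restriction to the spoke that
    does not depend on n. Against an arbitrary integrable density the cell integrals tend to 0 by
    dominated convergence, while the spoke term does not move; this needs no regularity of the
    density.

    All area integrals are pulled back to one reference simplex whose origin goes to the central
    vertex, so that integration by parts on a cell becomes Fubini and the fundamental theorem of
    calculus along the two spokes. *)

(** * Square systems of linear forms: basis, dimension, dual basis *)

Section Unisolvence.
Variables (R : realType) (V : lmodType R) (A : set V).

(** Linearity is asked on [A] only: derivatives and integrals take conventional values on irregular
    functions, so the degrees of freedom are not linear on all fields. *)
Definition linear_form_on (l : V -> R) : Prop :=
  forall (k : R) u v, A u -> A v -> l (k *: u + v) = k * l u + l v.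

Hypothesis subA : Defs.subspace A.

Let sub0 : A 0 := proj1 subA.
Let subD : forall (k : R) u v, A u -> A v -> A (k *: u + v) := proj2 subA.

Lemma subspace_sum (I : finType) (e : I -> V) (k : I -> R) :
  (forall i, A (e i)) -> A (\sum_i k i *: e i).
Proof.
move=> Ae; apply: (big_ind A) => [|u v Au Av|i _]; first exact: sub0.
  by rewrite -[u]scale1r; apply: subD.
by rewrite -[_ *: _]addr0; apply: subD => //; exact: sub0.
Qed.

Lemma linear_form_on0 l : linear_form_on l -> l 0 = 0.
Proof.
move=> /(_ 1 0 0 sub0 sub0); rewrite scaler0 addr0 mul1r => /eqP.
by rewrite -subr_eq0 opprD addNKr oppr_eq0 => /eqP.
Qed.

Lemma linear_form_on_sum l (I : finType) (e : I -> V) (k : I -> R) :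
  linear_form_on l -> (forall i, A (e i)) ->
  l (\sum_i k i *: e i) = \sum_i k i * l (e i).
Proof.
move=> ll Ae.
suff [] : A (\sum_i k i *: e i) /\
          l (\sum_i k i *: e i) = \sum_i k i * l (e i) by [].
apply: (big_ind2 (fun v r => A v /\ l v = r)) => [|v r v' r' [Av <-] [Av' <-]|i _].
- by split; [exact: sub0|exact: linear_form_on0].
- rewrite -[X in X + _]scale1r; split; first exact: subD.
  by rewrite ll// mul1r.
- rewrite -[_ *: _]addr0; split; first by apply: subD => //; exact: sub0.
  by rewrite ll// linear_form_on0// addr0.
Qed.

Variables (I J : finType) (e : I -> V) (l : J -> V -> R).
Hypotheses (IJ : #|I| = #|J|) (Ae : forall i, A (e i)).
Hypothesis free_e : forall k : I -> R, \sum_i k i *: e i = 0 -> forall i, k i = 0.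
Hypothesis lin_l : forall j, linear_form_on (l j).
Hypothesis inj_l : forall u, A u -> (forall j, l j u = 0) -> u = 0.

Let n := #|J|.
Let M : 'M[R]_n :=
  \matrix_(i, j) l (enum_val j) (e (enum_val (cast_ord (esym IJ) i))).

Let I_of (i : 'I_n) : I := enum_val (cast_ord (esym IJ) i).
Let of_I (i : I) : 'I_n := cast_ord IJ (enum_rank i).

Let of_IK : cancel of_I I_of.
Proof. by move=> i; rewrite /I_of /of_I cast_ordK enum_rankK. Qed.

Let I_ofK : cancel I_of of_I.
Proof. by move=> i; rewrite /I_of /of_I enum_valK cast_ordKV. Qed.

Let sum_I (W : nmodType) (F : I -> W) : \sum_i F i = \sum_(i < n) F (I_of i).
Proof. by rewrite (reindex I_of)//; exists of_I => i _. Qed.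

Let Mmul (k : 'rV[R]_n) (j : J) :
  (k *m M) 0 (enum_rank j) = l j (\sum_i k 0 (of_I i) *: e i).
Proof.
rewrite linear_form_on_sum// sum_I mxE; apply: eq_bigr => i _.
by rewrite mxE I_ofK enum_rankK.
Qed.

(** A vector in the left kernel of [M] gives a combination of the [e i] killed by every form, hence
    zero by [inj_l]; its coefficients then vanish by [free_e]. *)
Let Munit : M \in unitmx.
Proof.
rewrite -row_free_unit -kermx_eq0; apply/eqP/row_matrixP => r.
rewrite row0; set k := row r _.
have kM : k *m M = 0 by apply: sub_kermxP; exact: row_sub.
have Ak : A (\sum_i k 0 (of_I i) *: e i) by exact: subspace_sum.
have /free_e k0 : \sum_i k 0 (of_I i) *: e i = 0.
  by apply: inj_l => // j; rewrite -Mmul kM mxE.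
by apply/rowP => i; rewrite [RHS]mxE -[i]I_ofK; exact: k0.
Qed.

(** The coordinates are chosen to reproduce the values of all forms at [u], so the difference is
    killed by every form. *)
Lemma unisolvent_basis : is_basis A e.
Proof.
split=> // u Au.
pose k : 'rV[R]_n := (\row_j l (enum_val j) u) *m invmx M.
exists (fun i => k 0 (of_I i)); apply/eqP; rewrite -subr_eq0; apply/eqP.
have As : A (\sum_i k 0 (of_I i) *: e i) by exact: subspace_sum.
rewrite -[u - _]addr0 -[u - _]addrC -scaleN1r addr0; apply: inj_l => [|j].
  exact: subD.
by rewrite lin_l// -Mmul mulmxKV// mxE enum_rankK mulN1r addNr.
Qed.

Lemma unisolvent_dim : has_dim A #|J|.
Proof.
split=> //; have [_ _ gen] := unisolvent_basis.
exists (fun i => e (I_of i)); split=> [i|k|u /gen[k ->]].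
- exact: Ae.
- move=> s i; rewrite -[i]I_ofK; apply: (free_e (k := k \o of_I)).
  by rewrite sum_I -[RHS]s; apply: eq_bigr => j _; rewrite /= I_ofK.
- by exists (k \o I_of); rewrite sum_I.
Qed.

Lemma unisolvent_forms : unisolvent A l.
Proof.
split=> [j k u v w /= wuv|k s j|f fdual].
- rewrite wuv lin_l//; exact: svalP.
- pose kk : 'cV[R]_n := \col_j k (enum_val j).
  have Mk : M *m kk = 0.
    apply/colP => i; rewrite !mxE.
    have := congr1 (fun f => f (exist A _ (Ae (I_of i)))) s.
    rewrite /= !fct_sumE (reindex (@enum_val J J)) /=; last first.
      by exists enum_rank => x _; rewrite ?enum_valK ?enum_rankK.
    move=> s'; rewrite -[RHS]s'; apply: eq_bigr => m _.
    by rewrite !mxE mulrC.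
  have : kk = 0 by rewrite -[kk](mulKmx Munit) Mk mulmx0.
  by move/colP => /(_ (enum_rank j)); rewrite !mxE enum_rankK.
- have [_ _ gen] := unisolvent_basis.
  (* A functional is determined by its values [y] on the [e i]; its coordinates [z] on the forms
     solve M z = y. *)
  pose y : 'cV[R]_n := \col_i f (exist A _ (Ae (I_of i))).
  pose z := invmx M *m y.
  exists (fun j => z (enum_rank j) 0); apply/funext => u.
  rewrite fct_sumE.
  have [k uk] := gen _ (svalP u).
  have fu : f u = \sum_i k i * f (exist A _ (Ae i)).
    (* The extension of [f] by 0 from the sigma type to [V] is linear on [A], hence can be evaluated
       on finite sums. Proof irrelevance makes it independent of the proof of membership. *)
    pose g (v : V) : R := if pselect (A v) is left Av then f (exist A v Av) else 0.
    have gE v (Av : A v) : g v = f (exist A v Av).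
      rewrite /g; case: pselect => // Av'; congr f; congr exist.
      exact: Prop_irrelevance.
    have lg : linear_form_on g.
      move=> q v w Av Aw; have Avw := subD q Av Aw.
      by rewrite (gE _ Av) (gE _ Aw) [LHS](gE _ Avw); exact: fdual.
    have -> : f u = g (sval u).
      by case: (u) => v Av /=; rewrite (gE _ Av).
    by rewrite uk linear_form_on_sum//; apply: eq_bigr => i _; rewrite gE.
  rewrite fu sum_I.
  transitivity ((\row_i k (I_of i) *m M *m z) 0 0).
    rewrite -mulmxA mulKVmx// mxE.
    by apply: eq_bigr => i _; rewrite !mxE.
  rewrite mxE [RHS](reindex (@enum_val J J)) /=; last first.
    by exists enum_rank => x _; rewrite ?enum_valK ?enum_rankK.
  apply: eq_bigr => j _; rewrite enum_valK -[RHS]mulrC; congr (_ * _).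
  rewrite -[j in LHS]enum_valK Mmul; congr l.
  by rewrite uk; apply: eq_bigr => i _; rewrite mxE of_IK.
Qed.

End Unisolvence.

(** * Polynomials in two variables *)

Section PlanePolynomials.
Variable R : realType.
Local Notation V := 'cV[R]_2.
Implicit Types (x y v w : V) (f g h : V -> R).

Definition cross v w : R := v 0 0 * w 1 0 - v 1 0 * w 0 0.

Lemma ord2P (k : 'I_2) : k = 0 \/ k = 1.
Proof. by case: k => -[|[|//]] ?; [left|right]; exact: val_inj. Qed.

Lemma cv2P v w : v 0 0 = w 0 0 -> v 1 0 = w 1 0 -> v = w.
Proof.
by move=> v0 v1; apply/colP => k; have [->|->] := ord2P k.
Qed.

(** A nested (Horner-like) description of degree at most [r], with [g] and [h] not unique. Closure
    properties and derivatives become inductions on [r]; [polyfunP] gives the equivalence with the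
    double sum. *)
Fixpoint pol (r : nat) f : Prop :=
  if r is r'.+1 then
    exists k g h, [/\ pol r' g, pol r' h &
                      forall x, f x = k + x 0 0 * g x + x 1 0 * h x]
  else exists k, forall x, f x = k.

Lemma pol_ext r f g : f =1 g -> pol r f -> pol r g.
Proof. by move=> /funext ->. Qed.

Lemma pol_cst r (k : R) : pol r (fun _ => k).
Proof.
elim: r k => [|r IH] k /=; first by exists k.
exists k, (fun _ => 0), (fun _ => 0); split=> // x.
by rewrite !mulr0 !addr0.
Qed.

Lemma polS r f : pol r f -> pol r.+1 f.
Proof.
elim: r f => [|r IH] f.
  by move=> [k fk]; apply: pol_ext (pol_cst 1 k) => x; rewrite fk.
by move=> [k [g [h [/IH pg /IH ph fE]]]]; exists k, g, h.
Qed.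

Lemma pol_le r s f : (r <= s)%N -> pol r f -> pol s f.
Proof.
move=> /subnK <-; elim: (s - r)%N => // n IH pf.
by rewrite addSn; apply/polS/IH.
Qed.

Lemma polD r f g : pol r f -> pol r g -> pol r (fun x => f x + g x).
Proof.
elim: r f g => [|r IH] f g /=.
  by move=> [k fk] [l gl]; exists (k + l) => x; rewrite fk gl.
move=> [k [f1 [f2 [pf1 pf2 fE]]]] [l [g1 [g2 [pg1 pg2 gE]]]].
exists (k + l), (fun x => f1 x + g1 x), (fun x => f2 x + g2 x).
by split; [exact: IH|exact: IH|move=> x; rewrite fE gE; ring].
Qed.

Lemma polZ r (k : R) f : pol r f -> pol r (fun x => k * f x).
Proof.
elim: r f => [|r IH] f /=; first by move=> [l fl]; exists (k * l) => x; rewrite fl.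
move=> [l [f1 [f2 [pf1 pf2 fE]]]].
exists (k * l), (fun x => k * f1 x), (fun x => k * f2 x).
by split; [exact: IH|exact: IH|move=> x; rewrite fE; ring].
Qed.

Lemma polB r f g : pol r f -> pol r g -> pol r (fun x => f x - g x).
Proof.
by move=> pf pg; apply: pol_ext (polD pf (polZ (-1) pg)) => x; rewrite mulN1r.
Qed.

Lemma pol_sum r (I : Type) (s : seq I) (P : pred I) (F : I -> V -> R) :
  (forall i, P i -> pol r (F i)) -> pol r (fun x => \sum_(i <- s | P i) F i x).
Proof.
move=> pF; elim: s => [|i s IH].
  by apply: pol_ext (pol_cst r 0) => x; rewrite big_nil.
have [Pi|nPi] := boolP (P i).
  by apply: pol_ext (polD (pF _ Pi) IH) => x; rewrite big_cons Pi.
by apply: pol_ext IH => x; rewrite big_cons (negbTE nPi).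
Qed.

Lemma polM r s f g : pol r f -> pol s g -> pol (r + s) (fun x => f x * g x).
Proof.
elim: r f => [|r IH] f /=.
  by move=> [k fk] pg; apply: pol_ext (polZ k pg) => x; rewrite fk.
move=> [k [f1 [f2 [pf1 pf2 fE]]]] pg.
have p1 : pol (r + s).+1
   (fun x => 0 + x 0 0 * (f1 x * g x) + x 1 0 * (f2 x * g x)).
  by exists 0, (fun x => f1 x * g x), (fun x => f2 x * g x); split=> //; exact: IH.
have p2 : pol (r + s).+1 (fun x => k * g x).
  by apply: polZ; apply: pol_le pg; rewrite -addSn leq_addl.
by apply: pol_ext (polD p2 p1) => x; rewrite fE; ring.
Qed.

Lemma pol_exp r f n : pol r f -> pol (n * r) (fun x => f x ^+ n).
Proof.
move=> pf; elim: n => [|n IH]; first exact: (pol_cst 0 1).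
by rewrite mulSn; apply: pol_ext (polM pf IH) => x; rewrite exprS.
Qed.

Lemma pol_coord (k : 'I_2) : pol 1 (fun x => x k 0).
Proof.
have [->|->] := ord2P k.
  by exists 0, (fun _ => 1), (fun _ => 0); split; [exists 1|exists 0|move=> x; ring].
by exists 0, (fun _ => 0), (fun _ => 1); split; [exists 0|exists 1|move=> x; ring].
Qed.

Lemma pol_comp r f (phi : V -> V) :
  (forall k, pol 1 (fun x => phi x k 0)) -> pol r f -> pol r (f \o phi).
Proof.
move=> pphi; elim: r f => [|r IH] f /=; first by move=> [k fk]; exists k => x /=.
move=> [k [f1 [f2 [pf1 pf2 fE]]]].
have := polM (pphi 1) (IH _ pf2); have := polM (pphi 0) (IH _ pf1).
rewrite !add1n => p1 p2.
by apply: pol_ext (polD (polD (pol_cst r.+1 k) p1) p2) => x /=; rewrite fE.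
Qed.

Lemma pol1P f : pol 1 f <-> exists k l m, forall x, f x = k + l * x 0 0 + m * x 1 0.
Proof.
split=> [[k [g [h [[l gl] [m hm] fE]]]]|[k [l [m fE]]]].
  by exists k, l, m => x; rewrite fE gl hm; ring.
exists k, (fun _ => l), (fun _ => m); split; [by exists l|by exists m|].
by move=> x; rewrite fE; ring.
Qed.

Lemma pol_affine (O v w : V) (k : 'I_2) :
  pol 1 (fun y => (O + y 0 0 *: v + y 1 0 *: w) k 0).
Proof.
by apply/pol1P; exists (O k 0), (v k 0), (w k 0) => y; rewrite !mxE; ring.
Qed.

Lemma polyfun_pol r f : @polyfun R r R^o f -> pol r f.
Proof.
move=> [C fE]; apply: pol_ext (fun x => esym (fE x)) _.
apply: pol_sum => i _; apply: pol_sum => j _.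
apply: (@pol_le (i + j)).
  by rewrite -[leqRHS](subnKC (ltn_ord i : i <= r)%N) leq_add2l -ltnS.
have p := polM (pol_exp i (pol_coord 0)) (pol_exp j (pol_coord 1)).
rewrite !muln1 in p; apply: pol_ext (polZ (C i j) p) => x.
by rewrite -[RHS]/(_ * _) mulrC.
Qed.

Lemma pol_polyfun r f : pol r f -> @polyfun R r R^o f.
Proof.
elim: r f => [|r IH] f.
  by move=> [k fk]; exists (fun _ _ => k) => x; rewrite !big_ord1 !expr0 mul1r scale1r fk.
move=> [k [g [h [/IH[G gE] /IH[H hE] fE]]]].
pose Ck i j : R := if (i == 0)%N && (j == 0)%N then k else 0.
pose CG i j : R := if i is i'.+1 then G i' j else 0.
pose CH i j : R := if j is j'.+1 then H i j' else 0.
exists (fun i j => Ck i j + CG i j + CH i j) => x; rewrite fE.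
under [RHS]eq_bigr do under eq_bigr do rewrite !scalerDr.
under [RHS]eq_bigr do rewrite !big_split /=.
rewrite !big_split /=; congr (_ + _ + _).
- rewrite big_ord_recl [X in _ + X]big1 ?addr0 => [|i _].
    rewrite big_ord_recl [X in _ + X]big1 ?addr0 => [|j _].
      by rewrite !expr0 mul1r -[RHS]/(_ * _) mul1r.
    by rewrite /Ck/= scaler0.
  by rewrite big1// => j _; rewrite /Ck/= scaler0.
- rewrite big_ord_recl /= big1 ?add0r => [|i _]; last by rewrite scaler0.
  rewrite gE mulr_sumr; apply: eq_bigr => i _; rewrite mulr_sumr.
  apply: eq_bigr => j _.
  rewrite -[LHS]/(_ * (_ * _)) -[RHS]/(x 0 0 ^+ i.+1 * _ * G i j) exprS.
  by rewrite !mulrA.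
- rewrite big_ord_recr /= subnn big_ord1 /= scaler0 addr0.
  rewrite hE mulr_sumr; apply: eq_bigr => i _.
  rewrite subSn; last by rewrite -ltnS.
  rewrite [RHS]big_ord_recl /= scaler0 add0r mulr_sumr.
  apply: eq_bigr => j _.
  rewrite -[LHS]/(_ * (_ * _)) -[RHS]/(_ * x 1 0 ^+ j.+1 * H i j) exprS.
  by ring.
Qed.

Lemma polyfunP r f : @polyfun R r R^o f <-> pol r f.
Proof. by split; [exact: polyfun_pol|exact: pol_polyfun]. Qed.

Lemma polyfun_mxP r m n (f : V -> 'M[R]_(m, n)) :
  polyfun r f <-> forall i j, pol r (fun x => f x i j).
Proof.
split=> [[C fE] i j|pf].
  apply/polyfunP; exists (fun p q => C p q i j) => x.
  rewrite fE summxE; apply: eq_bigr => p _; rewrite summxE.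
  by apply: eq_bigr => q _; rewrite mxE.
have {pf} [C fE] := choice (fun ij : 'I_m * 'I_n => (polyfunP _ _).2 (pf ij.1 ij.2)).
exists (fun p q => \matrix_(i, j) C (i, j) p q) => x; apply/matrixP => i j.
rewrite (fE (i, j)) summxE; apply: eq_bigr => p _; rewrite summxE.
by apply: eq_bigr => q _; rewrite !mxE.
Qed.

Lemma poly_eq0_itv (p : {poly R}) :
  (forall s, 0 < s -> s < 1 -> p.[s] = 0) -> p = 0.
Proof.
move=> p0; apply/eqP; apply/negPn/negP => pn0.
(* The points 1/(k+2) with k < [size p] are distinct roots in the open interval, more of them than
   the degree of [p]. *)
pose s := [seq ((k.+2)%:R)^-1 : R | k <- iota 0 (size p)].
have := max_poly_roots pn0 (rs := s); rewrite size_map size_iota ltnn => h.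
suff : false by []; apply: h.
  apply/allP => _ /mapP[k _ ->]; apply/eqP/p0; first by rewrite invr_gt0 ltr0n.
  by rewrite invf_lt1 ?ltr0n// ltr1n.
rewrite map_inj_uniq ?iota_uniq// => i j /invr_inj/eqP.
by rewrite eqr_nat => /eqP[].
Qed.

Lemma pol_line r f (O v : V) : pol r f ->
  exists2 p : {poly R}, (size p <= r.+1)%N & forall s, f (O + s *: v) = p.[s].
Proof.
elim: r f => [|r IH] f /=.
  by move=> [k fk]; exists k%:P => [|s]; rewrite ?size_polyC_leq1// hornerC.
move=> [k [g [h [/IH[p sp pE] /IH[q sq qE] fE]]]].
exists (k%:P + ((O 0 0)%:P + (v 0 0)%:P * 'X) * p
             + ((O 1 0)%:P + (v 1 0)%:P * 'X) * q) => [|s].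
  have sl (l m : R) : (size (l%:P + m%:P * 'X : {poly R})%R <= 2)%N.
    rewrite (leq_trans (size_polyD _ _))// geq_max.
    rewrite (leq_trans (size_polyC_leq1 _))//=.
    rewrite (leq_trans (size_polyMleq _ _))// size_polyX addn2/=.
    by rewrite ltnS size_polyC_leq1.
  have sm (l m : R) (z : {poly R}) : (size z <= r.+1)%N ->
      (size ((l%:P + m%:P * 'X) * z)%R <= r.+2)%N.
    move=> sz; rewrite (leq_trans (size_polyMleq _ _))//.
    by rewrite -subn1 leq_subLR (leq_trans (leq_add (sl _ _) sz)).
  rewrite (leq_trans (size_polyD _ _))// geq_max sm// andbT.
  rewrite (leq_trans (size_polyD _ _))// geq_max sm// andbT.
  by rewrite (leq_trans (size_polyC_leq1 _)).
by rewrite fE !hornerE -pE -qE !mxE; ring.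
Qed.

(** On a line, [f] is a polynomial in one variable with infinitely many zeros. This is the passage
    from open segments to whole lines, end points included. *)
Lemma pol_line_eq0 r f (O v : V) : pol r f ->
  (forall s, 0 < s -> s < 1 -> f (O + s *: v) = 0) ->
  forall s, f (O + s *: v) = 0.
Proof.
move=> /(pol_line O v)[p _ pE] f0 s; rewrite pE (@poly_eq0_itv p) ?horner0//.
by move=> t t0 t1; rewrite -pE f0.
Qed.

(** In g = k + x g1 + y g2 the value at the origin gives k = 0; then x g1 vanishes on the axis,
    hence so does [g1], which is divisible by y by induction. The quotient is x q + g2. *)
Let pol_axis_div r g : pol r g -> (forall y, y 1 0 = 0 -> g y = 0) ->
  exists2 q, pol r.-1 q & forall y, g y = y 1 0 * q y.
Proof.
elim: r g => [|r IH] g /=.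
  move=> [k gk] g0; exists (fun _ => 0) => [|y]; first by exists 0.
  by rewrite mulr0 gk -(gk 0) g0// mxE.
move=> [k [g1 [g2 [pg1 pg2 gE]]]] g0.
have k0 : k = 0.
  by have := g0 0; rewrite gE !mxE !mul0r !addr0; exact.
have g10 y : y 1 0 = 0 -> g1 y = 0.
  move=> y1; have := pol_line_eq0 (O := 0) (v := vec2 1 0) pg1.
  move=> /(_ _ (y 0 0)); rewrite add0r => h.
  rewrite [y](_ : _ = y 0 0 *: vec2 1 0); last first.
    by apply: cv2P; rewrite !mxE/= ?y1; ring.
  apply: h => s s0 _; have := g0 (s *: vec2 1 0).
  rewrite gE k0 !mxE/= mulr0 mulr1 mul0r addr0 add0r add0r => /(_ erefl)/eqP.
  by rewrite mulf_eq0 gt_eqF//= => /eqP.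
have [q pq qE] := IH _ pg1 g10.
exists (fun y => y 0 0 * q y + g2 y) => [|y]; last by rewrite gE k0 qE; ring.
(* At [r] = 0 the quotient has to be constant although x q formally has degree 1; there [q] is zero,
   because [g1] is a constant that vanishes on the axis. *)
case: r {IH} pg1 pg2 pq => [|r] pg1 pg2 pq.
  exists (g2 0); case: pg1 => k1 g1E; case: pg2 => k2 g2E y.
  case: pq => kq qE'; rewrite !g2E qE'.
  have := qE (vec2 0 1); rewrite qE' mxE/= mul1r => <-.
  by rewrite g1E -(g1E 0) g10 ?mxE// mulr0 add0r.
by apply: polD => //; exact: (polM (pol_coord 0) pq).
Qed.

(** In the affine frame with origin [O] and axes [v], [rot v] the line is the first axis, and the
    second coordinate is [cross v (x - O)] divided by [dot v v]; [pol_axis_div] applies there. *)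
Lemma pol_div r f (O v : V) : v != 0 -> pol r f ->
  (forall s, f (O + s *: v) = 0) ->
  exists2 q, pol r.-1 q & forall x, f x = cross v (x - O) * q x.
Proof.
move=> v0 pf f0; have d0 : dot v v != 0.
  apply: contraNneq v0 => dv; apply/eqP; apply: cv2P; rewrite !mxE.
    by move: dv; rewrite /dot; nra.
  by move: dv; rewrite /dot; nra.
have [q pq qE] := pol_axis_div (pol_comp (pol_affine O v (Defs.rot v)) pf)
  (fun y (y1 : y 1 0 = 0) => ltac:(by rewrite /= y1 scale0r addr0 f0)).
pose B x : V := vec2 (dot v (x - O) / dot v v) (cross v (x - O) / dot v v).
have BK x : O + B x 0 0 *: v + B x 1 0 *: Defs.rot v = x.
  by apply: cv2P; rewrite !mxE/= /cross /dot !mxE; field.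
exists (fun x => (dot v v)^-1 * q (B x)) => [|x]; last first.
  by rewrite -[in LHS](BK x); have /= -> := qE (B x); rewrite {1}/B mxE/=; field.
apply: polZ; apply: pol_comp pq => k.
have [->|->] := ord2P k; apply/pol1P.
  exists (- dot v O / dot v v), (v 0 0 / dot v v), (v 1 0 / dot v v) => x.
  by rewrite mxE/= /dot !mxE; field.
exists (- cross v O / dot v v), (- v 1 0 / dot v v), (v 0 0 / dot v v) => x.
by rewrite mxE/= /cross !mxE; field.
Qed.

Lemma pol_differentiable r f x : pol r f -> differentiable f x.
Proof.
elim: r f => [|r IH] f /=.
  by move=> [k fk]; rewrite (_ : f = cst k)//; apply/funext.
move=> [k [g [h [/IH dg /IH dh fE]]]].
rewrite (_ : f = cst k + (fun y : V => y 0 0) * g + (fun y : V => y 1 0) * h).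
  apply: differentiableD; last first.
    by apply: differentiableM => //; exact: differentiable_coord.
  apply: differentiableD => //.
  by apply: differentiableM => //; exact: differentiable_coord.
by apply/funext => y; rewrite fE.
Qed.

Lemma pol_continuous r f : pol r f -> continuous f.
Proof.
by move=> pf x; apply: differentiable_continuous; exact: pol_differentiable pf.
Qed.

Lemma pol_derivable r f x v : pol r f -> derivable f x v.
Proof. by move=> pf; apply/diff_derivable; exact: pol_differentiable pf. Qed.

Lemma derive_lin f x (k : R) v w : differentiable f x ->
  'D_(k *: v + w) f x = k * 'D_v f x + 'D_w f x.
Proof. by move=> df; rewrite !deriveE// linearP. Qed.

Lemma derive_coords f x v : differentiable f x ->
  'D_v f x = v 0 0 * 'D_(e_ R 0) f x + v 1 0 * 'D_(e_ R 1) f x.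
Proof.
move=> df; rewrite [X in 'D_X f x](_ : v = v 0 0 *: e_ R 0 + (v 1 0 *: e_ R 1 + 0)).
  by rewrite (derive_lin _ _ _ df) (derive_lin _ _ _ df) derive0 addr0.
by apply: cv2P; rewrite !mxE/=; ring.
Qed.

Lemma is_derive_coord x v (k : 'I_2) : is_derive x v (fun y : V => y k 0) (v k 0).
Proof.
apply: DeriveDef; first exact: pol_derivable (pol_coord k).
by rewrite -[in RHS](derive_id x v) derive_mx// mxE.
Qed.

Lemma is_derive_add f g x v (df dg : R) : is_derive x v f df -> is_derive x v g dg ->
  is_derive x v (fun y => f y + g y) (df + dg).
Proof. exact: is_deriveD. Qed.

Lemma is_derive_mul f g x v (df dg : R) : is_derive x v f df -> is_derive x v g dg ->
  is_derive x v (fun y => f y * g y) (df * g x + f x * dg).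
Proof.
move=> Hf Hg; apply: is_derive_eq (is_deriveM Hf Hg) _.
by rewrite addrC mulrC.
Qed.

Lemma is_derive_pol1 (k l m : R) x v :
  is_derive x v (fun y : V => k + l * y 0 0 + m * y 1 0) (l * v 0 0 + m * v 1 0).
Proof.
have c (z : R) : is_derive x v (fun _ : V => z) 0 by exact: is_derive_cst.
apply: is_derive_eq.
  exact: (is_derive_add (is_derive_add (c k)
    (is_derive_mul (c l) (is_derive_coord x v 0)))
    (is_derive_mul (c m) (is_derive_coord x v 1))).
by rewrite !mul0r !add0r.
Qed.

Lemma pol_is_derive r f v : pol r f ->
  exists2 g, pol r.-1 g & forall x, is_derive x v f (g x).
Proof.
elim: r f => [|r IH] f /=.
  move=> [k fk]; exists (fun _ => 0) => [|x]; first by exists 0.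
  by rewrite (_ : f = fun _ => k); [exact: is_derive_cst|exact/funext].
move=> [k [g [h [pg ph fE]]]].
have [[g' pg' dg] [h' ph' dh]] := (IH _ pg, IH _ ph).
exists (fun x => (v 0 0 * g x + x 0 0 * g' x) + (v 1 0 * h x + x 1 0 * h' x)).
  (* For an affine [f] the derivative must be constant, so the terms with [g'] and [h'] have to be
     shown to vanish; in higher degree they are absorbed by the degree count. *)
  case: r {IH} pg ph pg' ph' => [|r] pg ph pg' ph'.
    case: pg dg => kg gE dg; case: ph dh => kh hE dh.
    have g'0 x : g' x = 0.
      have [_ <-] := dg x; rewrite (_ : g = cst kg) ?derive_cst//; exact/funext.
    have h'0 x : h' x = 0.
      have [_ <-] := dh x; rewrite (_ : h = cst kh) ?derive_cst//; exact/funext.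
    by exists (v 0 0 * kg + v 1 0 * kh) => x; rewrite g'0 h'0 gE hE; ring.
  by apply: polD; apply: polD; do ?[exact: polZ|exact: (polM (pol_coord _))].
move=> x; rewrite (_ : f = fun x => k + x 0 0 * g x + x 1 0 * h x); last exact/funext.
have c : is_derive x v (fun _ : V => k) 0 by exact: is_derive_cst.
apply: is_derive_eq.
  exact: (is_derive_add (is_derive_add c
    (is_derive_mul (is_derive_coord x v 0) (dg x)))
    (is_derive_mul (is_derive_coord x v 1) (dh x))).
by rewrite add0r.
Qed.

Lemma pol_derive r f v : pol r f -> pol r.-1 ('D_v f).
Proof.
move=> /(pol_is_derive v)[g pg dg]; apply: pol_ext pg => x.
by have [_ ->] := dg x.
Qed.

End PlanePolynomials.

Lemma continuous_mxP (R : realType) (T : topologicalType) m n (f : T -> 'M[R]_(m, n)) :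
  (forall i j, continuous (fun x => f x i j)) -> continuous f.
Proof.
move=> cf x; apply/cvgrPdist_le => /= e e0; near=> y.
rewrite /Num.Def.normr/= mx_normrE (bigmax_le _ (ltW e0))//= => i _.
rewrite !mxE; move: i; near: y; apply: filter_forall => /= i.
exact: ((cvgrPdist_le _ _).1 (cf i.1 i.2 x)).
Unshelve. all: by end_near. Qed.

Lemma continuous_polyfun (R : realType) r m n (f : 'cV[R]_2 -> 'M[R]_(m, n)) :
  polyfun r f -> continuous f.
Proof.
by move=> /polyfun_mxP pf; apply: continuous_mxP => i j; apply: pol_continuous (pf i j).
Qed.

(** * Cyclic indices of the three vertices *)

Lemma ord3P (i : 'I_3) : [\/ i = 0, i = 1 | i = 2].
Proof.
by case: i => -[|[|[|//]]] ?; [apply: Or31|apply: Or32|apply: Or33]; exact: val_inj.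
Qed.

Lemma ordS3E : [/\ ordS (0 : 'I_3) = 1, ordS (1 : 'I_3) = 2 & ordS (2 : 'I_3) = 0].
Proof. by split; exact: val_inj. Qed.

Lemma ord_pred3E :
  [/\ ord_pred (0 : 'I_3) = 2, ord_pred (1 : 'I_3) = 0 & ord_pred (2 : 'I_3) = 1].
Proof. by split; exact: val_inj. Qed.

Lemma sum3 (W : nmodType) (F : 'I_3 -> W) : \sum_i F i = F 0 + F 1 + F 2.
Proof.
rewrite !big_ord_recl big_ord0 addr0 addrA; congr (_ + F _ + F _);
  exact: val_inj.
Qed.

Lemma sum3S (W : nmodType) (F : 'I_3 -> W) i :
  \sum_j F j = F i + F (ordS i) + F (ord_pred i).
Proof.
have [S0 S1 S2] := ordS3E; have [P0 P1 P2] := ord_pred3E.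
rewrite sum3; have [->|->|->] := ord3P i; rewrite ?(S0, S1, S2) ?(P0, P1, P2) //.
  by rewrite -addrA addrC.
by rewrite addrC addrA.
Qed.

Lemma ord3_cases (i j : 'I_3) : [\/ j = i, j = ordS i | j = ord_pred i].
Proof.
have [S0 S1 S2] := ordS3E; have [P0 P1 P2] := ord_pred3E.
by have [->|->|->] := ord3P i; have [->|->|->] := ord3P j;
  rewrite ?(S0, S1, S2) ?(P0, P1, P2); by [apply: Or31|apply: Or32|apply: Or33].
Qed.

Lemma ordSS3 (i : 'I_3) : ordS (ordS i) = ord_pred i.
Proof.
have [S0 S1 S2] := ordS3E; have [P0 P1 P2] := ord_pred3E.
by have [->|->|->] := ord3P i; rewrite ?(S0, S1, S2) ?(P0, P1, P2) ?(S0, S1, S2).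
Qed.

Lemma ord_predP3 (i : 'I_3) : ord_pred (ord_pred i) = ordS i.
Proof.
have [S0 S1 S2] := ordS3E; have [P0 P1 P2] := ord_pred3E.
by have [->|->|->] := ord3P i; rewrite ?(S0, S1, S2) ?(P0, P1, P2) ?(P0, P1, P2).
Qed.

Lemma ordS3_neq (i : 'I_3) : [/\ (ordS i == i) = false, (ord_pred i == i) = false
  & (ordS i == ord_pred i) = false].
Proof. by have [->|->|->] := ord3P i. Qed.

Lemma det_mx2 (R : comNzRingType) (M : 'M[R]_2) :
  \det M = M 0 0 * M 1 1 - M 0 1 * M 1 0.
Proof.
rewrite (expand_det_row _ 0) big_ord_recl big_ord1 /cofactor !det_mx11 !mxE /=.
rewrite [lift 0 ord0](_ : _ = 1); last exact: val_inj.
rewrite [lift 1 0](_ : _ = 0); last exact: val_inj.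
rewrite [bump _ _](_ : _ = 1%N)//= !add0n expr0 mul1r expr1 mulN1r mulrN.
by congr (M _ _ * _ - _); exact: val_inj.
Qed.

Lemma line_continuous (R : realType) m n (x v : 'M[R]_(m, n)) :
  continuous (fun s : R => x + s *: v).
Proof.
by move=> s; apply: cvgD; [exact: cvg_cst|apply: cvgZr_tmp; exact: cvg_id].
Qed.

(** * Barycentric coordinates *)

Section Barycentric.
Variables (R : realType) (a : 'I_3 -> 'cV[R]_2).
Implicit Types (x v : 'cV[R]_2) (i : 'I_3).

(** Twice the signed area; its sign, the orientation of the vertices, is left free and reappears as
    [Num.sg (tdet a)] in the integrations by parts. *)
Definition tdet : R := cross (a 1 - a 0) (a 2 - a 0).

Lemma nondegenerate_tdet : nondegenerate_triangle a <-> tdet != 0.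
Proof.
rewrite /nondegenerate_triangle /tdet.
suff -> : \det (row_mx (a 1 - a 0) (a 2 - a 0)) = cross (a 1 - a 0) (a 2 - a 0) by [].
have E0 k : row_mx (a 1 - a 0) (a 2 - a 0) k 0 = (a 1 - a 0) k 0.
  rewrite -[RHS](row_mxEl _ (a 2 - a 0)); congr (fun_of_matrix _ k _); exact: val_inj.
have E1 k : row_mx (a 1 - a 0) (a 2 - a 0) k 1 = (a 2 - a 0) k 0.
  rewrite -[RHS](row_mxEr (a 1 - a 0)); congr (fun_of_matrix _ k _); exact: val_inj.
rewrite det_mx2 (E0 0) (E1 1) (E0 1) (E1 0) /cross; ring.
Qed.

Definition bary i x : R := cross (a (ordS i) - x) (a (ord_pred i) - x) / tdet.

Hypothesis nd : tdet != 0.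

Lemma bary_sum x : \sum_i bary i x = 1.
Proof.
have [S0 S1 S2] := ordS3E; have [P0 P1 P2] := ord_pred3E.
rewrite sum3 /bary S0 S1 S2 P0 P1 P2 -!mulrDl.
rewrite (_ : _ + _ + _ = tdet) ?divff//.
by rewrite /tdet /cross !mxE; ring.
Qed.

Lemma bary_point x : \sum_i bary i x *: a i = x.
Proof.
have [S0 S1 S2] := ordS3E; have [P0 P1 P2] := ord_pred3E.
apply: (@scalerI _ _ tdet) => //; rewrite sum3 !scalerDr !scalerA.
rewrite /bary S0 S1 S2 P0 P1 P2 ![tdet * (_ / _)]mulrC !divfK//.
by apply: cv2P; rewrite /tdet /cross !mxE; ring.
Qed.

Lemma bary_vertex i j : bary i (a j) = (i == j)%:R.
Proof.
have [S0 S1 S2] := ordS3E; have [P0 P1 P2] := ord_pred3E.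
apply: (mulIf nd); rewrite divfK//.
by have [->|->|->] := ord3P i; have [->|->|->] := ord3P j;
  rewrite ?(S0, S1, S2) ?(P0, P1, P2) /= ?mul1r ?mul0r /tdet /cross !mxE; ring.
Qed.

Definition dbary i v : R := cross v (a (ordS i) - a (ord_pred i)) / tdet.

Lemma bary_shift i x (s : R) v : bary i (x + s *: v) = bary i x + s * dbary i v.
Proof.
by rewrite /bary /dbary /cross !mxE; field.
Qed.

Lemma bary_add i x v : bary i (x + v) = bary i x + dbary i v.
Proof. by have := bary_shift i x 1 v; rewrite scale1r mul1r. Qed.

Lemma dbary_lin i (s : R) v w : dbary i (s *: v + w) = s * dbary i v + dbary i w.
Proof. by rewrite /dbary mulrA -mulrDl; congr (_ / _); rewrite /cross !mxE; ring. Qed.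

Lemma dbary_sub i x y : dbary i (x - y) = bary i x - bary i y.
Proof. by rewrite -[x in RHS](subrKC y) bary_add addrAC subrr add0r. Qed.

Lemma bary_comb i (t : 'I_3 -> R) (p : 'I_3 -> 'cV[R]_2) : \sum_j t j = 1 ->
  bary i (\sum_j t j *: p j) = \sum_j t j * bary i (p j).
Proof.
move=> t1; have {}t1 : t 0 = 1 - t 1 - t 2 by move: t1; rewrite sum3; lra.
have -> : \sum_j t j *: p j = p 0 + t 1 *: (p 1 - p 0) + t 2 *: (p 2 - p 0).
  by rewrite sum3 t1; apply: cv2P; rewrite !mxE; ring.
by rewrite !bary_shift !dbary_sub sum3 t1; ring.
Qed.

Lemma bary_pol i : pol 1 (bary i).
Proof.
apply/pol1P; exists (bary i 0), (dbary i (e_ R 0)), (dbary i (e_ R 1)) => x.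
rewrite -[x in LHS]add0r bary_add -addrA; congr (_ + _).
rewrite mulrC [_ * x 1 0]mulrC -[X in _ + X]addr0 -(_ : dbary i 0 = 0); last first.
  by rewrite /dbary /cross !mxE; ring.
rewrite -!dbary_lin; congr dbary.
by apply: cv2P; rewrite !mxE/=; ring.
Qed.

Lemma is_derive_bary i x v : is_derive x v (bary i) (dbary i v).
Proof.
have /pol1P[k [l [m E]]] := bary_pol i.
rewrite (_ : bary i = fun y => k + l * y 0 0 + m * y 1 0); last exact/funext.
apply: is_derive_eq (is_derive_pol1 _ _ _ _ _) _.
have := bary_add i x v; rewrite !E !mxE; lra.
Qed.

Lemma triangleE x : triangle a x <-> forall i, 0 <= bary i x.
Proof.
split=> [[t [t0 t1] ->] i|b0]; last first.
  by exists (bary^~ x); rewrite ?bary_point//; split=> //; exact: bary_sum.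
rewrite bary_comb//; apply: sumr_ge0 => j _.
by rewrite bary_vertex mulr_ge0// ler0n.
Qed.

(** If [bary i x] were 0, a small step from [x] away from [a i] would make it negative without
    leaving the triangle. Conversely, three strict inequalities between continuous functions persist
    nearby. *)
Lemma interior_triangleE x : (triangle a)° x <-> forall i, 0 < bary i x.
Proof.
split=> [tx i|b0].
  have : 0 <= bary i x by apply/triangleE : i; exact: interior_subset.
  rewrite le_eqVlt => /predU1P[b0|//]; exfalso.
  have /nbhs_ballP[e /= e0] : nbhs (0 : R) (fun s => triangle a (x + s *: (x - a i))).
    by apply: (@line_continuous _ _ _ x (x - a i)); rewrite scale0r addr0.
  have e2 : 0 < e / 2 by rewrite divr_gt0.
  move=> /(_ (e / 2)) /= -/(_ _)/triangleE/(_ i).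
  rewrite bary_shift dbary_sub bary_vertex eqxx -b0 add0r sub0r mulrN1 oppr_ge0.
  rewrite leNgt e2 /=; suff eb : ball 0 e (e / 2) by move=> /(_ eb).
  by rewrite /ball/= sub0r normrN gtr0_norm// gtr_pMr// invf_lt1// ltr1n.
have : \forall y \near x, forall i, 0 < bary i y.
  apply: (@filter_forall _ _ _ _ (nbhs_filter x)) => i.
  have cb : continuous (bary i) by exact: pol_continuous (bary_pol i).
  exact: (cvgr_gt _ (cb x) _ (b0 i)).
by apply: filterS => y by_; apply/triangleE => i; exact/ltW.
Qed.

End Barycentric.

Lemma derive_polyfunE (R : realType) r m n (f : 'cV[R]_2 -> 'M[R]_(m, n)) v x i j :
  polyfun r f -> ('D_v f x) i j = 'D_v (fun y => f y i j) x.
Proof.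
move=> /polyfun_mxP pf; rewrite derive_mx ?mxE//.
by apply/derivable_mxP => k l; exact: pol_derivable (pf k l).
Qed.

Lemma derivable_polyfun (R : realType) r m n (f : 'cV[R]_2 -> 'M[R]_(m, n)) x v :
  polyfun r f -> derivable f x v.
Proof.
by move=> /polyfun_mxP pf; apply/derivable_mxP => k l; exact: pol_derivable (pf k l).
Qed.

Lemma polyfun_derive (R : realType) r m n (f : 'cV[R]_2 -> 'M[R]_(m, n)) v :
  polyfun r f -> polyfun r.-1 ('D_v f).
Proof.
move=> pf; apply/polyfun_mxP => i j.
apply: pol_ext (fun x => esym (derive_polyfunE v x i j pf)) _.
apply: pol_derive; move/polyfun_mxP: pf; exact.
Qed.

(** * Geometry of the split; continuity and class C^1 as matching conditions *)

Section CloughTocherGeometry.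
Variables (R : realType) (a : 'I_3 -> 'cV[R]_2) (c : 'cV[R]_2).
Hypothesis nd : tdet a != 0.
Hypothesis cint : (triangle a)° c.
Implicit Types (x v : 'cV[R]_2) (i j k : 'I_3).

Definition wt i : R := bary a i c.

Lemma wt_gt0 i : 0 < wt i.
Proof. by move: i; apply/interior_triangleE. Qed.

Lemma wt_ge0 i : 0 <= wt i. Proof. exact: ltW (wt_gt0 i). Qed.

Lemma wt_neq0 i : wt i != 0. Proof. by rewrite gt_eqF// wt_gt0. Qed.

Lemma wt_sum : \sum_i wt i = 1. Proof. exact: bary_sum. Qed.

Lemma wt_sum3 i : wt i = 1 - wt (ordS i) - wt (ord_pred i).
Proof. by have := wt_sum; rewrite (sum3S _ i); lra. Qed.

Definition spoke k : 'cV[R]_2 := a k - c.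

Lemma cross_spokes i : cross (spoke (ordS i)) (spoke (ord_pred i)) = tdet a * wt i.
Proof. by rewrite /wt /bary mulrC divfK. Qed.

Lemma spoke_sum : \sum_k wt k *: spoke k = 0.
Proof.
rewrite /spoke; under eq_bigr do rewrite scalerBr.
by rewrite sumrB -scaler_suml wt_sum scale1r bary_point// subrr.
Qed.

(* On the subtriangle [ct i] this is the barycentric coordinate of [c]. *)
Definition hat i x : R := bary a i x / wt i.

Definition dhat i v : R := dbary a i v / wt i.

Lemma hat_pol i : pol 1 (hat i).
Proof.
apply: pol_ext (polZ (wt i)^-1 (bary_pol nd i)) => x; exact: mulrC.
Qed.

Lemma hat_c i : hat i c = 1. Proof. exact: divff (wt_neq0 i). Qed.

Lemma hat_vertex i j : hat i (a j) = (i == j)%:R / wt i.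
Proof. by rewrite /hat bary_vertex. Qed.

Lemma hat_sum x : \sum_i wt i * hat i x = 1.
Proof.
rewrite -[RHS](bary_sum nd x); apply: eq_bigr => i _.
by rewrite mulrC divfK// wt_neq0.
Qed.

Lemma hat_point x : \sum_i (wt i * hat i x) *: a i = x.
Proof.
rewrite -[RHS](bary_point nd x); apply: eq_bigr => i _.
by rewrite mulrC divfK// wt_neq0.
Qed.

Lemma hat_shift i x (s : R) v : hat i (x + s *: v) = hat i x + s * dhat i v.
Proof. by rewrite /hat /dhat bary_shift// mulrDl mulrA. Qed.

Lemma dhat_lin i (s : R) v w : dhat i (s *: v + w) = s * dhat i v + dhat i w.
Proof. by rewrite /dhat dbary_lin mulrDl mulrA. Qed.

Lemma is_derive_hat i x v : is_derive x v (hat i) (dhat i v).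
Proof.
have c0 : is_derive x v (fun _ : 'cV[R]_2 => (wt i)^-1) 0 by exact: is_derive_cst.
apply: is_derive_eq (is_derive_mul (is_derive_bary nd i x v) c0) _.
by rewrite mulr0 addr0.
Qed.

Lemma dhat_spoke i k : dhat i (spoke k) = (i == k)%:R / wt i - 1.
Proof. by rewrite /dhat dbary_sub// mulrBl bary_vertex// divff// wt_neq0. Qed.

Lemma hat_spoke i k (s : R) : i != k -> hat i (c + s *: spoke k) = 1 - s.
Proof.
move=> /negPf ik; rewrite hat_shift hat_c dhat_spoke ik mul0r sub0r.
by rewrite mulrN1.
Qed.

Lemma hat_spoke_self k (s : R) :
  hat k (c + s *: spoke k) = 1 - s + s / wt k.
Proof. by rewrite hat_shift hat_c dhat_spoke eqxx mulrBr mulrA !mulr1 addrA addrAC. Qed.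

Lemma triangle_hatE x : triangle a x <-> forall i, 0 <= hat i x.
Proof.
rewrite triangleE//; split=> h i; first by rewrite divr_ge0// wt_ge0.
by have := mulr_ge0 (h i) (ltW (wt_gt0 i)); rewrite divfK// wt_neq0.
Qed.

Lemma interior_triangle_hatE x : (triangle a)° x <-> forall i, 0 < hat i x.
Proof.
rewrite interior_triangleE//; split=> h i; first by rewrite divr_gt0// wt_gt0.
by have := mulr_gt0 (h i) (wt_gt0 i); rewrite divfK// wt_neq0.
Qed.

(** In the cell [i] the barycentric coordinate of [c] is [hat i x] and that of [a j] is [wt j] times
    [hat j x - hat i x]. The split is thus described by comparing three affine functions. *)
Lemma ctE i x : ct a c i x <-> 0 <= hat i x /\ forall j, hat i x <= hat j x.
Proof.
split=> [[t [t0 t1] ->]|[h0 hj]].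
  have bj j : bary a j (\sum_k t k *: [eta a with i |-> c] k) =
      t i * wt j + (j != i)%:R * t j.
    rewrite bary_comb// (bigD1 i)//= eqxx; congr (_ + _).
    have [->|ji] := eqVneq j i.
      rewrite mul0r big1// => k ki.
      by rewrite (negbTE ki) bary_vertex// eq_sym (negbTE ki) mulr0.
    rewrite (bigD1 j)//= (negbTE ji) bary_vertex// eqxx mulr1 mul1r.
    rewrite big1 ?addr0// => k /andP[ki kj].
    by rewrite (negbTE ki) bary_vertex// eq_sym (negbTE kj) mulr0.
  have hj j : hat j (\sum_k t k *: [eta a with i |-> c] k) =
      t i + (j != i)%:R * t j / wt j.
    by rewrite /hat bj; field; exact: wt_neq0.
  rewrite !hj eqxx !mul0r addr0; split=> // j; rewrite hj.
  by rewrite lerDl divr_ge0 ?wt_ge0// mulr_ge0// ler0n.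
exists (fun j => if j == i then hat i x else wt j * (hat j x - hat i x)).
  split=> [j|].
    by case: ifP => // _; rewrite mulr_ge0 ?subr_ge0// wt_ge0.
  rewrite (bigD1 i)//= eqxx.
  have := hat_sum x; have := wt_sum; rewrite !(bigD1 i (P := xpredT))//=.
  under [X in _ -> _ -> _ + X = _]eq_bigr => j ji do
    rewrite (negbTE ji) mulrBr.
  have -> : \sum_(j < 3 | j != i) (wt j * hat j x - wt j * hat i x) =
      \sum_(j < 3 | j != i) wt j * hat j x - (\sum_(j < 3 | j != i) wt j) * hat i x.
    by rewrite sumrB mulr_suml.
  by move=> /(canRL (addKr _)) -> /(canRL (addKr _)) ->; ring.
rewrite -[LHS]hat_point !(bigD1 i (P := xpredT))//= eqxx.
under [X in _ = _ + X]eq_bigr => j ji do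
  rewrite (negbTE ji) mulrBr scalerBl.
have -> : \sum_(j < 3 | j != i) ((wt j * hat j x) *: a j - (wt j * hat i x) *: a j) =
    \sum_(j < 3 | j != i) (wt j * hat j x) *: a j -
    hat i x *: \sum_(j < 3 | j != i) wt j *: a j.
  rewrite sumrB scaler_sumr; congr (_ - _); apply: eq_bigr => j _.
  by rewrite scalerA mulrC.
have -> : \sum_(j < 3 | j != i) wt j *: a j = c - wt i *: a i.
  apply: (addrI (wt i *: a i)); rewrite [RHS]addrC subrK.
  by rewrite -[RHS](bary_point nd c) [RHS](bigD1 i).
by set S := \sum_(_ < _ | _) _; apply: cv2P; rewrite !mxE; ring.
Qed.

Lemma ct_triangle i x : ct a c i x -> triangle a x.
Proof. by move=> /ctE[h0 hj]; apply/triangle_hatE => j; exact: le_trans (hj j). Qed.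

Lemma triangle_ct x : triangle a x -> exists i, ct a c i x.
Proof.
move=> /triangle_hatE h0.
have [i _ hi] := arg_minP (hat^~ x) (erefl : xpredT (0 : 'I_3)).
by exists i; apply/ctE; split=> // j; exact: hi.
Qed.

Lemma ct_spoke i k (s : R) : i != k -> 0 <= s -> s <= 1 ->
  ct a c i (c + s *: spoke k).
Proof.
move=> ik s0 s1; apply/ctE; rewrite hat_spoke// subr_ge0; split=> // j.
have [->|jk] := eqVneq j k; last by rewrite hat_spoke.
by rewrite hat_spoke_self lerDl divr_ge0// wt_ge0.
Qed.

(** On the intersection both hats are minimal, hence equal. Together with the weighted sum of the
    hats being 1, their common value h is the only parameter left, and 1 - h is the position on the
    spoke. *)
Lemma ct_meet k x : ct a c (ordS k) x -> ct a c (ord_pred k) x ->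
  exists s : R, [/\ 0 <= s, s <= 1 & x = c + s *: spoke k].
Proof.
move=> /ctE[h0 hj] /ctE[_ hj'].
have hE : hat (ord_pred k) x = hat (ordS k) x by apply/le_anti; rewrite hj hj'.
have := hat_sum x; have := hat_point x; rewrite !(sum3S _ k) hE => xE h1.
have := hj k; set h := hat (ordS k) x in xE h1 h0 *.
have wk := wt_sum3 k; have w0 := wt_gt0 k => hk.
exists (1 - h); split.
- have : 0 <= wt k * (hat k x - h) by rewrite mulr_ge0 ?subr_ge0// ltW.
  by rewrite subr_ge0; nra.
- by lra.
- have := spoke_sum; rewrite (sum3S _ k) /spoke => sp.
  have -> : 1 - h = wt k * (hat k x - h) by nra.
  have cE : c = wt k *: a k + wt (ordS k) *: a (ordS k) + wt (ord_pred k) *: a (ord_pred k).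
    by rewrite -(sum3S (fun i => wt i *: a i)) bary_point.
  apply/eqP; rewrite -subr_eq0; apply/eqP.
  have e : x - c = wt k * (hat k x - h) *: a k + (h - 1) *: c.
    have e2 : wt (ordS k) *: a (ordS k) + wt (ord_pred k) *: a (ord_pred k) =
        c - wt k *: a k.
      apply/eqP; rewrite eq_sym subr_eq; apply/eqP.
      by rewrite [LHS]cE -addrA addrC.
    rewrite -[X in X - c]xE -addrA -[(wt (ordS k) * h) *: _]scalerA -[(wt (ord_pred k) * h) *: _]scalerA.
    have e3 (u v : 'cV[R]_2) (p q : R) : p *: (h *: u) + q *: (h *: v) = h *: (p *: u + q *: v).
      by apply: cv2P; rewrite !mxE; ring.
    by rewrite e3 e2; apply: cv2P; rewrite !mxE; ring.
  rewrite opprD addrA e; have -> : h - 1 = - (wt k * (hat k x - h)) by nra.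
  by apply: cv2P; rewrite !mxE; ring.
Qed.

Lemma ct_closed i : closed (ct a c i).
Proof.
rewrite (_ : ct a c i =
    [set x | 0 <= hat i x] `&` \bigcap_(j in setT) [set x | 0 <= hat j x - hat i x]).
  have cl (f : 'cV[R]_2 -> R) : pol 1 f -> closed [set x | 0 <= f x].
    move=> pf; have cf : continuous f := @pol_continuous _ _ _ pf.
    exact: (@preimage_closed _ _ f [set y | 0 <= y]
      (fun x _ => cf x) (@closed_ge _ 0)).
  apply: closedI; first by apply: cl; exact: hat_pol.
  by apply: closed_bigI => j _; apply: cl; apply: polB; exact: hat_pol.
apply/seteqP; split=> x.
  by move=> /ctE[h0 hj]; split=> //= j _ /=; rewrite subr_ge0.
by move=> [/= h0 hj]; apply/ctE; split=> // j; rewrite -subr_ge0; exact: hj.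
Qed.

Definition ct_center i : 'cV[R]_2 := 3^-1 *: (a (ordS i) + a (ord_pred i) + c).

Lemma hat_ct_center i j :
  hat j (ct_center i) = 3^-1 * (1 + (j != i)%:R / wt j).
Proof.
have -> : ct_center i = c + 3^-1 *: spoke (ordS i) + 3^-1 *: spoke (ord_pred i).
  by rewrite /ct_center /spoke; apply: cv2P; rewrite !mxE; field.
rewrite !hat_shift hat_c !dhat_spoke.
have [iS iP SP] := ordS3_neq i.
have PS : (ord_pred i == ordS i) = false by rewrite eq_sym.
have Si : (i == ordS i) = false by rewrite eq_sym.
have Pi : (i == ord_pred i) = false by rewrite eq_sym.
move: (wt j) (wt_neq0 j) => w w0.
by have [->|->|->] := ord3_cases i j;
  rewrite !eqxx ?(iS, iP, SP, PS, Si, Pi) /=; field.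
Qed.

Definition ct_inner i x : Prop := 0 < hat i x /\ forall j, j != i -> hat i x < hat j x.

Lemma ct_inner_center i : ct_inner i (ct_center i).
Proof.
split=> [|j ji]; rewrite !hat_ct_center eqxx/=.
  by rewrite mul0r addr0 mulr1 invr_gt0.
rewrite ji ltr_pM2l ?invr_gt0// ltrD2l mul0r.
by rewrite divr_gt0// wt_gt0.
Qed.

Lemma ct_inner_near i x : ct_inner i x -> \forall y \near x, ct_inner i y.
Proof.
move=> [h0 hj].
have ch j : continuous (hat j) by exact: pol_continuous (hat_pol j).
have n1 : \forall y \near x, 0 < hat i y by exact: (cvgr_gt _ (ch i x) _ h0).
have n2 : \forall y \near x, forall j, j != i -> hat i y < hat j y.
  apply: (@filter_forall _ _ _ _ (nbhs_filter x)) => j.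
  have [->|ji] := eqVneq j i; first by near=> y.
  have cb : continuous (fun y => hat j y - hat i y).
    exact: pol_continuous (polB (hat_pol j) (hat_pol i)).
  have ji0 : 0 < hat j x - hat i x by rewrite subr_gt0 hj.
  by apply: filterS (cvgr_gt _ (cb x) _ ji0) => y; rewrite subr_gt0.
by apply: filterS2 n1 n2.
Unshelve. all: by end_near. Qed.

Lemma ct_inner_ct i x : ct_inner i x -> ct a c i x.
Proof.
move=> [h0 hj]; apply/ctE; split=> [|j]; first exact: ltW.
by have [->//|ji] := eqVneq j i; exact/ltW/hj.
Qed.

Lemma ct_inner_interior i x : ct_inner i x -> (triangle a)° x.
Proof.
move=> [h0 hj]; apply/interior_triangle_hatE => j.
by have [->//|ji] := eqVneq j i; apply: lt_trans h0 _; exact: hj.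
Qed.

Lemma ct_inner_segment i x (s : R) : ct a c i x -> 0 < s -> s <= 1 ->
  ct_inner i (x + s *: (ct_center i - x)).
Proof.
move=> /ctE[h0 hj] s0 s1; have [b0 bj] := ct_inner_center i.
have hE j : hat j (x + s *: (ct_center i - x)) =
    (1 - s) * hat j x + s * hat j (ct_center i).
  rewrite hat_shift /dhat dbary_sub// mulrBl -!/(hat _ _); ring.
split=> [|j ji]; rewrite !hE.
  by apply: ltr_wpDl; [apply: mulr_ge0; rewrite ?subr_ge0|exact: mulr_gt0].
by apply: ler_ltD; [apply: ler_wpM2l; rewrite ?subr_ge0|rewrite ltr_pM2l// bj].
Qed.

Definition matching (W : Type) (u : 'I_3 -> 'cV[R]_2 -> W) : Prop :=
  forall i j x, ct a c i x -> ct a c j x -> u i x = u j x.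

(** On a spoke an arbitrary adjacent cell is chosen, which is immaterial under [matching]; the value
    outside the triangle is arbitrary. *)
Definition glue (W : Type) (u : 'I_3 -> 'cV[R]_2 -> W) x : W :=
  if pselect (exists i, ct a c i x) is left H then u (sval (cid H)) x else u 0 x.

Lemma glueP (W : Type) (u : 'I_3 -> 'cV[R]_2 -> W) :
  matching u -> glues a c u (glue u).
Proof.
move=> mu i x xi; rewrite /glue; case: pselect => [H|]; last by case; exists i.
by apply: mu => //; exact: svalP (cid H).
Qed.

Lemma glues_matching (W : Type) (u : 'I_3 -> 'cV[R]_2 -> W) g :
  glues a c u g -> matching u.
Proof. by move=> gu i j x xi xj; rewrite -(gu _ _ xi) -(gu _ _ xj). Qed.

Lemma triangle_ctU : triangle a = ct a c 0 `|` ct a c 1 `|` ct a c 2.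
Proof.
apply/seteqP; split=> [x /triangle_ct[i]|x [[]|]]; last 3 first.
- exact: ct_triangle.
- exact: ct_triangle.
- exact: ct_triangle.
by have [->|->|->] := ord3P i => ?; [left; left|left; right|right].
Qed.

Lemma glues_continuous (W : topologicalType) (u : 'I_3 -> 'cV[R]_2 -> W) g :
  glues a c u g -> (forall i, continuous (u i)) -> {within triangle a, continuous g}.
Proof.
move=> gu cu; rewrite triangle_ctU.
have cg i : {within ct a c i, continuous g}.
  apply: (@subspace_eq_continuous _ _ _ (u i)).
    by move=> x /[!inE] xi; exact/esym/gu.
  exact: continuous_subspaceT.
have cl i : closed (ct a c i) := @ct_closed i.
exact: (withinU_continuous (closedU (cl 0) (cl 1)) (cl 2)
  (withinU_continuous (cl 0) (cl 1) (cg 0) (cg 1)) (cg 2)).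
Qed.

Lemma C0P m n (u : 'I_3 -> 'cV[R]_2 -> 'M[R]_(m, n)) :
  (forall i, continuous (u i)) -> C0 a c u <-> matching u.
Proof.
move=> cu; split=> [[g gu _]|mu]; first exact: glues_matching gu.
by exists (glue u); [exact: glueP|apply: glues_continuous cu; exact: glueP].
Qed.

(** A point of the closed cell is approached along the segment to [ct_center i], which stays in the
    open cell. Identities known there extend to the spokes and edges, where [f] is continuous only
    relative to the triangle. *)
Lemma ct_limit (W : normedModType R) (f g : 'cV[R]_2 -> W) i x :
  {within triangle a, continuous f} -> continuous g -> ct a c i x ->
  (forall y, ct_inner i y -> f y = g y) -> f x = g x.
Proof.
move=> /subspace_continuousP cf cg xi fg.
pose y (s : R) := x + s *: (ct_center i - x).
have cy : y s @[s --> 0^'+] --> x.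
  have /cvg_at_right_filter : y s @[s --> (0 : R)] --> x.
    by rewrite -[x in _ --> x]addr0 -(scale0r (ct_center i - x)); exact: line_continuous.
  exact.
have ny : \forall s \near (0 : R)^'+, ct_inner i (y s).
  by near=> s; apply: ct_inner_segment => //; near: s; exact: nbhs_right_le.
have lf : f (y s) @[s --> 0^'+] --> f x.
  apply: cvg_comp (cf x (ct_triangle xi)) => A /= wA.
  have := cy _ wA => /=; rewrite /nbhs/=; apply: filterS2 ny => s yi; apply.
  exact: ct_triangle (ct_inner_ct yi).
have lg : g (y s) @[s --> 0^'+] --> g x by exact: cvg_comp cy (cg x).
apply: (cvg_unique (@norm_hausdorff _ W) lf); apply: cvg_trans lg.
apply: near_eq_cvg; apply: filterS ny => s ?.
exact/esym/fg.
Unshelve. all: by end_near. Qed.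

(** Forward: in an open cell the derivative of the glued function is that of the piece, and
    [ct_limit] carries this to the boundary of the cell. Backward: near an interior point [x], each
    difference quotient of the glued function is one of a piece whose cell contains [x], and those
    pieces share the same derivative at [x]. *)
Lemma C1P r m n (u : 'I_3 -> 'cV[R]_2 -> 'M[R]_(m, n)) :
  (forall i, polyfun r (u i)) ->
  C1 a c u <-> matching u /\ forall k : 'I_2, matching (fun i => 'D_(e_ R k) (u i)).
Proof.
move=> pu; have cu i : continuous (u i) := @continuous_polyfun _ _ _ _ _ (pu i).
have cDu i v : continuous ('D_v (u i)).
  exact: continuous_polyfun (polyfun_derive v (pu i)).
split=> [[g [gu cg h]]|[mu mDu]].
  split; first exact: glues_matching gu.
  move=> k; have [D cD gD] := h k; suff hE i x : ct a c i x -> D x = 'D_(e_ R k) (u i) x.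
    by move=> i j x xi xj; rewrite -hE// -hE.
  move=> xi; apply: (ct_limit cD (cDu i _) xi) => y yi.
  have [_ <-] := gD y (ct_inner_interior yi).
  apply: near_eq_derive; apply: filterS (ct_inner_near yi) => z zi.
  by apply: gu; exact: ct_inner_ct.
exists (glue u); split; first exact: glueP.
  by apply: glues_continuous cu; exact: glueP.
move=> k; exists (glue (fun i => 'D_(e_ R k) (u i))).
  by apply: glues_continuous (fun i => cDu i _); exact: glueP.
move=> x xT; set v := e_ R k; set D := glue _ x.
suff : is_derive x v (glue u) D by move=> [].
have gD i : ct a c i x -> D = 'D_v (u i) x by exact: (glueP (mDu k)).
have cl : continuous (fun t : R => t *: v + x).
  by under eq_fun do rewrite addrC; exact: line_continuous.
have cl0 : (t *: v + x) @[t --> 0^'] --> x.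
  have := cl 0; rewrite /continuous_at scale0r add0r.
  by apply: cvg_trans; apply: cvg_app; exact: cvg_within.
have nT : \forall t \near (0 : R)^', triangle a (t *: v + x).
  have : nbhs x (triangle a)° by apply: open_nbhs_nbhs; split=> //; exact: open_interior.
  by move=> /cl0 h; near=> t; apply: interior_subset; near: t; exact: h.
(* Cells are closed, so a cell that misses [x] misses a neighbourhood of [x]; there are finitely
   many of them. *)
have nct : \forall t \near (0 : R)^', forall i, ct a c i (t *: v + x) -> ct a c i x.
  apply: filter_forall => i.
  have [xi|nxi] := pselect (ct a c i x); first exact: nearW.
  have : nbhs x (~` ct a c i).
    apply: open_nbhs_nbhs; split=> //; apply: closed_openC.
    exact: (@ct_closed i).
  move=> /cl0 h; near=> t; have : (~` ct a c i) (t *: v + x) by near: t; exact: h.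
  by move=> nt /nt.
have cv : (fun t : R => t^-1 *: (glue u (t *: v + x) - glue u x)) @ 0^' --> D.
  apply/cvgrPdist_lt => e e0.
  have nq : \forall t \near (0 : R)^', forall i, ct a c i x ->
      `|D - t^-1 *: (u i (t *: v + x) - u i x)| < e.
    apply: filter_forall => i.
    have [xi|nxi] := pselect (ct a c i x); last exact: nearW.
    have du : derivable (u i) x v by exact: (derivable_polyfun (pu i)).
    have h := (cvgrPdist_lt _ _).1 du e e0.
    by near=> t => _; rewrite (gD _ xi); near: t; exact: h.
  apply: filterS3 nT nct nq => t tT tct tq.
  have [i ti] := triangle_ct tT; have xi := tct _ ti.
  by rewrite (glueP mu ti) (glueP mu xi); exact: tq.
apply: DeriveDef; first by apply/cvg_ex; exists D.
exact: cvg_lim cv.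
Unshelve. all: by end_near. Qed.

End CloughTocherGeometry.

(** * Affine changes of variables for the plane Lebesgue measure *)

Section PlaneMeasure.
Variable R : realType.
Local Notation mu := (@lebesgue_measure R).
Local Notation RT := (measurableTypeR R).

(** By uniqueness of the Lebesgue measure it is enough to compare on half-open intervals. For
    negative [al] the preimage is open at the other end, but has the same length. *)
Lemma lebesgue_measure_affine (al be : R) (A : set RT) : al != 0 -> measurable A ->
  (mu A = `|al|%:E * mu ((fun x : RT => (al * x + be)%R : RT) @^-1` A))%E.
Proof.
move=> al0 mA; set f := fun x : RT => (al * x + be : RT).
have mf : measurable_fun [set: RT] f.
  by apply: measurable_funD => //; apply: measurable_funM.
pose m : {measure set RT -> \bar R} := mscale (NngNum (normr_ge0 al))
  (measure_function_pushforward__canonical__measure_function_Measure mu mf).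
have h X : ocitv X -> mu X = m X.
  move=> [[p q] _ <-]; rewrite /m /= /mscale/= /pushforward/=.
  have [al_gt0|al_le0] := ltP 0 al.
    have -> : f @^-1` `]p, q]%classic = `](p - be) / al, (q - be) / al]%classic.
      apply/seteqP; split=> x; rewrite /= !in_itv/= ltr_pdivrMr// ler_pdivlMr//;
        by rewrite /f ltrBlDr lerBrDr mulrC.
    rewrite !lebesgue_measure_itv/= !lte_fin ltr_pM2r ?invr_gt0// ltrD2r.
    case: ifP => _; last by rewrite mule0.
    by rewrite gtr0_norm// -!EFinD -EFinM; congr EFin; field.
  have {al0 al_le0}al_lt0 : al < 0 by rewrite lt_neqAle al0.
  have -> : f @^-1` `]p, q]%classic = `[(q - be) / al, (p - be) / al[%classic.
    apply/seteqP; split=> x; rewrite /= !in_itv/= ler_ndivrMr// ltr_ndivlMr//;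
      by rewrite /f lerBrDr ltrBlDr mulrC andbC.
  rewrite !lebesgue_measure_itv/= !lte_fin ltr_nM2r ?invr_lt0// ltrD2r.
  case: ifP => _; last by rewrite mule0.
  have ? : al != 0 by rewrite lt_eqF.
  by rewrite ltr0_norm// -!EFinD -EFinM; congr EFin; field.
by rewrite (lebesgue_measure_unique h mA).
Qed.

(** For an affine map, [k] is the absolute value of the determinant. Stated on preimages, the
    property composes without inverse maps. *)
Definition area_factor (k : R) (phi : RT * RT -> RT * RT) : Prop :=
  measurable_fun setT phi /\
  forall X, measurable X -> (leb2 X = k%:E * leb2 (phi @^-1` X))%E.

Lemma area_factor_comp k l phi psi : area_factor k phi -> area_factor l psi ->
  area_factor (k * l) (phi \o psi).
Proof.
move=> [mphi kphi] [mpsi lpsi]; split; first exact: measurableT_comp.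
move=> X mX; rewrite kphi// lpsi; first by rewrite muleA EFinM.
by rewrite -[_ @^-1` _]setTI; exact: mphi.
Qed.

Lemma area_factor_shear (al k be : R) : al != 0 ->
  area_factor `|al| (fun z => (z.1, al * z.2 + (k * z.1 + be))).
Proof.
move=> al0; set phi := fun _ => _.
have mphi : measurable_fun setT phi.
  apply/measurable_fun_pairP; split=> /=; first exact: measurable_fst.
  apply: measurable_funD; first by apply: measurable_funM => //; exact: measurable_snd.
  by apply: measurable_funD => //; apply: measurable_funM => //; exact: measurable_fst.
split=> // X mX; have mpX : measurable (phi @^-1` X).
  by rewrite -[_ @^-1` _]setTI; exact: mphi.
rewrite /leb2 /product_measure1 -ge0_integralZl//; last first.
  exact: measurable_fun_xsection.
apply: eq_integral => x _ /=.
by rewrite (@lebesgue_measure_affine al (k * x + be))//; exact: measurable_xsection.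
Qed.

Lemma area_factor_swap : area_factor 1 (fun z => (z.2, z.1)).
Proof.
split; first exact: measurable_swap.
move=> X mX; rewrite mul1e.
transitivity ((mu \x^ mu)%E X).
  by apply: product_measure_unique => // A B mA mB; exact: product_measure2E.
rewrite /leb2 /product_measure1 /product_measure2; apply: eq_integral => x _ /=.
by congr (mu _); apply/seteqP; split=> y /=; rewrite /xsection/ysection/= !inE.
Qed.

Definition aff2 (p v w : 'cV[R]_2) (z : RT * RT) : RT * RT :=
  (p 0 0 + z.1 * v 0 0 + z.2 * w 0 0, p 1 0 + z.1 * v 1 0 + z.2 * w 1 0).

(** When the first coordinate of [v] is nonzero this is an LU factorisation: two shears, one of them
    conjugated by the swap of coordinates. Otherwise [v] and [w] are exchanged, the first coordinate
    of [w] being nonzero since [cross v w] is. *)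
Lemma area_factor_aff2 p v w : cross v w != 0 -> area_factor `|cross v w| (aff2 p v w).
Proof.
wlog v0 : v w / v 0 0 != 0.
  move=> h vw; have [v0|?] := eqVneq (v 0 0) 0; last exact: h.
  have wv : cross w v != 0 by move: vw; rewrite /cross; apply: contraNneq; lra.
  have w0 : w 0 0 != 0.
    by apply: contraNneq vw => w0; rewrite /cross v0 w0; apply/eqP; ring.
  have := area_factor_comp (h _ _ w0 wv) area_factor_swap.
  rewrite mulr1 (_ : `|cross w v| = `|cross v w|); last first.
    by rewrite -normrN; congr (`| _ |); rewrite /cross; ring.
  rewrite (_ : _ \o _ = aff2 p v w)//; apply/funext => z.
  by rewrite /aff2/=; congr pair; ring.
move=> vw; have w1 : cross v w / v 0 0 != 0 by rewrite mulf_neq0// invr_eq0.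
have s1 := area_factor_comp (area_factor_comp area_factor_swap
  (area_factor_shear (w 0 0) (p 0 0) v0)) area_factor_swap.
have s2 := area_factor_shear (v 1 0 / v 0 0) (p 1 0 - p 0 0 * v 1 0 / v 0 0) w1.
have := area_factor_comp s2 s1.
rewrite mul1r mulr1 -normrM divfK// (_ : _ \o _ = aff2 p v w)//.
apply/funext => z; rewrite /aff2/= /cross; congr pair; first ring.
by field.
Qed.

End PlaneMeasure.

(** * Integrals on segments and on the reference simplex *)

Section SegmentIntegrals.
Variable R : realType.
Local Notation mu := (@lebesgue_measure R).

Lemma integrable_segment (f : R -> R) (l : R) : continuous f ->
  mu.-integrable `[0, l] (EFin \o f).
Proof.
move=> cf; apply: continuous_compact_integrable; first exact: segment_compact.
exact: continuous_subspaceT.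
Qed.

Lemma Rintegral_segment_lin (f g : R -> R) (k l : R) : continuous f -> continuous g ->
  \int[mu]_(s in `[0, l]) (k * f s + g s) =
  k * \int[mu]_(s in `[0, l]) f s + \int[mu]_(s in `[0, l]) g s.
Proof.
move=> cf cg; rewrite RintegralD//; last 2 first.
- by apply: integrable_segment => s; apply: cvgM; [exact: cvg_cst|exact: cf].
- exact: integrable_segment.
by rewrite RintegralZl//; exact: integrable_segment.
Qed.

Lemma integral_segment_derive (f F : R -> R) (l : R) : 0 <= l -> continuous f ->
  (forall s : R, is_derive s (1 : R) F (f s)) ->
  (\int[mu]_(s in `[0%R, l]) (f s)%:E = (F l - F 0)%:E)%E.
Proof.
rewrite le_eqVlt => /predU1P[<-|l0] cf dF.
  by rewrite set_itv1 integral_set1 subrr.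
have cF : continuous F.
  by move=> s; apply/differentiable_continuous/derivable1_diffP; have [] := dF s.
rewrite (continuous_FTC2 l0 (F := F)) ?EFinB//.
- exact: continuous_subspaceT.
- split; first by move=> s _; have [] := dF s.
    exact: (cvg_at_right_filter (cF 0)).
  exact: (cvg_at_left_filter (cF l)).
- by move=> s _; rewrite derive1E; have [_ ->] := dF s.
Qed.

Lemma Rintegral_segment_cubic (c0 c1 c2 c3 l : R) : 0 <= l ->
  \int[mu]_(s in `[0, l]) (c0 + c1 * s + c2 * s ^+ 2 + c3 * s ^+ 3) =
  c0 * l + c1 * l ^+ 2 / 2 + c2 * l ^+ 3 / 3 + c3 * l ^+ 4 / 4.
Proof.
move=> l0.
pose p : {poly R} := c0%:P + c1%:P * 'X + c2%:P * 'X^2 + c3%:P * 'X^3.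
pose q : {poly R} := c0%:P * 'X + (c1 / 2)%:P * 'X^2 + (c2 / 3)%:P * 'X^3
  + (c3 / 4)%:P * 'X^4.
have qp s : q^`().[s] = p.[s].
  by rewrite /q /p !poly.derivE !hornerE /=; field.
rewrite /Rintegral.
have -> : (fun s : R => (c0 + c1 * s + c2 * s ^+ 2 + c3 * s ^+ 3)%:E) =
    (fun s => p.[s]%:E) by apply/funext => s; rewrite !hornerE.
have dq s : is_derive (s : R) (1 : R) (horner q) p.[s].
  by rewrite -qp; exact: is_derive_poly.
have cp : continuous (horner p) by exact: continuous_horner.
by rewrite (integral_segment_derive l0 cp dq)/= !hornerE /=; field.
Qed.

End SegmentIntegrals.

Section SimplexIntegral.
Variable R : realType.
Local Notation mu := (@lebesgue_measure R).
Local Notation RT := (measurableTypeR R).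

Definition simplex2 : set (R * R) := [set z | [/\ 0 <= z.1, 0 <= z.2 & z.1 + z.2 <= 1]].

Definition sint (G : R * R -> R) : R := \int[leb2 (R:=R)]_(z in (simplex2 : set (RT * RT))) G z.

Lemma measurable_box (p : R * R) (e : R) : measurable ((ball p e : set (R * R)) : set (RT * RT)).
Proof.
rewrite (_ : ball p e = (ball p.1 e : set RT) `*` (ball p.2 e : set RT)).
  by apply: measurableX; exact: measurable_ball.
by apply/seteqP; split=> -[x y].
Qed.

(** Pairs carry the product sigma-algebra, generated by rectangles. An open set belongs to it as a
    countable union of balls with rational centres and radii 1/(k+1), such balls being products of
    intervals. *)
Lemma open_plane_measurable (U : set (R * R)) : open U -> measurable (U : set (RT * RT)).
Proof.
move=> oU.
pose B (q r : rat) (k : nat) : set (RT * RT) :=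
  let b := (ball ((ratr q, ratr r) : R * R) k.+1%:R^-1 : set (R * R)) in
  if `[< b `<=` U >] then b else set0.
rewrite (_ : (U : set (RT * RT)) = \bigcup_q \bigcup_r \bigcup_k B q r k).
  apply: bigcupT_measurable_rat => q; apply: bigcupT_measurable_rat => r.
  apply: bigcupT_measurable => k; rewrite /B /=; case: ifP => // _.
  exact: measurable_box.
apply/seteqP; split=> [z Uz|z [q _ [r _ [k _]]]]; last first.
  by rewrite /B /=; case: asboolP => // bU /bU.
have /nbhs_ballP[e /= e0 eU] : nbhs z U by exact: open_nbhs_nbhs.
have [k _ ke] : exists2 k, True & k.+1%:R^-1 < e / 2.
  have [k ke] := ltr_add_invr (divr_gt0 e0 (ltr0Sn R 1)).
  by exists k => //; move: ke; rewrite add0r.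
have rat_near (x : R) : exists q : rat, `|ratr q - x| < k.+1%:R^-1.
  have [|q] := @rat_in_itvoo R (x - k.+1%:R^-1) (x + k.+1%:R^-1).
    by rewrite ltrBlDr -addrA ltrDl addr_gt0// invr_gt0.
  by rewrite in_itv/= -ltr_distl; exists q.
have [q qx] := rat_near z.1; have [r rx] := rat_near z.2.
exists q => //; exists r => //; exists k => //; rewrite /B /=.
case: asboolP => [bU|[]]; first by split.
move=> y [/= y1 y2]; apply: eU; split=> /=.
  rewrite /ball/=; rewrite /ball/= in y1.
  by rewrite -(subrKA (ratr q)) (le_lt_trans (ler_normD _ _))// (splitr e) ltrD// ?(distrC z.1) (lt_trans _ ke).
rewrite /ball/=; rewrite /ball/= in y2.
by rewrite -(subrKA (ratr r)) (le_lt_trans (ler_normD _ _))// (splitr e) ltrD// ?(distrC z.2) (lt_trans _ ke).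
Qed.

Lemma continuous_plane_measurable (G : R * R -> R) : continuous G ->
  measurable_fun setT (G : RT * RT -> RT).
Proof.
move=> /continuousP cG; apply: (measurability _ (RGenOpens.measurableE R)).
move=> _ [_ [x [y ->] <-]]; rewrite setTI; apply: open_plane_measurable.
exact/cG/interval_open.
Qed.

Lemma measurable_simplex2 : measurable (simplex2 : set (RT * RT)).
Proof.
rewrite (_ : simplex2 = [set z | 0 <= z.1] `&` [set z | 0 <= z.2] `&`
   [set z | 0 <= 1 - z.1 - z.2]).
  have cl (f : R * R -> R) : continuous f -> measurable ([set z | 0 <= f z] : set (RT * RT)).
    move=> cf; rewrite -[X in measurable X]setCK; apply: measurableC.
    apply: open_plane_measurable; apply: closed_openC.
    exact: (@preimage_closed _ _ f [set y | 0 <= y] (fun x _ => cf x) (@closed_ge _ 0)).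
  apply: measurableI; first apply: measurableI.
  - by apply: cl => z; exact: cvg_fst.
  - by apply: cl => z; exact: cvg_snd.
  - apply: cl => z; apply: cvgB; last exact: cvg_snd.
    by apply: cvgB; [exact: cvg_cst|exact: cvg_fst].
apply/seteqP; split=> [z [? ? ?]|z [[/= ? ?] ?]]; first by split=> //=; lra.
by split=> //; lra.
Qed.

Lemma continuous_simplex2_bounded (G : R * R -> R) : continuous G ->
  exists M, forall z, simplex2 z -> `|G z| <= M.
Proof.
move=> cG.
have K : compact (`[0%R, 1%R]%classic `*` `[0%R, 1%R]%classic : set (R * R)).
  by apply: compact_setX; exact: segment_compact.
have := continuous_compact (continuous_subspaceT cG) K.
move=> /compact_bounded[M [_ /(_ (M + 1))]] h.
exists (M + 1) => z [z1 z2 z3]; apply: h; first by rewrite ltrDl.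
exists z => //; split; rewrite /= in_itv/= ?z1 ?z2/=; lra.
Qed.

Lemma leb2_simplex2_lty : (leb2 (simplex2 : set (RT * RT)) < +oo)%E.
Proof.
have mI : measurable (`[0%R, 1%R]%classic : set RT) by exact: measurable_itv.
apply: (@le_lt_trans _ _ (leb2 ((`[0%R, 1%R]%classic : set RT) `*` (`[0%R, 1%R]%classic : set RT)))).
  apply: le_measure; rewrite ?inE//; first exact: measurable_simplex2.
    exact: measurableX.
  move=> z [z1 z2 z3]; split; rewrite /= in_itv/= ?z1 ?z2/=; lra.
rewrite /leb2 product_measure1E// [X in (X * _)%E]lebesgue_measure_itv/=.
rewrite [X in (_ * X)%E]lebesgue_measure_itv/= lte_fin ltr01.
by rewrite -EFinB -EFinM ltry.
Qed.

Lemma integrable_simplex2 (G : R * R -> R) : continuous G ->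
  (leb2 (R:=R)).-integrable (simplex2 : set (RT * RT)) (EFin \o G).
Proof.
move=> cG; have [M HM] := continuous_simplex2_bounded cG.
apply: measurable_bounded_integrable.
- exact: measurable_simplex2.
- exact: leb2_simplex2_lty.
- by apply: measurable_funTS; exact: continuous_plane_measurable.
- exists M; split; first exact: num_real.
  by move=> N MN z /HM Gz; apply: le_trans Gz (ltW MN).
Qed.

End SimplexIntegral.

(** The push-forward formula is applied to the positive and negative parts separately; integrability
    over the preimage makes both integrals finite, so [k] distributes over their difference. *)
Lemma Rintegral_image d d' (X : measurableType d) (Y : measurableType d') (R : realType)
    (mu : {measure set X -> \bar R}) (nu : {measure set Y -> \bar R})
    (phi : X -> Y) (k : R) (K : set Y) (g : Y -> R) :
  measurable_fun setT phi -> 0 <= k ->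
  (forall A, measurable A -> (nu A = k%:E * mu (phi @^-1` A))%E) ->
  measurable K -> measurable_fun setT g ->
  mu.-integrable (phi @^-1` K) (EFin \o (g \o phi)) ->
  \int[nu]_(z in K) g z = k * \int[mu]_(z in phi @^-1` K) g (phi z).
Proof.
move=> mphi k0 kphi mK mg ig.
have mphiK : measurable (phi @^-1` K) by rewrite -[_ @^-1` _]setTI; exact: mphi.
pose pf := measure_function_pushforward__canonical__measure_function_Measure mu mphi.
pose m : {measure set Y -> \bar R} := mscale (NngNum k0) pf.
have ge0 (h : Y -> \bar R) : measurable_fun setT h -> (forall z, 0 <= h z)%E ->
    (\int[nu]_(z in K) h z = k%:E * \int[mu]_(z in phi @^-1` K) h (phi z))%E.
  move=> mh h0; rewrite (@eq_measure_integral _ _ _ K m); last first.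
    by move=> A mA _; exact: kphi.
  have mKh : measurable_fun K h by exact: measurable_funTS.
  rewrite (ge0_integral_mscale pf mK (NngNum k0) mKh) => [|z _]; last exact: h0.
  by rewrite (ge0_integral_pushforward mphi mu mK mKh) => [//|z _]; exact: h0.
have mEg : measurable_fun setT (EFin \o g) by exact/measurable_EFinP.
rewrite /Rintegral integralE [in RHS]integralE.
have -> : (\int[nu]_(z in K) ((EFin \o g)^\+ z) =
    k%:E * \int[mu]_(z in phi @^-1` K) ((EFin \o (g \o phi))^\+ z))%E.
  have mf := measurable_funepos mEg.
  rewrite [LHS](ge0 _ mf (funepos_ge0 _)); congr (_ * _)%E.
  by apply: eq_integral => z _; rewrite !funeposE.
have -> : (\int[nu]_(z in K) ((EFin \o g)^\- z) =
    k%:E * \int[mu]_(z in phi @^-1` K) ((EFin \o (g \o phi))^\- z))%E.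
  have mf := measurable_funeneg mEg.
  rewrite [LHS](ge0 _ mf (funeneg_ge0 _)); congr (_ * _)%E.
  by apply: eq_integral => z _; rewrite !funenegE.
have fp := integrable_pos_fin_num mphiK ig.
have fn := integrable_neg_fin_num mphiK ig.
have key (A B : \bar R) : A \is a fin_num -> B \is a fin_num ->
    fine (k%:E * A - k%:E * B)%E = k * fine (A - B)%E.
  by case: A B => [x| |] [y| |] //= _ _; rewrite mulrBr.
exact: key.
Qed.

(** * Integration by parts on the reference simplex *)

Section SimplexCalculus.
Variable R : realType.
Local Notation mu := (@lebesgue_measure R).
Local Notation RT := (measurableTypeR R).
Implicit Types G H : R * R -> R.

Lemma continuous_section2 G (x : R) : continuous G -> continuous (fun y : R => G (x, y)).
Proof.
move=> cG y; have cp : (x, t) @[t --> y] --> (x, y).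
  by apply: (@cvg_pair _ _ _ (nbhs y) (nbhs x) (nbhs y)); [exact: cvg_cst|exact: cvg_id].
exact: cvg_comp cp (cG (x, y)).
Qed.

Lemma continuous_swap G : continuous G -> continuous (fun z => G (z.2, z.1)).
Proof.
move=> cG z; have cp : (t.2, t.1) @[t --> z] --> (z.2, z.1).
  by apply: (@cvg_pair _ _ _ (nbhs z) (nbhs z.2) (nbhs z.1)); [exact: cvg_snd|exact: cvg_fst].
exact: cvg_comp cp (cG (z.2, z.1)).
Qed.

Lemma sint_lin (k : R) G H : continuous G -> continuous H ->
  sint (fun z => k * G z + H z) = k * sint G + sint H.
Proof.
move=> cG cH; rewrite /sint RintegralD; last 3 first.
- exact: measurable_simplex2.
- by apply: integrable_simplex2 => z; apply: cvgM; [exact: cvg_cst|exact: cG].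
- exact: integrable_simplex2.
by rewrite RintegralZl//; [exact: measurable_simplex2|exact: integrable_simplex2].
Qed.

(** Fubini, then the fundamental theorem on each vertical section. The upper end of the section lies
    on the hypotenuse, where [H] vanishes, so only the leg on the first axis contributes. *)
Lemma sint_derive2 G H : continuous G ->
  (forall x y : R, is_derive y (1 : R) (fun y => H (x, y)) (G (x, y))) ->
  (forall s, H (s, 1 - s) = 0) ->
  sint G = \int[mu]_(s in `[0, 1]) - H (s, 0).
Proof.
move=> cG dH H0; rewrite /sint /Rintegral; congr fine.
have mS := @measurable_simplex2 R.
rewrite integral_mkcond -integral12_prod_meas1; last first.
  exact: ((integrable_mkcond _ mS).1 (integrable_simplex2 cG)).
rewrite [RHS]integral_mkcond; apply: eq_integral => x _.
rewrite /fubini_F /patch; case: ifPn => [|x01]; last first.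
  rewrite integral0_eq// => y _; case: ifPn => // /set_mem[/= x0 y0 xy].
  case/negP: x01; rewrite inE/= in_itv/= x0/=; lra.
rewrite inE/= in_itv/= => /andP[x0 x1].
have cGx : continuous (fun y => G (x, y))  by exact: continuous_section2.
have x1' : 0 <= 1 - x by rewrite subr_ge0.
have := integral_segment_derive x1' cGx (dH x).
rewrite H0 sub0r => <-; rewrite [RHS]integral_mkcond; apply: eq_integral => y _.
rewrite /patch; congr (if _ then _ else _); apply/idP/idP; rewrite !inE/= in_itv/=.
  by move=> [/= ? ? ?]; apply/andP; split=> //; lra.
by move=> /andP[? ?]; split=> //=; lra.
Qed.

Lemma area_factor_integral (k : R) (phi : RT * RT -> RT * RT) (K : set (RT * RT))
    (g : RT * RT -> R) : 0 <= k -> area_factor k phi -> measurable K ->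
  measurable_fun setT g -> (leb2 (R:=R)).-integrable (phi @^-1` K) (EFin \o (g \o phi)) ->
  \int[leb2 (R:=R)]_(z in K) g z = k * \int[leb2 (R:=R)]_(z in phi @^-1` K) g (phi z).
Proof. by move=> k0 [mphi kphi]; exact: Rintegral_image. Qed.

Lemma sint_swap G : continuous G -> sint (fun z => G (z.2, z.1)) = sint G.
Proof.
move=> cG.
have sw : (fun z : R * R => (z.2, z.1)) @^-1` simplex2 (R:=R) = simplex2 (R:=R).
  by apply/seteqP; split=> z [/= ? ? ?]; split=> //=; lra.
have cGs : continuous (fun z => G (z.2, z.1)) by exact: continuous_swap.
rewrite [RHS](area_factor_integral ler01 (area_factor_swap R)).
- by rewrite sw mul1r.
- exact: measurable_simplex2.
- exact: continuous_plane_measurable.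
- by rewrite sw; exact: integrable_simplex2.
Qed.

Lemma sint_derive1 G H : continuous G ->
  (forall x y : R, is_derive x (1 : R) (fun x => H (x, y)) (G (x, y))) ->
  (forall s, H (1 - s, s) = 0) ->
  sint G = \int[mu]_(s in `[0, 1]) - H (0, s).
Proof.
move=> cG dH H0; rewrite -sint_swap//.
have cs : continuous (fun z => G (z.2, z.1)) by exact: continuous_swap.
exact: (@sint_derive2 (fun z => G (z.2, z.1)) (fun z => H (z.2, z.1)) cs (fun x y => dH y x) H0).
Qed.

Lemma sint_affine (k l m : R) : sint (fun z => k + l * z.1 + m * z.2) = k / 2 + l / 6 + m / 6.
Proof.
(* The primitive in the second variable that vanishes on the hypotenuse. *)
pose H (z : R * R) := (k + l * z.1) * (z.2 - (1 - z.1)) + m / 2 * (z.2 ^+ 2 - (1 - z.1) ^+ 2).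
have cG : continuous (fun z : R * R => k + l * z.1 + m * z.2).
  move=> z; apply: cvgD.
    by apply: cvgD; [exact: cvg_cst|apply: cvgM; [exact: cvg_cst|exact: cvg_fst]].
  by apply: cvgM; [exact: cvg_cst|exact: cvg_snd].
have dH (x y : R) : is_derive y (1 : R) (fun y => H (x, y)) (k + l * x + m * y).
  rewrite /H/=.
  pose p : {poly R} := (k + l * x)%:P * ('X - (1 - x)%:P) + (m / 2)%:P * ('X^2 - ((1 - x) ^+ 2)%:P).
  have -> : (fun y => (k + l * x) * (y - (1 - x)) + m / 2 * (y ^+ 2 - (1 - x) ^+ 2)) = horner p.
    by apply/funext => t; rewrite /p !hornerE.
  have -> : k + l * x + m * y = p^`().[y] by rewrite /p !poly.derivE !hornerE/=; field.
  exact: is_derive_poly.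
have H0 s : H (s, 1 - s) = 0 by rewrite /H/=; ring.
transitivity (\int[mu]_(s in `[0, 1]) ((k + m / 2) + (l - k - m) * s + (m / 2 - l) * s ^+ 2 + 0 * s ^+ 3)).
  rewrite (@sint_derive2 _ H cG dH H0).
  by apply: eq_Rintegral => s _; rewrite /H/=; field.
by rewrite Rintegral_segment_cubic//; field.
Qed.

End SimplexCalculus.

(** * Directional derivatives of functions with continuous partial derivatives *)

Section DirectionalDerivatives.
Variable R : realType.
Local Notation V := 'cV[R]_2.
Implicit Types (x v w O : V) (f F : V -> R).

Lemma is_derive_line f O v (s d : R) : is_derive (O + s *: v) v f d ->
  is_derive s (1 : R) (fun t : R => f (O + t *: v)) d.
Proof.
move=> [df Df].
have E : (fun h : R => h^-1 *: ((f \o shift (O + s *: v)) (h *: v) - f (O + s *: v))) =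
         (fun h : R => h^-1 *: (((fun t : R => f (O + t *: v)) \o shift s) (h *: (1 : R)) - f (O + s *: v))).
  apply/funext => h /=; congr (_ *: (f _ - _)).
  by apply: cv2P; rewrite !mxE /GRing.scale/=; ring.
apply: DeriveDef; first by move: df; rewrite /derivable E.
by rewrite -Df /derive E.
Qed.

Lemma mean_value (g g' : R -> R) (y : R) : (forall t : R, is_derive t (1 : R) g (g' t)) ->
  exists2 xi, `|xi| <= `|y| & g y - g 0 = y * g' xi.
Proof.
move=> dg.
have cg : continuous g.
  by move=> s; apply/differentiable_continuous/derivable1_diffP; have [] := dg s.
have [y0|y0] := leP 0 y.
  have [|xi] := @MVT_segment R g g' 0 y y0 (fun t _ => dg t).
    exact: continuous_subspaceT.
  rewrite in_itv/= => /andP[a0 ay] ->; exists xi; last by rewrite subr0 mulrC.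
  by rewrite !ger0_norm.
have [|xi] := @MVT_segment R g g' y 0 (ltW y0) (fun t _ => dg t).
  exact: continuous_subspaceT.
rewrite in_itv/= => /andP[ya a0] e; exists xi.
  by rewrite !ler0_norm// ?lerN2// ltW.
by rewrite -[LHS]opprB e sub0r mulrN opprK mulrC.
Qed.

(** Smoothness of test functions is expressed by partial derivatives along the axes, whereas cells
    are integrated along their spokes. The increment is cut into two axis-parallel steps, with the
    mean value theorem on each. *)
Lemma C1_is_derive f f0 f1 x v : continuous f0 -> continuous f1 ->
  (forall y, is_derive y (e_ R 0) f (f0 y)) -> (forall y, is_derive y (e_ R 1) f (f1 y)) ->
  is_derive x v f (v 0 0 * f0 x + v 1 0 * f1 x).
Proof.
move=> c0 c1 d0 d1.
suff : (fun h : R => h^-1 *: ((f \o shift x) (h *: v) - f x)) @ 0^' -->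
    v 0 0 * f0 x + v 1 0 * f1 x.
  by move=> cv; apply: DeriveDef; [apply/cvg_ex; eexists; exact: cv|exact: cvg_lim cv].
(* The summand 1 keeps [K] positive when v = 0 and makes the last estimate strict. *)
pose K := `|v 0 0| + `|v 1 0| + 1.
have K0 : 0 < K by rewrite ltr_wpDl// addr_ge0.
apply/cvgrPdist_lt => e e0.
have eK : 0 < e / K by rewrite divr_gt0.
have /nbhs_ballP[r0 /= r00 h0] : nbhs x (fun y => `|f0 x - f0 y| < e / K).
  exact: (cvgrPdist_lt _ _).1 (c0 x) _ eK.
have /nbhs_ballP[r1 /= r10 h1] : nbhs x (fun y => `|f1 x - f1 y| < e / K).
  exact: (cvgrPdist_lt _ _).1 (c1 x) _ eK.
pose r := Num.min r0 r1.
have rK : 0 < r / K by rewrite divr_gt0// lt_min r00.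
near=> h.
have hr : `|h| * K < r.
  by rewrite -ltr_pdivlMr//; near: h; exact: dnbhs0_lt.
have hn0 : h != 0 by near: h; exact: nbhs_dnbhs_neq.
have [xi xih xiE] := @mean_value (fun t => f (x + t *: e_ R 0)) (fun t => f0 (x + t *: e_ R 0))
  (h * v 0 0) (fun t => is_derive_line (d0 _)).
have [et eth etE] := @mean_value (fun t => f ((x + (h * v 0 0) *: e_ R 0) + t *: e_ R 1))
  (fun t => f1 ((x + (h * v 0 0) *: e_ R 0) + t *: e_ R 1))
  (h * v 1 0) (fun t => is_derive_line (d1 _)).
rewrite !scale0r !addr0 in xiE etE.
rewrite /=; have -> : f (h *: v + x) = f (x + (h * v 0 0) *: e_ R 0 + (h * v 1 0) *: e_ R 1).
  rewrite /=; congr f; apply: cv2P; rewrite !mxE/=; ring.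
have -> : h^-1 *: (f (x + (h * v 0 0) *: e_ R 0 + (h * v 1 0) *: e_ R 1) - f x) =
    v 0 0 * f0 (x + xi *: e_ R 0) + v 1 0 * f1 (x + (h * v 0 0) *: e_ R 0 + et *: e_ R 1).
  rewrite -[LHS]/(_ * _) -(subrK (f (x + (h * v 0 0) *: e_ R 0)) (f _)) -addrA xiE etE.
  by field.
have vK0 : `|h| * `|v 0 0| < r.
  by apply: le_lt_trans hr; rewrite ler_wpM2l// /K -addrA lerDl addr_ge0.
have vK1 : `|h| * `|v 1 0| < r.
  by apply: le_lt_trans hr; rewrite ler_wpM2l// /K [_ + `|v 1 0|]addrC -addrA lerDl addr_ge0.
have B0 : `|f0 x - f0 (x + xi *: e_ R 0)| < e / K.
  apply: h0; split=> // i j; rewrite /ball/= ord1 !mxE opprD addrA subrr sub0r normrN.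
  have [->|->] := ord2P i; rewrite /= ?mulr1 ?mulr0 ?normr0//.
  by apply: le_lt_trans xih _; rewrite normrM (lt_le_trans vK0)// ge_min lexx.
have B1 : `|f1 x - f1 (x + (h * v 0 0) *: e_ R 0 + et *: e_ R 1)| < e / K.
  apply: h1; split=> // i j; rewrite /ball/= ord1 !mxE.
  have [->|->] := ord2P i; rewrite /= ?mulr1 ?mulr0 ?addr0 opprD addrA subrr sub0r normrN.
    by rewrite normrM (lt_le_trans vK0)// ge_min lexx orbT.
  by apply: le_lt_trans eth _; rewrite normrM (lt_le_trans vK1)// ge_min lexx orbT.
rewrite (_ : _ - _ = v 0 0 * (f0 x - f0 (x + xi *: e_ R 0)) +
  v 1 0 * (f1 x - f1 (x + (h * v 0 0) *: e_ R 0 + et *: e_ R 1))); last by ring.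
apply: le_lt_trans (ler_normD _ _) _; rewrite !normrM.
apply: (@le_lt_trans _ _ ((`|v 0 0| + `|v 1 0|) * (e / K))).
  by rewrite mulrDl lerD// ler_wpM2l// ltW.
by rewrite mulrA ltr_pdivrMr// mulrC ltr_pM2l// /K ltrDl.
Unshelve. all: by end_near. Qed.

End DirectionalDerivatives.

Section SmoothFunctions.
Variable R : realType.
Local Notation V := 'cV[R]_2.
Implicit Types (x v w O : V) (f g F : V -> R).

Lemma Cn_continuous n f : Cn n f -> continuous f.
Proof. by case: n => [|n] []. Qed.

Lemma CnS n f : Cn n.+1 f -> Cn n f.
Proof.
elim: n f => [|n IH] f; first by move=> [].
by move=> [cf df]; split=> // k; have [dfk /IH] := df k.
Qed.

Lemma Cn_derivable n f x k : Cn n.+1 f -> derivable f x (e_ R k).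
Proof. by move=> [_ /(_ k)[]]. Qed.

Lemma Cn_derive n f k : Cn n.+1 f -> Cn n ('D_(e_ R k) f).
Proof. by move=> [_ /(_ k)[]]. Qed.

Lemma Cn1_is_derive n f x v : Cn n.+1 f ->
  is_derive x v f (v 0 0 * 'D_(e_ R 0) f x + v 1 0 * 'D_(e_ R 1) f x).
Proof.
move=> cf.
have c0 : continuous ('D_(e_ R 0) f) := Cn_continuous (Cn_derive 0 cf).
have c1 : continuous ('D_(e_ R 1) f) := Cn_continuous (Cn_derive 1 cf).
have d k y : is_derive y (e_ R k) f ('D_(e_ R k) f y).
  by apply/derivableP; exact: Cn_derivable cf.
exact: (C1_is_derive x v c0 c1 (d 0) (d 1)).
Qed.

Lemma Cn1_derive n f v : Cn n.+1 f ->
  'D_v f = fun x => v 0 0 * 'D_(e_ R 0) f x + v 1 0 * 'D_(e_ R 1) f x.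
Proof. by move=> cf; apply/funext => x; have [_ ->] := Cn1_is_derive x v cf. Qed.

Lemma Cn1_derive_lin n f x (k l : R) v w : Cn n.+1 f ->
  'D_(k *: v + l *: w) f x = k * 'D_v f x + l * 'D_w f x.
Proof.
move=> cf; have E u := derive_val (is_derive := Cn1_is_derive x u cf).
rewrite (E (k *: v + l *: w)) (E v) (E w).
move: ('D_(e_ R 0) f x) ('D_(e_ R 1) f x) => p q; rewrite !mxE; ring.
Qed.

Lemma Cn1_continuous_derive n f v : Cn n.+1 f -> continuous ('D_v f).
Proof.
move=> cf; rewrite (Cn1_derive _ cf) => x.
have c0 := Cn_continuous (Cn_derive 0 cf); have c1 := Cn_continuous (Cn_derive 1 cf).
exact: (cvgD (cvgM (cvg_cst _) (c0 x)) (cvgM (cvg_cst _) (c1 x))).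
Qed.

Lemma Cn_add n f g : Cn n f -> Cn n g -> Cn n (fun x => f x + g x).
Proof.
elim: n f g => [|n IH] f g.
  by move=> [cf _] [cg _]; split=> // x; exact: (cvgD (cf x) (cg x)).
move=> [cf df] [cg dg]; split; first by move=> x; exact: (cvgD (cf x) (cg x)).
move=> k; have [[dfk cfk] [dgk cgk]] := (df k, dg k).
have E x := is_derive_add (derivableP (dfk x)) (derivableP (dgk x)).
split; first by move=> x; have [] := E x.
rewrite (_ : 'D_(e_ R k) _ = fun x => 'D_(e_ R k) f x + 'D_(e_ R k) g x).
  exact: IH.
by apply/funext => x; have [_] := E x.
Qed.

Lemma Cn_mul n f g : Cn n f -> Cn n g -> Cn n (fun x => f x * g x).
Proof.
elim: n f g => [|n IH] f g.
  by move=> [cf _] [cg _]; split=> // x; exact: (cvgM (cf x) (cg x)).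
move=> Cf Cg; have [cf df] := Cf; have [cg dg] := Cg.
split; first by move=> x; exact: (cvgM (cf x) (cg x)).
move=> k; have [[dfk cfk] [dgk cgk]] := (df k, dg k).
have E x := is_derive_mul (derivableP (dfk x)) (derivableP (dgk x)).
split; first by move=> x; have [] := E x.
rewrite (_ : 'D_(e_ R k) _ = fun x => 'D_(e_ R k) f x * g x + f x * 'D_(e_ R k) g x).
  by apply: Cn_add; apply: IH => //; exact: CnS.
by apply/funext => x; have [_] := E x.
Qed.

Lemma pol_Cn r f n : pol r f -> Cn n f.
Proof.
elim: n r f => [|n IH] r f pf; split=> //; try exact: pol_continuous pf.
move=> k; split; first by move=> x; exact: (pol_derivable pf).
by apply: IH (pol_derive _ pf).
Qed.

End SmoothFunctions.

Lemma cross_decomp (R : realType) (v t t' : 'cV[R]_2) : cross t t' != 0 ->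
  v = (cross v t' / cross t t') *: t + (cross t v / cross t t') *: t'.
Proof. by move=> d0; apply: cv2P; rewrite !mxE /cross; field; exact: d0. Qed.

Lemma sint_comb (R : realType) (k l : R) (G H : R * R -> R) :
  continuous G -> continuous H ->
  sint (fun z => k * G z + l * H z) = k * sint G + l * sint H.
Proof.
move=> cG cH; have mS := @measurable_simplex2 R.
have ck (m : R) (K : R * R -> R) : continuous K -> continuous (fun z => m * K z).
  by move=> cK z; exact: (cvgM (cvg_cst _) (cK z)).
have cGk := ck k _ cG; have cHl := ck l _ cH.
rewrite /sint RintegralD//; [|exact: integrable_simplex2|exact: integrable_simplex2].
by rewrite !RintegralZl//; exact: integrable_simplex2.
Qed.

(** * Integration over the cells *)

Section CloughTocherIntegrals.
Variables (R : realType) (a : 'I_3 -> 'cV[R]_2) (c : 'cV[R]_2).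
Hypothesis nd : tdet a != 0.
Hypothesis cint : (triangle a)° c.
Local Notation V := 'cV[R]_2.
Local Notation mu := (@lebesgue_measure R).
Local Notation RT := (measurableTypeR R).
Implicit Types (x v : V) (i j : 'I_3).
Local Notation spoke := (spoke a c).
Local Notation hat := (hat a c).
Local Notation wt := (wt a c).

(** The legs of the simplex go to the two spokes of the cell and the hypotenuse to the outer edge,
    so functions that vanish on the boundary of the triangle leave spoke terms only. *)
Definition ctmap i (z : R * R) : V :=
  c + z.1 *: spoke (ordS i) + z.2 *: spoke (ord_pred i).

Lemma hat_ctmap i z :
  [/\ hat i (ctmap i z) = 1 - z.1 - z.2,
      hat (ordS i) (ctmap i z) = 1 - z.1 - z.2 + z.1 / wt (ordS i) &
      hat (ord_pred i) (ctmap i z) = 1 - z.1 - z.2 + z.2 / wt (ord_pred i)].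
Proof.
have [iS iP SP] := ordS3_neq i.
have PS : (ord_pred i == ordS i) = false by rewrite eq_sym.
have Si : (i == ordS i) = false by rewrite eq_sym.
have Pi : (i == ord_pred i) = false by rewrite eq_sym.
have E j : hat j (ctmap i z) = 1 + z.1 * ((j == ordS i)%:R / wt j - 1) +
    z.2 * ((j == ord_pred i)%:R / wt j - 1).
  by rewrite /ctmap !hat_shift// hat_c// !dhat_spoke.
have := (wt_neq0 nd cint (ordS i), wt_neq0 nd cint (ord_pred i)).
rewrite !E !eqxx ?(iS, iP, SP, PS, Si, Pi) /= => -[w1 w2].
move: (wt i) (wt (ordS i)) (wt (ord_pred i)) w1 w2 => w w' w'' w1 w2.
by split; rewrite ?mul0r; [ring|field|field].
Qed.

Lemma ct_ctmap i z : ct a c i (ctmap i z) <-> simplex2 z.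
Proof.
have [h0 h1 h2] := hat_ctmap i z.
have w1 := wt_gt0 nd cint (ordS i); have w2 := wt_gt0 nd cint (ord_pred i).
rewrite ctE// h0; split=> [[z0 zj]|[/= z1 z2 z3]].
  have := zj (ordS i); have := zj (ord_pred i).
  rewrite h1 h2 !lerDl !pmulr_lge0 ?invr_gt0// => z2 z1.
  by split=> //; lra.
split=> [|j]; first lra.
have [->|->|->] := ord3_cases i j; rewrite ?h0 ?h1 ?h2//.
  by rewrite lerDl divr_ge0// ltW.
by rewrite lerDl divr_ge0// ltW.
Qed.

Lemma continuous_vec2 : continuous (fun z : R * R => vec2 z.1 z.2 : V).
Proof.
apply: continuous_mxP => i j z; rewrite ord1.
have [->|->] := ord2P i.
  rewrite (_ : (fun _ => _) = fst); last by apply/funext => t; rewrite mxE.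
  exact: cvg_fst.
rewrite (_ : (fun _ => _) = snd); last by apply/funext => t; rewrite mxE.
exact: cvg_snd.
Qed.

Lemma continuous_ctmap i : continuous (ctmap i).
Proof.
move=> z; apply: cvgD; last by apply: cvgZr_tmp; exact: cvg_snd.
by apply: cvgD; [exact: cvg_cst|apply: cvgZr_tmp; exact: cvg_fst].
Qed.

Lemma measurable_planar_ct i : measurable (planar (ct a c i) : set (RT * RT)).
Proof.
rewrite -[X in measurable X]setCK; apply: measurableC.
apply: open_plane_measurable; apply: closed_openC.
have cv := continuous_vec2.
exact: (@preimage_closed _ _ (fun z : R * R => vec2 z.1 z.2 : V) (ct a c i)
  (fun z _ => cv z) (@ct_closed _ _ _ nd cint i)).
Qed.

Lemma integral2_ct i (f : V -> R) : continuous f ->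
  integral2 (ct a c i) f = `|tdet a| * wt i * sint (f \o ctmap i).
Proof.
move=> cf.
have d0 : cross (spoke (ordS i)) (spoke (ord_pred i)) != 0.
  by rewrite cross_spokes// mulf_neq0// wt_neq0.
have E (z : R * R) : vec2 (aff2 c (spoke (ordS i)) (spoke (ord_pred i)) z).1
    (aff2 c (spoke (ordS i)) (spoke (ord_pred i)) z).2 = ctmap i z.
  by apply: cv2P; rewrite /aff2 /ctmap /= !mxE.
have pS : aff2 c (spoke (ordS i)) (spoke (ord_pred i)) @^-1` planar (ct a c i) = simplex2 (R:=R).
  by apply/seteqP; split=> z; rewrite /planar/= E => /ct_ctmap.
have cfc : continuous (f \o ctmap i).
  by move=> z; apply: continuous_comp; [exact: continuous_ctmap|exact: cf].
have cfv : continuous (fun z : R * R => f (vec2 z.1 z.2)).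
  by move=> z; apply: continuous_comp; [exact: continuous_vec2|exact: cf].
rewrite /integral2 (area_factor_integral (normr_ge0 _) (area_factor_aff2 c d0)).
- rewrite pS cross_spokes// normrM (gtr0_norm (wt_gt0 nd cint i)); congr (_ * _).
  by apply: eq_Rintegral => z _; rewrite E.
- exact: measurable_planar_ct.
- exact: continuous_plane_measurable.
- rewrite pS (_ : _ \o _ = EFin \o (f \o ctmap i)); first exact: integrable_simplex2.
  by apply/funext => z /=; rewrite E.
Qed.

Definition spoke_integral k (f : V -> R) : R :=
  \int[mu]_(s in `[0, 1]) f (c + s *: spoke k).

Lemma continuous_line (f : V -> R) (O v : V) : continuous f ->
  continuous (fun s : R => f (O + s *: v)).
Proof.
by move=> cf s; apply: continuous_comp; [exact: line_continuous|exact: cf].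
Qed.

Lemma spoke_integral_lin k (l : R) (f g : V -> R) : continuous f -> continuous g ->
  spoke_integral k (fun x => l * f x + g x) = l * spoke_integral k f + spoke_integral k g.
Proof.
move=> cf cg; rewrite /spoke_integral.
have cl (h : V -> R) : continuous h -> continuous (fun s : R => h (c + s *: spoke k)).
  by move=> ch; exact: continuous_line.
exact: (@Rintegral_segment_lin R (fun s => f (c + s *: spoke k))
  (fun s => g (c + s *: spoke k)) l 1 (cl _ cf) (cl _ cg)).
Qed.

Lemma spoke_integral_eq k (f g : V -> R) :
  (forall s, 0 <= s <= 1 -> f (c + s *: spoke k) = g (c + s *: spoke k)) ->
  spoke_integral k f = spoke_integral k g.
Proof. by move=> fg; apply: eq_Rintegral => s; rewrite inE/= in_itv/= => /fg. Qed.

Lemma spoke_integralN k (f : V -> R) : continuous f ->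
  \int[mu]_(s in `[0, 1]) - f (c + s *: spoke k) = - spoke_integral k f.
Proof.
move=> cf.
have c0 : continuous (fun _ : V => 0 : R) by exact: (@cst_continuous V R 0).
have := spoke_integral_lin k (-1) cf c0; rewrite mulN1r => E.
have E0 : spoke_integral k (fun _ => 0) = 0.
  by rewrite /spoke_integral Rintegral_cst// mul0r.
move: E; rewrite E0 addr0 => <-; apply: eq_Rintegral => s _.
by rewrite mulN1r addr0.
Qed.

Lemma integral2_ct_derive i (F : V -> R) v : Cn 1 F ->
  (forall s, F (ctmap i (s, 1 - s)) = 0) ->
  integral2 (ct a c i) ('D_v F) =
  Num.sg (tdet a) * (cross v (spoke (ordS i)) * spoke_integral (ordS i) F
                   - cross v (spoke (ord_pred i)) * spoke_integral (ord_pred i) F).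
Proof.
move=> CF F0; have cF := Cn_continuous CF.
set t := spoke (ordS i); set t' := spoke (ord_pred i).
have w0 := wt_neq0 nd cint i.
have dE : cross t t' = tdet a * wt i by exact: cross_spokes.
have d0 : cross t t' != 0 by rewrite dE mulf_neq0.
have cD w : continuous ('D_w F) by exact: Cn1_continuous_derive CF.
rewrite (integral2_ct i (cD v)).
have vE : v = (cross v t' / cross t t') *: t + (cross t v / cross t t') *: t'.
  exact: cross_decomp.
have DE x : 'D_v F x = (cross v t' / cross t t') * 'D_t F x + (cross t v / cross t t') * 'D_t' F x.
  by rewrite {1}vE; exact: Cn1_derive_lin CF.
have -> : 'D_v F \o ctmap i = fun z => (cross v t' / cross t t') * ('D_t F \o ctmap i) z
     + (cross t v / cross t t') * ('D_t' F \o ctmap i) z.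
  by apply/funext => z /=; rewrite DE.
have cDc w : continuous ('D_w F \o ctmap i).
  by move=> z; apply: continuous_comp; [exact: continuous_ctmap|exact: cD].
rewrite (sint_comb _ _ (cDc t) (cDc t')).
have dF w y : is_derive y w F ('D_w F y).
  by apply: derivableP; have [] := Cn1_is_derive y w CF.
have d1 (x y : R) : is_derive x (1 : R) (fun p : R => (F \o ctmap i) (p, y)) (('D_t F \o ctmap i) (x, y)).
  rewrite /comp /ctmap/=.
  have e s : c + s *: t + y *: t' = c + y *: t' + s *: t by rewrite addrAC.
  by rewrite (funext (fun s => congr1 F (e s))) e; exact: is_derive_line.
have d2 (x y : R) : is_derive y (1 : R) (fun p : R => (F \o ctmap i) (x, p)) (('D_t' F \o ctmap i) (x, y)).
  by rewrite /comp /ctmap/=; exact: is_derive_line.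
have e1 s : (F \o ctmap i) (1 - s, s) = 0 by have := F0 (1 - s); rewrite subKr.
have S1 : sint ('D_t F \o ctmap i) = - spoke_integral (ord_pred i) F.
  rewrite (@sint_derive1 _ _ (F \o ctmap i) (cDc t) d1 e1) -spoke_integralN//.
  by apply: eq_Rintegral => s _; rewrite /ctmap/= scale0r addr0.
have S2 : sint ('D_t' F \o ctmap i) = - spoke_integral (ordS i) F.
  rewrite (@sint_derive2 _ _ (F \o ctmap i) (cDc t') d2 F0) -spoke_integralN//.
  by apply: eq_Rintegral => s _; rewrite /ctmap/= scale0r addr0.
rewrite S1 S2 dE normrEsg.
have -> : cross t v = - cross v t by rewrite /cross; ring.
move: (cross v t) (cross v t') (spoke_integral _ F) (spoke_integral _ F) => p q l m.
move: (Num.sg (tdet a)) => sg.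
by move: (tdet a) (wt i) nd w0 => d w hd hw; field; rewrite hd hw.
Qed.

End CloughTocherIntegrals.

(** * The distribution sven as cell terms plus spoke densities *)

Section WeakSven.
Variables (R : realType) (a : 'I_3 -> 'cV[R]_2) (c : 'cV[R]_2).
Hypothesis nd : tdet a != 0.
Hypothesis cint : (triangle a)° c.
Local Notation V := 'cV[R]_2.
Implicit Types (x v : V) (i j k : 'I_3) (f : V -> R) (l m : 'I_2).
Local Notation spoke := (spoke a c).
Local Notation SI := (spoke_integral a c).
Local Notation bint := (bintegral a c).

(** A local form of the support condition: vanishing in a neighbourhood, rather than at a point,
    passes to derivatives, and it includes the outer edges. *)
Definition vanishing f : Prop :=
  forall x, ~ (triangle a)° x -> \forall y \near x, f y = 0.

Lemma test_vanishing f : test_function (triangle a) f -> vanishing f.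
Proof.
move=> [_ _ sf] x nx.
have : nbhs x (~` closure [set y | f y != 0]).
  apply: open_nbhs_nbhs; split; last by move=> /sf.
  by apply: closed_openC; exact: closed_closure.
apply: filterS => y ny; apply/eqP/negPn/negP => fy; apply: ny.
exact: subset_closure.
Qed.

Lemma vanishing_eq0 f x : vanishing f -> ~ (triangle a)° x -> f x = 0.
Proof. by move=> zf /zf; exact: nbhs_singleton. Qed.

Lemma vanishing_derive f v : vanishing f -> vanishing ('D_v f).
Proof.
move=> zf x /zf /nbhs_interior h; apply: filterS h => y fy.
by rewrite (@near_eq_derive _ _ _ f (cst 0)) ?derive_cst.
Qed.

Lemma bint_lin (p : R) (f g : 'I_3 -> V -> R) :
  (forall i, continuous (f i)) -> (forall i, continuous (g i)) ->
  bint (fun i x => p * f i x + g i x) = p * bint f + bint g.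
Proof.
move=> cf cg; rewrite /bintegral mulr_sumr -big_split; apply: eq_bigr => i _ /=.
have cfg : continuous (fun x => p * f i x + g i x).
  by move=> x; exact: (cvgD (cvgM (cvg_cst _) (cf i x)) (cg i x)).
have cc (h : V -> R) : continuous h -> continuous (h \o ctmap a c i).
  by move=> ch z; apply: continuous_comp; [exact: continuous_ctmap|exact: ch].
rewrite (integral2_ct nd cint i cfg) (integral2_ct nd cint i (cf i)).
rewrite (integral2_ct nd cint i (cg i)) (_ : (fun _ => _) \o _ =
  fun z => p * (f i \o ctmap a c i) z + (g i \o ctmap a c i) z)//.
by rewrite (sint_lin p (cc _ (cf i)) (cc _ (cg i))); ring.
Qed.

Lemma bint_add (f g : 'I_3 -> V -> R) :
  (forall i, continuous (f i)) -> (forall i, continuous (g i)) ->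
  bint (fun i x => f i x + g i x) = bint f + bint g.
Proof.
move=> cf cg; rewrite -[bint f in RHS]mul1r -bint_lin//; congr bint.
by apply/funext => i; apply/funext => x; rewrite mul1r.
Qed.

(** Each spoke bounds two cells, which see it with opposite signs; regrouping the cell contributions
    by spoke produces differences. *)
Lemma bint_derive (F : 'I_3 -> V -> R) v : (forall i, Cn 1 (F i)) ->
  (forall i x, ~ (triangle a)° x -> F i x = 0) ->
  bint (fun i => 'D_v (F i)) = Num.sg (tdet a) *
    \sum_k cross v (spoke k) * (SI k (F (ord_pred k)) - SI k (F (ordS k))).
Proof.
move=> CF F0.
have E i : integral2 (ct a c i) ('D_v (F i)) = Num.sg (tdet a) *
    (cross v (spoke (ordS i)) * SI (ordS i) (F i) -
     cross v (spoke (ord_pred i)) * SI (ord_pred i) (F i)).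
  apply: integral2_ct_derive => // s; apply: F0.
  move=> /(interior_triangle_hatE nd cint)/(_ i).
  by have [-> _ _] := hat_ctmap nd cint i (s, 1 - s); rewrite subrr ltxx.
rewrite /bintegral; under eq_bigr do rewrite E.
rewrite -mulr_sumr; congr (_ * _).
have gen (p : 'I_3 -> R) (q : 'I_3 -> 'I_3 -> R) :
    \sum_i (p (ordS i) * q (ordS i) i - p (ord_pred i) * q (ord_pred i) i) =
    \sum_k p k * (q k (ord_pred k) - q k (ordS k)).
  have [S0 S1 S2] := ordS3E; have [P0 P1 P2] := ord_pred3E.
  by rewrite !sum3 S0 S1 S2 P0 P1 P2; ring.
exact: (gen (fun k => cross v (spoke k)) (fun k i => SI k (F i))).
Qed.

Lemma ct_spokes k s : 0 <= s <= 1 ->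
  ct a c (ordS k) (c + s *: spoke k) /\ ct a c (ord_pred k) (c + s *: spoke k).
Proof.
move=> /andP[s0 s1]; have [kS kP _] := ordS3_neq k.
by split; apply: ct_spoke => //; rewrite ?kS ?kP.
Qed.

(** Two integrations by parts. The first leaves no spoke term because [g] is continuous across
    spokes; the second leaves the jump of the first derivative of [g], integrated against [f]. *)
Lemma weak_second r (g : 'I_3 -> V -> R) f l m : (forall i, pol r (g i)) ->
  matching a c g -> Cn 2 f -> vanishing f ->
  bint (fun i x => g i x * 'D_(e_ R l) ('D_(e_ R m) f) x) =
  bint (fun i x => 'D_(e_ R m) ('D_(e_ R l) (g i)) x * f x) -
  Num.sg (tdet a) * \sum_k cross (e_ R m) (spoke k) *
    SI k (fun x => ('D_(e_ R l) (g (ord_pred k)) x - 'D_(e_ R l) (g (ordS k)) x) * f x).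
Proof.
move=> pg mg cf zf.
have cg i : Cn 1 (g i) := pol_Cn 1 (pg i).
have pDg i : pol r.-1 ('D_(e_ R l) (g i)) := pol_derive (e_ R l) (pg i).
have cDg i : Cn 1 ('D_(e_ R l) (g i)) := pol_Cn 1 (pDg i).
have cDf : Cn 1 ('D_(e_ R m) f) := Cn_derive m cf.
have cf1 : Cn 1 f := CnS cf.
pose F1 i x := g i x * 'D_(e_ R m) f x.
pose F2 i x := 'D_(e_ R l) (g i) x * f x.
have CF1 i : Cn 1 (F1 i) := Cn_mul (cg i) cDf.
have CF2 i : Cn 1 (F2 i) := Cn_mul (cDg i) cf1.
have zDf : vanishing ('D_(e_ R m) f) by exact: vanishing_derive.
have Z1 i x : ~ (triangle a)° x -> F1 i x = 0.
  by move=> nx; rewrite /F1 (vanishing_eq0 zDf nx) mulr0.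
have Z2 i x : ~ (triangle a)° x -> F2 i x = 0.
  by move=> nx; rewrite /F2 (vanishing_eq0 zf nx) mulr0.
have D1 i : 'D_(e_ R l) (F1 i) = fun x => 'D_(e_ R l) (g i) x * 'D_(e_ R m) f x +
    g i x * 'D_(e_ R l) ('D_(e_ R m) f) x.
  apply/funext => x; apply: derive_val; apply: is_derive_mul.
    by apply/derivableP; exact: Cn_derivable (cg i).
  by apply/derivableP; exact: Cn_derivable cDf.
have D2 i : 'D_(e_ R m) (F2 i) = fun x => 'D_(e_ R m) ('D_(e_ R l) (g i)) x * f x +
    'D_(e_ R l) (g i) x * 'D_(e_ R m) f x.
  apply/funext => x; apply: derive_val; apply: is_derive_mul.
    by apply/derivableP; exact: Cn_derivable (cDg i).
  by apply/derivableP; exact: Cn_derivable cf1.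
have c1 i : continuous (fun x => 'D_(e_ R l) (g i) x * 'D_(e_ R m) f x).
  exact: Cn_continuous (Cn_mul (cDg i) cDf).
have c2 i : continuous (fun x => g i x * 'D_(e_ R l) ('D_(e_ R m) f) x).
  exact: Cn_continuous (Cn_mul (CnS (cg i)) (Cn_derive l cDf)).
have c3 i : continuous (fun x => 'D_(e_ R m) ('D_(e_ R l) (g i)) x * f x).
  exact: Cn_continuous (Cn_mul (Cn_derive m (cDg i)) (CnS cf1)).
have I1 := bint_derive (e_ R l) CF1 Z1; have I2 := bint_derive (e_ R m) CF2 Z2.
have := I1; rewrite [X in X = _](_ : _ = bint (fun i x => 'D_(e_ R l) (g i) x * 'D_(e_ R m) f x +
    g i x * 'D_(e_ R l) ('D_(e_ R m) f) x)); last by congr bint; apply/funext => i; exact: D1.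
rewrite big1 => [|k _]; last first.
  rewrite (@spoke_integral_eq _ a c k (F1 (ord_pred k)) (F1 (ordS k))) ?subrr ?mulr0//.
  by move=> s /(ct_spokes k)[sS sP]; rewrite /F1 (mg _ _ _ sS sP).
rewrite bint_add// mulr0 => E1.
have := I2; rewrite [X in X = _](_ : _ = bint (fun i x => 'D_(e_ R m) ('D_(e_ R l) (g i)) x * f x +
    'D_(e_ R l) (g i) x * 'D_(e_ R m) f x)); last by congr bint; apply/funext => i; exact: D2.
rewrite bint_add// => E2.
have -> : \sum_k cross (e_ R m) (spoke k) *
    SI k (fun x => ('D_(e_ R l) (g (ord_pred k)) x - 'D_(e_ R l) (g (ordS k)) x) * f x) =
  \sum_k cross (e_ R m) (spoke k) * (SI k (F2 (ord_pred k)) - SI k (F2 (ordS k))).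
  apply: eq_bigr => k _; congr (_ * _).
  have cF i : continuous (F2 i) := Cn_continuous (CF2 i).
  rewrite addrC -mulN1r -(spoke_integral_lin a c k (-1) (cF (ordS k)) (cF (ord_pred k))).
  by apply: spoke_integral_eq => s _; rewrite /F2; ring.
rewrite -E2 opprD addrA subrr sub0r; apply/eqP.
by rewrite -addr_eq0 addrC E1.
Qed.

(** The mixed derivatives come in the reverse of the order in which they act on the test function in
    [sven_eq], as two integrations by parts produce them. *)
Definition sven_piece (u : V -> 'M[R]_2) x : R :=
  'D_(e_ R 1) ('D_(e_ R 1) (fun y => u y 0 0)) x
  + 'D_(e_ R 0) ('D_(e_ R 0) (fun y => u y 1 1)) x
  - 'D_(e_ R 1) ('D_(e_ R 0) (fun y => u y 1 0)) x
  - 'D_(e_ R 0) ('D_(e_ R 1) (fun y => u y 0 1)) x.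

(* Density of the part of the distribution [sven u] concentrated on the spoke [k]. *)
Definition sven_jump (u : 'I_3 -> V -> 'M[R]_2) k x : R :=
  let d p q l := 'D_(e_ R l) (fun y => u (ord_pred k) y p q) x -
                 'D_(e_ R l) (fun y => u (ordS k) y p q) x in
  cross (e_ R 1) (spoke k) * d 0 0 1 + cross (e_ R 0) (spoke k) * d 1 1 0
  - cross (e_ R 1) (spoke k) * d 1 0 0 - cross (e_ R 0) (spoke k) * d 0 1 1.

Lemma sven_weak r (u : 'I_3 -> V -> 'M[R]_2) f : (forall i, polyfun r (u i)) ->
  matching a c u -> test_function (triangle a) f ->
  bint (fun i x =>
        u i x 0 0 * 'D_(e_ R 1) ('D_(e_ R 1) f) x
      + u i x 1 1 * 'D_(e_ R 0) ('D_(e_ R 0) f) x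
      - u i x 1 0 * 'D_(e_ R 0) ('D_(e_ R 1) f) x
      - u i x 0 1 * 'D_(e_ R 1) ('D_(e_ R 0) f) x) =
  bint (fun i x => sven_piece (u i) x * f x) -
  Num.sg (tdet a) * \sum_k SI k (fun x => sven_jump u k x * f x).
Proof.
move=> pu mu tf; have [cf _ _] := tf; have zf := test_vanishing tf.
have pe p q i : pol r (fun x => u i x p q) := (polyfun_mxP r (u i)).1 (pu i) p q.
have me p q : matching a c (fun i x => u i x p q).
  by move=> i j x xi xj; rewrite (mu _ _ _ xi xj).
have W p q l m := weak_second l m (pe p q) (me p q) (cf 2) zf.
have cA p q l m i : continuous (fun x => u i x p q * 'D_(e_ R l) ('D_(e_ R m) f) x).
  apply: Cn_continuous (Cn_mul (pol_Cn 0 (pe p q i)) _).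
  exact: Cn_derive (Cn_derive m (cf 2)).
have cB p q l m i : continuous (fun x => 'D_(e_ R m) ('D_(e_ R l) (fun y => u i y p q)) x * f x).
  by apply: Cn_continuous (Cn_mul (pol_Cn 0 (pol_derive _ (pol_derive _ (pe p q i)))) (cf 0)).
have comb (A B C D : 'I_3 -> V -> R) : (forall i, continuous (A i)) ->
    (forall i, continuous (B i)) -> (forall i, continuous (C i)) ->
    (forall i, continuous (D i)) ->
    bint (fun i x => A i x + B i x - C i x - D i x) = bint A + bint B - bint C - bint D.
  move=> hA hB hC hD.
  have hAB i : continuous (fun x => A i x + B i x) by move=> x; exact: (cvgD (hA i x) (hB i x)).
  have hABC i : continuous (fun x => -1 * C i x + (A i x + B i x)).
    by move=> x; exact: (cvgD (cvgM (cvg_cst _) (hC i x)) (hAB i x)).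
  have -> : bint (fun i x => A i x + B i x - C i x - D i x) =
      bint (fun i x => -1 * D i x + (-1 * C i x + (A i x + B i x))).
    by congr bint; apply/funext => i; apply/funext => x; ring.
  by rewrite bint_lin// bint_lin// bint_add//; ring.
have dist4 (p q s t z : R) : (p + q - s - t) * z = p * z + q * z - s * z - t * z.
  ring.
have dist4' (e0 e1 p q s t z : R) : (e1 * p + e0 * q - e1 * s - e0 * t) * z =
    e1 * (p * z) + (e0 * (q * z) + (- e1 * (s * z) + (- e0 * (t * z) + 0))).
  ring.
have dist5 (e0 e1 p q s t : R) : e1 * p + (e0 * q + (- e1 * s + (- e0 * t + 0))) =
    e1 * p + e0 * q - e1 * s - e0 * t.
  ring.
have dist8 (z p q s t p' q' s' t' : R) :
    (p - z * p') + (q - z * q') - (s - z * s') - (t - z * t') =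
    p + q - s - t - z * (p' + q' - s' - t').
  ring.
pose bA p q l m := bint (fun i x => u i x p q * 'D_(e_ R l) ('D_(e_ R m) f) x).
pose bB p q l m := bint (fun i x => 'D_(e_ R m) ('D_(e_ R l) (fun y => u i y p q)) x * f x).
pose d k p q l x := ('D_(e_ R l) (fun y => u (ord_pred k) y p q) x -
                   'D_(e_ R l) (fun y => u (ordS k) y p q) x) * f x.
pose S p q l m := \sum_k cross (e_ R m) (spoke k) * SI k (d k p q l).
have W' p q l m : bA p q l m = bB p q l m - Num.sg (tdet a) * S p q l m by exact: W.
apply: (etrans (comb _ _ _ _ (cA 0 0 1 1) (cA 1 1 0 0) (cA 1 0 0 1) (cA 0 1 1 0))).
have EB : bint (fun i x => sven_piece (u i) x * f x) =
    bB 0 0 1 1 + bB 1 1 0 0 - bB 1 0 0 1 - bB 0 1 1 0.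
  rewrite -[RHS](comb _ _ _ _ (cB 0 0 1 1) (cB 1 1 0 0) (cB 1 0 0 1) (cB 0 1 1 0)).
  apply: (congr1 bint); apply/funext => i; apply/funext => x; exact: dist4.
have ES : \sum_k SI k (fun x => sven_jump u k x * f x) =
    S 0 0 1 1 + S 1 1 0 0 - S 1 0 0 1 - S 0 1 1 0.
  rewrite -big_split -!sumrB; apply: eq_bigr => k _ /=.
  have cd p q l : continuous (d k p q l).
    exact: Cn_continuous (Cn_mul (pol_Cn 0 (polB (pol_derive _ (pe p q (ord_pred k)))
      (pol_derive _ (pe p q (ordS k))))) (cf 0)).
  have c0 : continuous (fun _ : V => 0 : R) by exact: (@cst_continuous V R 0).
  have lin := spoke_integral_lin a c k.
  have cl (p : R) (h1 h2 : V -> R) : continuous h1 -> continuous h2 ->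
      continuous (fun x => p * h1 x + h2 x).
    by move=> k1 k2 x; exact: (cvgD (cvgM (cvg_cst _) (k1 x)) (k2 x)).
  have C1' := cl (- cross (e_ R 0) (spoke k)) _ _ (cd 0 1 1) c0.
  have C2' := cl (- cross (e_ R 1) (spoke k)) _ _ (cd 1 0 0) C1'.
  have C3' := cl (cross (e_ R 0) (spoke k)) _ _ (cd 1 1 0) C2'.
  have S0 : SI k (fun _ => 0) = 0 by rewrite /spoke_integral Rintegral_cst// mul0r.
  transitivity (SI k (fun x => cross (e_ R 1) (spoke k) * d k 0 0 1 x +
      (cross (e_ R 0) (spoke k) * d k 1 1 0 x + (- cross (e_ R 1) (spoke k) * d k 1 0 0 x +
       (- cross (e_ R 0) (spoke k) * d k 0 1 1 x + 0))))).
    apply: spoke_integral_eq => s _; exact: dist4'.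
  rewrite (lin _ _ _ (cd 0 0 1) C3') (lin _ _ _ (cd 1 1 0) C2').
  rewrite (lin _ _ _ (cd 1 0 0) C1') (lin _ _ _ (cd 0 1 1) c0) S0.
  exact: dist5.
rewrite EB ES.
apply: (etrans (congr2 _ (congr2 _ (congr2 _ (W' 0 0 1 1) (W' 1 1 0 0))
  (congr1 _ (W' 1 0 0 1))) (congr1 _ (W' 0 1 1 0)))).
exact: dist8.
Qed.

End WeakSven.

(** * Smooth bumps *)

Section FlatFunctions.
Variable R : realType.
Implicit Types (t : R) (n : nat).

(* Differentiation maps [flat n] into the span of the family, whence smoothness. *)
Definition flat n t : R := if 0 < t then t^-1 ^+ n * expR (- t^-1) else 0.

Lemma flat_ge0 n t : 0 <= flat n t.
Proof.
rewrite /flat; case: ifPn => // t0; rewrite mulr_ge0 ?expR_ge0//.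
by rewrite exprn_ge0// invr_ge0 ltW.
Qed.

Lemma flat_gt0 n t : 0 < t -> 0 < flat n t.
Proof. by move=> t0; rewrite /flat t0 mulr_gt0 ?expR_gt0// exprn_gt0// invr_gt0. Qed.

Lemma flat_eq0 n t : t <= 0 -> flat n t = 0.
Proof. by move=> t0; rewrite /flat ltNge t0. Qed.

Lemma flat0_le1 t : flat 0 t <= 1.
Proof.
rewrite /flat; case: ifPn => // t0; rewrite expr0 mul1r -[leRHS]expR0.
by rewrite ler_expR oppr_le0 invr_ge0 ltW.
Qed.

(** Keeping the term of order n+2 of the exponential series at 1/t bounds exp(1/t) from below. The
    resulting quadratic decay makes the derivative at 0 vanish. *)
Lemma flat_bound n t : flat n t <= n.+2`!%:R * t ^+ 2.
Proof.
rewrite /flat; case: ifPn => t0; last by rewrite mulr_ge0// sqr_ge0.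
have x0 : 0 < t^-1 by rewrite invr_gt0.
have f0 : 0 < n.+2`!%:R :> R by rewrite ltr0n fact_gt0.
have tn0 : t != 0 by rewrite gt_eqF.
have h : t^-1 ^+ n.+2 / n.+2`!%:R <= expR t^-1.
  by apply: le_trans (expR_ge1Dxn n.+1 (ltW x0)); rewrite lerDr.
rewrite expRN ler_pdivrMr ?expR_gt0//.
have e : t^-1 ^+ n = n.+2`!%:R * t ^+ 2 * (t^-1 ^+ n.+2 / n.+2`!%:R).
  rewrite -addn2 exprD; field; rewrite tn0 gt_eqF//.
by rewrite {1}e ler_wpM2l// mulr_ge0 ?ltW// exprn_gt0.
Qed.

Lemma is_derive_flat n t :
  is_derive t (1 : R) (flat n) (flat n.+2 t - n%:R * flat n.+1 t).
Proof.
have [t0|t0|->] := ltgtP t 0.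
- have e0 m : flat m t = 0 by rewrite flat_eq0// ltW.
  rewrite !e0 mulr0 subr0; apply: (near_eq_is_derive (f := cst 0)) => //.
  have : \forall s \near t, s < 0 by exact: (cvgr_lt _ (@cvg_id _ (nbhs t)) _ t0).
  by apply: filterS => s s0; rewrite flat_eq0// ltW.
- have tn0 : t != 0 by rewrite gt_eqF.
  apply: (near_eq_is_derive (f := fun s : R => s^-1 ^+ n * expR (- s^-1))).
    have : \forall s \near t, 0 < s by exact: (cvgr_gt _ (@cvg_id _ (nbhs t)) _ t0).
    by apply: filterS => s s0; rewrite /flat s0.
  have iv : is_derive t (1 : R) (fun s : R => s^-1) (- t ^- 2 *: 1).
    exact: (is_deriveV tn0 (is_derive_id t 1)).
  have pw m : is_derive t (1 : R) (fun s : R => s^-1 ^+ m) (- m%:R * t^-1 ^+ m.+1).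
    elim: m => [|m IH].
      by rewrite oppr0 mul0r; exact: is_derive_cst.
    have -> : (fun s : R => s^-1 ^+ m.+1) = (fun s : R => s^-1) * (fun s : R => s^-1 ^+ m).
      by apply/funext => s; rewrite exprS.
    apply: is_derive_eq (is_deriveM iv IH) _.
    by rewrite /GRing.scale/= -natr1 !exprS; field.
  have ng : is_derive t (1 : R) (fun s : R => - s^-1) (- (- t ^- 2 *: 1)).
    exact: (is_deriveN iv).
  have ex : is_derive t (1 : R) (fun s : R => expR (- s^-1)) (expR (- t^-1) * - (- t ^- 2 *: 1)).
    exact: (is_derive1_comp (is_derive_expR _) ng).
  apply: is_derive_eq (is_deriveM (pw n) ex) _.
  have H (E N : R) : t^-1 ^+ n.+1 = t^-1 * t^-1 ^+ n -> t^-1 ^+ n.+2 = t^-1 * (t^-1 * t^-1 ^+ n) ->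
      t^-1 ^+ n * (E * - (- t ^- 2 * 1)) + E * (- N * t^-1 ^+ n.+1) =
      t^-1 ^+ n.+2 * E - N * (t^-1 ^+ n.+1 * E).
    by move=> -> ->; rewrite -exprVn; ring.
  rewrite /flat t0; by apply: H; rewrite !exprS.
- have -> : flat n.+2 0 - n%:R * flat n.+1 0 = 0 by rewrite !flat_eq0// mulr0 subr0.
  pose K : R := n.+2`!%:R + 1.
  have K0 : 0 < K by rewrite ltr_wpDl.
  suff cv : (fun h : R => h^-1 *: ((flat n \o shift (0 : R)) (h *: (1 : R)) - flat n 0)) @ 0^' --> (0 : R).
    by apply: DeriveDef; [apply/cvg_ex; eexists; exact: cv|exact: cvg_lim cv].
  apply/cvgrPdist_lt => e e0; near=> h.
  have hn0 : h != 0 by near: h; exact: nbhs_dnbhs_neq.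
  have hK : `|h| < e / K by near: h; apply: dnbhs0_lt; rewrite divr_gt0.
  rewrite /= addr0 [h *: 1]mulr1 (flat_eq0 n (lexx 0)) subr0 sub0r normrN.
  rewrite normrM normfV (ger0_norm (flat_ge0 _ _)) mulrC ltr_pdivrMr ?normr_gt0//.
  apply: le_lt_trans (flat_bound n h) _.
  rewrite -[h ^+ 2]real_normK ?num_real// expr2 mulrA ltr_pM2r ?normr_gt0//.
  rewrite mulrC; apply: lt_trans (_ : `|h| * K < e); last by rewrite -ltr_pdivlMr.
  by rewrite ltr_pM2l ?normr_gt0// ltrDl.
Unshelve. all: by end_near. Qed.

Lemma continuous_flat n : continuous (flat n).
Proof.
by move=> t; apply/differentiable_continuous/derivable1_diffP; have [] := is_derive_flat n t.
Qed.

Lemma is_derive_of_line (f : 'cV[R]_2 -> R) x v d :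
  is_derive (0 : R) (1 : R) (fun t : R => f (x + t *: v)) d -> is_derive x v f d.
Proof.
move=> [df Df].
have E : (fun h : R => h^-1 *: (((fun t : R => f (x + t *: v)) \o shift 0) (h *: (1 : R)) - f (x + 0 *: v)))
       = (fun h : R => h^-1 *: ((f \o shift x) (h *: v) - f x)).
  apply/funext => h /=; rewrite scale0r !addr0 [h *: 1]mulr1.
  by congr (_ *: (f _ - _)); rewrite addrC.
apply: DeriveDef; first by move: df; rewrite /derivable E.
by rewrite -Df /derive E.
Qed.

(** Induction on [m] for all [n] at once, since the derivative of [flat n] involves [flat n.+1] and
    [flat n.+2]; composing with an affine [l] only adds the constant factor [b]. *)
Lemma Cn_flat m n (l : 'cV[R]_2 -> R) : pol 1 l -> Cn m (flat n \o l).
Proof.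
move=> pl; have cl : continuous l by exact: pol_continuous pl.
have cfl p : continuous (flat p \o l).
  by move=> x; apply: continuous_comp; [exact: cl|exact: continuous_flat].
elim: m n => [|m IH] n; split=> //; try exact: cfl.
move=> k; have := pol_derive (e_ R k) pl => -[b bE].
have D x : is_derive x (e_ R k) (flat n \o l) ((flat n.+2 (l x) - n%:R * flat n.+1 (l x)) * b).
  apply: is_derive_of_line.
  have dl : is_derive (0 : R) (1 : R) (fun t : R => l (x + t *: e_ R k)) b.
    rewrite -(bE (x + 0 *: e_ R k)); apply: is_derive_line.
    by apply/derivableP; exact: pol_derivable pl.
  have dfl := is_derive_flat n (l (x + 0 *: e_ R k)).
  rewrite scale0r addr0 in dfl; rewrite -[x in l x](addr0) -(scale0r (e_ R k)).
  exact: (is_derive1_comp (is_derive_flat n (l (x + 0 *: e_ R k))) dl).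
split; first by move=> x; have [] := D x.
rewrite (_ : 'D_(e_ R k) _ = fun x => b * ((flat n.+2 \o l) x + (- n%:R) * (flat n.+1 \o l) x)).
  apply: Cn_mul; first exact: pol_Cn (pol_cst 0 b).
  apply: Cn_add; first exact: IH.
  by apply: Cn_mul; [exact: pol_Cn (pol_cst 0 _)|exact: IH].
apply/funext => x; have [_ ->] := D x; rewrite /comp; ring.
Qed.

End FlatFunctions.

Section Bumps.
Variables (R : realType) (a : 'I_3 -> 'cV[R]_2).
Local Notation V := 'cV[R]_2.
Implicit Types (x p : V).

(** Positive exactly on the open square of centre [p] and half-side [d], that is, on a ball of the
    sup norm, and at most 1 everywhere. *)
Definition box p (d : R) x : R :=
  (flat 0 (d - (x 0 0 - p 0 0)) * flat 0 (d + (x 0 0 - p 0 0))) *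
  (flat 0 (d - (x 1 0 - p 1 0)) * flat 0 (d + (x 1 0 - p 1 0))).

Lemma box_ge0 p d x : 0 <= box p d x.
Proof. by rewrite /box !mulr_ge0// flat_ge0. Qed.

Lemma box_le1 p d x : box p d x <= 1.
Proof. by rewrite /box !mulr_ile1 ?mulr_ge0 ?flat_ge0 ?flat0_le1. Qed.

Lemma box_gt0 p d : 0 < d -> 0 < box p d p.
Proof.
by move=> d0; rewrite /box !subrr subr0 addr0 !mulr_gt0// flat_gt0.
Qed.

Lemma box_neq0 p d x : box p d x != 0 ->
  `|x 0 0 - p 0 0| < d /\ `|x 1 0 - p 1 0| < d.
Proof.
rewrite /box !mulf_eq0 !negb_or => /andP[/andP[h1 h2] /andP[h3 h4]].
have gt (t : R) : flat 0 t != 0 -> 0 < t by apply: contraNT; rewrite -leNgt => /flat_eq0 ->.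
by split; rewrite ltr_norml; apply/andP; split;
  move: (gt _ h1) (gt _ h2) (gt _ h3) (gt _ h4); lra.
Qed.

Lemma box_Cn n p d : Cn n (box p d).
Proof.
have C (k : 'I_2) (s : R) : pol 1 (fun x => d + s * (x k 0 - p k 0)).
  by apply: polD; [exact: pol_cst|apply: polZ; apply: polB; [exact: pol_coord|exact: pol_cst]].
have C1 (k : 'I_2) : Cn n (fun x => flat 0 (d - (x k 0 - p k 0))).
  apply: (Cn_flat n 0); apply: pol_ext (C k (-1)) => x; by rewrite mulN1r.
have C2 (k : 'I_2) : Cn n (fun x => flat 0 (d + (x k 0 - p k 0))).
  apply: (Cn_flat n 0); apply: pol_ext (C k 1) => x; by rewrite mul1r.
by apply: Cn_mul; apply: Cn_mul.
Qed.

(** The closed square is compact, contains the closure of the support and lies in the interior for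
    small [d]. The smooth factor [g] leaves room for localising further around a spoke. *)
Lemma box_test p : (triangle a)° p -> exists2 d0, 0 < d0 &
  forall d (g : V -> R), 0 < d -> d <= d0 -> (forall n, Cn n g) ->
    test_function (triangle a) (fun x => box p d x * g x).
Proof.
move=> pT.
have : nbhs p (triangle a)° by apply: open_nbhs_nbhs; split=> //; exact: open_interior.
move=> /nbhs_ballP[e /= e0 eT]; exists (e / 2) => [|d g d0 de cg]; first by rewrite divr_gt0.
pose K := (fun z : R * R => vec2 z.1 z.2 : V) @`
  (`[p 0 0 - d, p 0 0 + d]%classic `*` `[p 1 0 - d, p 1 0 + d]%classic).
have cK : compact K.
  apply: continuous_compact; first by apply: continuous_subspaceT; exact: continuous_vec2.
  by apply: compact_setX; exact: segment_compact.
have clK : closed K by apply: compact_closed => //; exact: norm_hausdorff.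
have sK : closure [set x | box p d x * g x != 0] `<=` K.
  rewrite [X in _ `<=` X](closure_id K).1//; apply: closureS => x /=.
  rewrite mulf_eq0 negb_or => /andP[/box_neq0[x0 x1] _].
  exists (x 0 0, x 1 0); last by apply: cv2P; rewrite mxE.
  by split; rewrite /= in_itv/= -ler_distl ltW.
split.
- by move=> n; apply: Cn_mul => //; exact: box_Cn.
- by apply: subclosed_compact sK => //; exact: closed_closure.
- move=> x /sK[z [/= z0 z1] <-]; apply: eT; split=> // i j.
  rewrite /= !in_itv/= -!ler_distl in z0 z1.
  have de' : d < e by apply: le_lt_trans de _; rewrite gtr_pMr// invf_lt1// ltr1n.
  rewrite /ball/= ord1 !mxE; have [->|->] := ord2P i => /=;
    by rewrite distrC (le_lt_trans _ de').
Qed.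

End Bumps.

(** * Positivity of integrals and dominated convergence *)

Section IntegralLemmas.
Context d (T : measurableType d) (R : realType) (mu : {measure set T -> \bar R}).
Implicit Types (D A N : set T) (f g : T -> R).

Lemma Rintegral_gt0 D A f (e : R) : measurable D -> measurable A -> A `<=` D ->
  (0 < mu A)%E -> 0 < e -> mu.-integrable D (EFin \o f) ->
  (forall x, D x -> 0 <= f x) -> (forall x, A x -> e <= f x) ->
  0 < \int[mu]_(x in D) f x.
Proof.
move=> mD mA AD A0 e0 fi f0 fe; have fin := integrable_fin_num mD fi.
rewrite /Rintegral -lte_fin fineK//.
have mf : measurable_fun D (EFin \o f) by have /integrableP[] := fi.
have fE x : D x -> (0 <= (EFin \o f) x)%E by move=> /f0; rewrite lee_fin.
have := ge0_subset_integral mu mA mD mf fE AD; apply: lt_le_trans.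
apply: (@lt_le_trans _ _ (\int[mu]_(x in A) (cst e%:E) x)%E).
  by rewrite integral_cst// mule_gt0.
apply: ge0_le_integral => //; [by move=> x _; rewrite lee_fin ltW|].
exact: measurable_funS mf.
Qed.

Lemma integral_vanish D N g (F : nat -> T -> R) : measurable D ->
  mu.-integrable D (EFin \o g) -> (forall n, measurable_fun D (F n)) ->
  (forall n x, `|F n x| <= 1) -> measurable N -> mu N = 0%E ->
  (forall x, D x -> ~ N x -> F ^~ x @ \oo --> (0 : R)) ->
  (fun n => \int[mu]_(x in D) (g x * F n x)) @ \oo --> (0 : R).
Proof.
move=> mD gi mF F1 mN N0 F0.
have mg : measurable_fun D g by apply/measurable_EFinP; have /integrableP[] := gi.
have [] := @dominated_convergence _ T R mu D mD (fun n x => (g x * F n x)%:E) (cst 0%E)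
  (fun x => `|(g x)%:E|%E).
- by move=> n; apply/measurable_EFinP; exact: measurable_funM.
- exact: measurable_cst.
- exists N; split=> // x /= nh; apply: contrapT => nN; apply: nh => Dx.
  have h : (fun n => g x * F n x) @ \oo --> (0 : R).
    by rewrite -(mulr0 (g x)); exact: (cvgM (cvg_cst _) (F0 _ Dx nN)).
  by apply/fine_cvgP; split; [exact: nearW|exact: h].
- exact: integrable_abse gi.
- apply: aeW => x n _; rewrite lee_fin normrM -[leRHS]mulr1.
  by rewrite ler_wpM2l.
- move=> _ _; rewrite integral0 => h; exact: fine_cvg h.
Qed.

End IntegralLemmas.

Section PlaneIntegrals.
Variable R : realType.
Local Notation V := 'cV[R]_2.
Local Notation RT := (measurableTypeR R).
Implicit Types (x p : V) (K : set V) (f : V -> R).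

Lemma measurable_continuous2 f : continuous f ->
  measurable_fun setT (fun z : RT * RT => f (vec2 z.1 z.2) : RT).
Proof.
move=> cf; apply: continuous_plane_measurable => z.
by apply: continuous_comp; [exact: continuous_vec2|exact: cf].
Qed.

Lemma nbhs_square p (P : set V) : (\forall x \near p, P x) ->
  exists2 e : R, 0 < e & forall x, `|x 0 0 - p 0 0| < e -> `|x 1 0 - p 1 0| < e -> P x.
Proof.
move=> /nbhs_ballP[e /= e0 eP]; exists e => // x x0 x1; apply: eP; split=> // i j.
by rewrite ord1 /ball/= distrC; have [->|->] := ord2P i.
Qed.

Lemma integral2_gt0 K f p : measurable (planar K : set (RT * RT)) ->
  integrable2 K f -> (forall x, K x -> 0 <= f x) -> continuous f -> 0 < f p ->
  (\forall x \near p, K x) -> 0 < integral2 K f.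
Proof.
move=> mK fi f0 cf fp Kp.
have fn : \forall x \near p, f p / 2 < f x.
  by apply: (cvgr_gt (f p) (cf p)); rewrite gtr_pMr// invf_lt1// ltr1n.
have [e e0 eP] := nbhs_square (filterI Kp fn).
pose I (s : R) : set RT := ball s e.
pose A : set (RT * RT) := I (p 0 0) `*` I (p 1 0).
have mI s : measurable (I s) by exact: measurable_ball.
have I0 s : (0 < @lebesgue_measure R (I s))%E.
  by rewrite /I lebesgue_measure_ball ?ltW// lte_fin mulrn_wgt0.
have AP z : A z -> K (vec2 z.1 z.2) /\ f p / 2 < f (vec2 z.1 z.2).
  by move=> [/= z1 z2]; apply: eP; rewrite !mxE /= distrC.
refine (@Rintegral_gt0 _ (RT * RT)%type R (leb2 (R:=R)) (planar K) A
  (fun z => f (vec2 z.1 z.2)) (f p / 2) _ _ _ _ _ _ _ _) => //.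
- exact: measurableX.
- by move=> z /AP[].
- rewrite [X in (_ < X)%E](product_measure1E _ _ (mI _) (mI _)).
  exact: mule_gt0 (I0 _) (I0 _).
- by rewrite divr_gt0.
- by move=> z; exact: f0.
- by move=> z /AP[_ /ltW].
Qed.

End PlaneIntegrals.

(** * Spokes lie on null lines *)

Section CloughTocherNull.
Variables (R : realType) (a : 'I_3 -> 'cV[R]_2) (c : 'cV[R]_2).
Hypothesis nd : tdet a != 0.
Hypothesis cint : (triangle a)° c.
Local Notation V := 'cV[R]_2.
Local Notation RT := (measurableTypeR R).
Implicit Types (x v : V) (i j k : 'I_3) (f : V -> R).
Local Notation spoke := (spoke a c).
Local Notation hat := (hat a c).
Local Notation wt := (wt a c).

(** The affine equation of the line carrying the spoke [k]: nonpositive on the cell [ordS k],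
    nonnegative on the cell [ord_pred k]. *)
Definition kink k x : R := hat (ordS k) x - hat (ord_pred k) x.

Lemma kink_pol k : pol 1 (kink k).
Proof. by apply: polB; exact: hat_pol. Qed.

Lemma kink_spoke k (s : R) : kink k (c + s *: spoke k) = 0.
Proof.
have [iS iP SP] := ordS3_neq k.
by rewrite /kink !hat_spoke ?subrr ?iS ?iP.
Qed.

Lemma measurable_kink k : measurable (planar [set x | kink k x = 0] : set (RT * RT)).
Proof.
rewrite -[X in measurable X]setCK; apply: measurableC.
apply: open_plane_measurable; apply: closed_openC.
have ck : continuous (kink k) by exact: pol_continuous (kink_pol k).
have ckv : continuous (fun z : R * R => kink k (vec2 z.1 z.2)).
  move=> z; exact: (@continuous_comp _ _ _ (fun z : R * R => vec2 z.1 z.2 : V)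
    (kink k) z (@continuous_vec2 R z) (ck _)).
exact: (@preimage_closed _ _ (fun z : R * R => kink k (vec2 z.1 z.2))
  [set s | s = 0] (fun z _ => ckv z) (@closed_eq R 0)).
Qed.

(** In the affine frame at [c] with axes [spoke k] and the next spoke, the kink is a multiple of the
    second coordinate, so the line becomes a coordinate axis. *)
Lemma kink_null k :
  leb2 (planar [set x | kink k x = 0] : set (RT * RT)) = 0%E.
Proof.
have [Sk Pk SP] := ordS3_neq k.
have PS : (ord_pred k == ordS k) = false by rewrite eq_sym.
set v := spoke k; set w := spoke (ordS k).
have d0 : cross v w != 0.
  have := cross_spokes c nd (ord_pred k).
  by rewrite ord_predK ord_predP3 => ->; rewrite mulf_neq0// wt_neq0.
have [mphi kphi] := area_factor_aff2 c d0.
have E (z : R * R) : vec2 (aff2 c v w z).1 (aff2 c v w z).2 = c + z.1 *: v + z.2 *: w.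
  by apply: cv2P; rewrite /aff2 /= !mxE.
have kE (z : R * R) : kink k (c + z.1 *: v + z.2 *: w) = z.2 / wt (ordS k).
  rewrite /kink !hat_shift// !hat_c// !dhat_spoke// eqxx PS Sk Pk.
  move: (wt_neq0 nd cint (ordS k)) (wt (ordS k)) (wt (ord_pred k)) => + m m'.
  rewrite /=; have -> : (0%:R / m' : R) = 0 by rewrite mul0r.
  have -> : (0%:R / m : R) = 0 by rewrite mul0r.
  by move: (z.1) (z.2) => p q _; rewrite mulrBr div1r; ring.
have mL := measurable_kink k.
have pE : aff2 c v w @^-1` planar [set x | kink k x = 0] = (setT : set RT) `*` ([set 0] : set RT).
  apply/seteqP; split=> z /=; rewrite /planar /= E kE.
    by move=> /eqP; rewrite mulf_eq0 invr_eq0 (negbTE (wt_neq0 nd cint _)) orbF => /eqP.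
  by move=> [_ ->]; rewrite mul0r.
have mT : measurable (setT : set RT) by exact: measurableT.
have m0 : measurable ([set 0] : set RT) by exact: measurable_set1.
rewrite kphi// pE [X in (_ * X)%E](product_measure1E _ _ mT m0).
by rewrite [X in (_ * (_ * X))%E]lebesgue_measure_set1 !mule0.
Qed.

End CloughTocherNull.

(** * Integrability of sven and vanishing of the spoke densities *)

Section SvenCharacterization.
Variables (R : realType) (a : 'I_3 -> 'cV[R]_2) (c : 'cV[R]_2).
Hypothesis nd : tdet a != 0.
Hypothesis cint : (triangle a)° c.
Local Notation V := 'cV[R]_2.
Local Notation RT := (measurableTypeR R).
Local Notation mu := (@lebesgue_measure R).
Implicit Types (x v : V) (i j k : 'I_3) (f : V -> R).
Local Notation spoke := (spoke a c).
Local Notation hat := (hat a c).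
Local Notation wt := (wt a c).
Local Notation SI := (spoke_integral a c).

Lemma ctmap_onto i x : exists z, x = ctmap a c i z.
Proof.
have d0 : cross (spoke (ordS i)) (spoke (ord_pred i)) != 0.
  by rewrite cross_spokes// mulf_neq0// wt_neq0.
have := cross_decomp (x - c) d0; set p := _ / _; set q := (cross _ (x - c) / _) => E.
by exists (p, q); rewrite /ctmap/= -addrA -E addrC subrK.
Qed.

Lemma ct_bounded i f : continuous f -> exists M, forall x, ct a c i x -> `|f x| <= M.
Proof.
move=> cf; have cfc : continuous (f \o ctmap a c i).
  by move=> z; apply: continuous_comp; [exact: continuous_ctmap|exact: cf].
have [M HM] := continuous_simplex2_bounded cfc.
by exists M => x; have [z ->] := ctmap_onto i x => /ct_ctmap-/(_ nd cint)/HM.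
Qed.

Lemma leb2_ct_lty i : (leb2 (planar (ct a c i) : set (RT * RT)) < +oo)%E.
Proof.
have d0 : cross (spoke (ordS i)) (spoke (ord_pred i)) != 0.
  by rewrite cross_spokes// mulf_neq0// wt_neq0.
have [_ ->] := area_factor_aff2 c d0; last exact: measurable_planar_ct.
rewrite lte_mul_pinfty//; apply: le_lt_trans (leb2_simplex2_lty R).
apply: le_measure; rewrite ?inE.
- have [+ _] := area_factor_aff2 c d0.
  move=> /(_ measurableT _ (measurable_planar_ct nd cint i)); rewrite setTI; exact.
- exact: measurable_simplex2.
move=> z; rewrite /planar/= (_ : vec2 _ _ = ctmap a c i z) ?ct_ctmap//.
by apply: cv2P; rewrite /aff2 /ctmap /= !mxE.
Qed.

Lemma integrable2_ct_bounded i f M : measurable_fun setT (fun z : RT * RT => f (vec2 z.1 z.2) : RT) ->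
  (forall x, ct a c i x -> `|f x| <= M) -> integrable2 (ct a c i) f.
Proof.
move=> mf fM; apply: measurable_bounded_integrable.
- exact: measurable_planar_ct.
- exact: leb2_ct_lty.
- exact: measurable_funTS.
- exists M; split; first exact: num_real.
  by move=> y My z /fM h; exact: le_trans h (ltW My).
Qed.

Lemma integrable2_ct i f : continuous f -> integrable2 (ct a c i) f.
Proof.
move=> cf; have [M HM] := ct_bounded i cf.
by apply: (integrable2_ct_bounded _ HM); exact: measurable_continuous2.
Qed.

Lemma spoke_integral_gt0 k f s0 : 0 < s0 -> s0 < 1 -> continuous f ->
  (forall s, 0 <= s <= 1 -> 0 <= f (c + s *: spoke k)) ->
  0 < f (c + s0 *: spoke k) -> 0 < SI k f.
Proof.
move=> s00 s01 cf f0 fs0.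
have cl : continuous (fun s : R => f (c + s *: spoke k)) by exact: continuous_line.
have n1 : \forall s \near s0, f (c + s0 *: spoke k) / 2 < f (c + s *: spoke k).
  by apply: (cvgr_gt _ (cl s0)); rewrite gtr_pMr// invf_lt1// ltr1n.
have n2 : \forall s \near s0, 0 < s by exact: (cvgr_gt _ (@cvg_id _ (nbhs s0)) _ s00).
have n3 : \forall s \near s0, s < 1 by exact: (cvgr_lt _ (@cvg_id _ (nbhs s0)) _ s01).
have [e /= e0 eP] := (nbhs_ballP s0 _).1 (filterI n1 (filterI n2 n3)).
have mb : (0 < mu (ball s0 e))%E.
  by rewrite lebesgue_measure_ball ?ltW// lte_fin mulrn_wgt0.
apply: (@Rintegral_gt0 _ _ R mu (`[0, 1]%classic : set RT) (ball s0 e : set RT)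
  (fun s => f (c + s *: spoke k)) (f (c + s0 *: spoke k) / 2)) => //.
- exact: measurable_ball.
- by move=> s /eP[_ [h1 h2]]; rewrite /= in_itv/= !ltW.
- by rewrite divr_gt0.
- exact: integrable_segment.
- by move=> s /eP[/ltW].
Qed.

(** A bump supported in the open cell [i] sees only the constant of that cell and has a positive
    integral. *)
Lemma sven_eq_unique u (w w' : 'I_3 -> R) : sven_eq a c u (fun i _ => w i) ->
  sven_eq a c u (fun i _ => w' i) -> w = w'.
Proof.
move=> h h'; apply/funext => i; pose p := ct_center a c i.
have pi := ct_inner_center nd cint i.
have [e e0 eP] := nbhs_square (ct_inner_near nd pi).
have [d0 d00 tst] := box_test (ct_inner_interior nd cint pi).
pose d := Num.min d0 e.
have dd0 : 0 < d by rewrite lt_min d00 e0.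
have bi x : box p d x != 0 -> ct_inner a c i x.
  move=> /box_neq0[x0 x1]; apply: eP.
    by apply: lt_le_trans x0 _; rewrite ge_min lexx orbT.
  by apply: lt_le_trans x1 _; rewrite ge_min lexx orbT.
have C1 n : Cn n (fun _ : V => 1 : R) by exact: pol_Cn (pol_cst 0 1).
pose f x := box p d x * 1.
have cf : continuous f by exact: Cn_continuous (Cn_mul (box_Cn 0 p d) (C1 0%N)).
have tf : test_function (triangle a) f by apply: tst => //; rewrite ge_min lexx.
have E (m : 'I_3 -> R) : bintegral a c (fun j x => m j * f x) = m i * integral2 (ct a c i) f.
  rewrite /bintegral (bigD1 i)//= big1 ?addr0 => [|j ji].
    by rewrite /integral2 RintegralZl//; [exact: measurable_planar_ct|exact: integrable2_ct].
  transitivity (integral2 (ct a c j) (fun _ => 0)); last first.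
    by rewrite /integral2 Rintegral_cst ?mul0r//; exact: measurable_planar_ct.
  apply: eq_Rintegral => z; rewrite inE => zj; rewrite /f mulr1.
  have [->|/bi[_ /(_ j ji)]] := eqVneq (box p d (vec2 z.1 z.2)) 0; first by rewrite mulr0.
  by move: zj; rewrite /planar/= ctE// => -[_ /(_ i)]; rewrite leNgt => /negbTE ->.
have I0 : 0 < integral2 (ct a c i) f.
  apply: (integral2_gt0 (p := p)) => //.
  - exact: measurable_planar_ct.
  - exact: integrable2_ct.
  - by move=> x _; rewrite /f mulr1 box_ge0.
  - by rewrite /f mulr1 box_gt0.
  - have := ct_inner_near nd pi; apply: filterS => x; exact: ct_inner_ct.
by apply: (mulIf (lt0r_neq0 I0)); rewrite -!E -h// -h'.
Qed.

(** An integrable density is a single function on the triangle, whereas the constants of adjacent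
    cells conflict on spokes. [F] takes the value [w i] where [hat i] is strictly smallest, and
    agrees with the constants off the null lines of the kinks. *)
Lemma sven_integrable_cst u (w : 'I_3 -> R) :
  sven_eq a c u (fun i _ => w i) -> sven_integrable a c u.
Proof.
move=> uw; pose D i : set V := [set x | hat i x < hat (ordS i) x /\ hat i x < hat (ord_pred i) x].
pose F x : R := \sum_i w i * \1_(D i) x.
have mI i : measurable (planar (D i) : set (RT * RT)).
  have lt j : measurable (planar [set x | hat i x < hat j x] : set (RT * RT)).
    have cd : continuous (fun x => hat j x - hat i x).
      have h : pol 1 (fun x => hat j x - hat i x) by apply: polB; exact: hat_pol.
      exact: pol_continuous h.
    rewrite (_ : planar _ = (fun z : RT * RT => hat j (vec2 z.1 z.2) - hat i (vec2 z.1 z.2) : RT)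
        @^-1` [set` `]0, +oo[]); last first.
      by apply/seteqP; split=> z; rewrite /planar/= in_itv/= andbT subr_gt0.
    by rewrite -[X in measurable X]setTI; apply: (measurable_continuous2 cd).
  exact: measurableI (lt (ordS i)) (lt (ord_pred i)).
have mF : measurable_fun setT (fun z : RT * RT => F (vec2 z.1 z.2) : RT).
  rewrite (_ : (fun z => _) = fun z => \sum_(i <- index_enum 'I_3)
      (w i * \1_(planar (D i)) z)); last first.
    by apply/funext => z; apply: eq_bigr => i _; rewrite !indicE.
  apply: measurable_sum => i; exact: measurable_funM.
have FM x : `|F x| <= \sum_i `|w i|.
  apply: le_trans (ler_norm_sum _ _ _) _; apply: ler_sum => i _.
  by rewrite normrM indicE; case: (_ \in _); rewrite ?normr1 ?normr0 ?mulr1 ?mulr0.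
have FE i x : D i x -> F x = w i.
  move=> [xS xP]; rewrite /F (bigD1 i)//= indicE mem_set// mulr1 big1 ?addr0// => j ji.
  rewrite indicE memNset ?mulr0// => -[].
  have [E|->|->] := ord3_cases i j; first by rewrite E eqxx in ji.
    by rewrite ordSK => _ h; have := lt_trans xS h; rewrite ltxx.
  by rewrite ord_predK => h _; have := lt_trans xP h; rewrite ltxx.
have triE : planar (triangle a) = planar (ct a c 0) `|` planar (ct a c 1) `|` planar (ct a c 2).
  by apply/seteqP; split=> z; rewrite /planar/= (triangle_ctU nd cint).
exists F.
  have mct := measurable_planar_ct nd cint.
  rewrite /integrable2 triE; apply: measurable_bounded_integrable.
  - by apply: measurableU; [apply: measurableU|]; exact: mct.
  - apply: le_lt_trans (measureU2 _ _ _) _; try exact: mct.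
      by apply: measurableU; exact: mct.
    apply: lte_add_pinfty; last exact: leb2_ct_lty.
    apply: le_lt_trans (measureU2 _ _ _) _; try exact: mct.
    by apply: lte_add_pinfty; exact: leb2_ct_lty.
  - exact: measurable_funTS.
  - exists (\sum_i `|w i|); split; first exact: num_real.
    by move=> y My z _; exact: le_trans (FM _) (ltW My).
move=> f tf; rewrite uw//; apply: eq_bigr => i _.
have [cf _ _] := tf; have mf := measurable_continuous2 (Cn_continuous (cf 0%N)).
rewrite /integral2 /Rintegral; congr fine; apply: ae_eq_integral.
- exact: measurable_planar_ct.
- apply/measurable_EFinP; apply: measurable_funTS; exact: measurable_funM.
- apply/measurable_EFinP; apply: measurable_funTS; exact: measurable_funM.
have nk k : (leb2 (R:=R)).-negligible (planar [set x | kink a c k x = 0] : set (RT * RT)).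
  by exists (planar [set x | kink a c k x = 0]); split=> //; [exact: measurable_kink|exact: kink_null].
have := negligibleU (nk (ordS i)) (nk (ord_pred i)); apply: negligibleS => z /=.
move=> nz; apply: contrapT => /not_orP[h1 h2]; apply: nz => zi; rewrite (FE i)//.
move: zi; rewrite /planar/= ctE// => -[_ zi]; split; rewrite lt_neqAle zi andbT.
  apply/eqP => h; apply: h2; rewrite /planar/= /kink ord_predK ord_predP3.
  by apply/eqP; rewrite subr_eq0 h.
apply/eqP => h; apply: h1; rewrite /planar/= /kink ordSK ordSS3.
by apply/eqP; rewrite subr_eq0 h.
Qed.

Lemma sven_piece_cst (u : 'I_3 -> V -> 'M[R]_2) i : PP 2 u -> forall x, sven_piece (u i) x = sven_piece (u i) 0.
Proof.
move=> pu; have pe p q : pol 2 (fun y => u i y p q) := (polyfun_mxP 2 (u i)).1 (pu i) p q.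
have h p q l m := pol_derive (e_ R l) (pol_derive (e_ R m) (pe p q)).
have [b0 E0] := h 0 0 1 1; have [b1 E1] := h 1 1 0 0.
have [b2 E2] := h 1 0 1 0; have [b3 E3] := h 0 1 0 1.
by move=> x; rewrite /sven_piece !E0 !E1 !E2 !E3.
Qed.

Lemma sven_jump_pol r (u : 'I_3 -> V -> 'M[R]_2) k : (forall i, polyfun r (u i)) -> pol r.-1 (sven_jump a c u k).
Proof.
move=> pu; have pe i p q : pol r (fun y => u i y p q) := (polyfun_mxP r (u i)).1 (pu i) p q.
have h p q l := polB (pol_derive (e_ R l) (pe (ord_pred k) p q)) (pol_derive (e_ R l) (pe (ordS k) p q)).
by apply: polB; [apply: polB; [apply: polD|]|]; apply: polZ; exact: h.
Qed.

Lemma sven_eq_piece (u : 'I_3 -> V -> 'M[R]_2) : PP 2 u -> matching a c u ->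
  (forall k s, 0 <= s <= 1 -> sven_jump a c u k (c + s *: spoke k) = 0) ->
  sven_eq a c u (fun i x => sven_piece (u i) x).
Proof.
move=> pu mu ju f tf; rewrite (sven_weak nd cint pu mu tf).
rewrite big1 ?mulr0 ?subr0// => k _.
rewrite (@spoke_integral_eq _ _ _ _ _ (fun _ => 0)) => [|s s01]; last by rewrite ju// mul0r.
by rewrite /spoke_integral Rintegral_cst// mul0r.
Qed.

Lemma bintegral_vanish (g : 'I_3 -> V -> R) (F : nat -> V -> R) k :
  (forall i, integrable2 (ct a c i) (g i)) -> (forall n, continuous (F n)) ->
  (forall n x, `|F n x| <= 1) ->
  (forall x, kink a c k x != 0 -> \forall n \near \oo, F n x = 0) ->
  (fun n => bintegral a c (fun i x => g i x * F n x)) @ \oo --> (0 : R).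
Proof.
move=> gi cF F1 F0.
have L i : (fun n => integral2 (ct a c i) (fun x => g i x * F n x)) @ \oo --> (0 : R).
  apply: (@integral_vanish _ (RT * RT)%type R (leb2 (R:=R)) (planar (ct a c i))
    (planar [set x | kink a c k x = 0]) (fun z => g i (vec2 z.1 z.2)) (fun n z => F n (vec2 z.1 z.2))).
  - exact: measurable_planar_ct.
  - exact: gi.
  - by move=> n; apply: measurable_funTS; exact: measurable_continuous2.
  - by move=> n z; exact: F1.
  - exact: measurable_kink.
  - exact: kink_null.
  - by move=> z _ /eqP kz; apply: cvg_near_cst; exact: F0.
rewrite -[0 in X in _ --> X](addr0 0) -[X in X + 0](addr0 0).
rewrite (_ : (fun n => _) = fun n => integral2 (ct a c 0) (fun x => g 0 x * F n x) +
    integral2 (ct a c 1) (fun x => g 1 x * F n x) + integral2 (ct a c 2) (fun x => g 2 x * F n x)).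
  exact: (cvgD (cvgD (L 0) (L 1)) (L 2)).
by apply/funext => n; rewrite /bintegral sum3.
Qed.

(** Suppose the density is nonzero at a point [p] of the open spoke. Along the bumps [F n] around
    [p] the cell integrals of both the density [g] and the piecewise value tend to 0, but their
    difference is a fixed multiple of a spoke integral that is nonzero by the constant sign of the
    density near [p]. *)
Lemma sven_integrable_jump (u : 'I_3 -> V -> 'M[R]_2) k s : PP 2 u -> matching a c u -> sven_integrable a c u ->
  sven_jump a c u k (c + s *: spoke k) = 0.
Proof.
move=> pu mu [g gi ug]; have pJ k' := sven_jump_pol k' pu.
(* The density is a polynomial, so the open spoke suffices; its points are interior to the triangle
   and admit bumps. *)
apply: (pol_line_eq0 (pJ k)) => {}s s0 s1; apply/eqP/negPn/negP => J0.
set J := sven_jump a c u in J0 *; set p := c + s *: spoke k in J0 *.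
have cJ k' : continuous (J k') := pol_continuous (pJ k').
have [iS iP SP] := ordS3_neq k.
have PS : (ord_pred k == ordS k) = false by rewrite eq_sym.
have hS : hat (ordS k) p = 1 - s by rewrite hat_spoke// iS.
have hP : hat (ord_pred k) p = 1 - s by rewrite hat_spoke// iP.
have hk : 1 - s < hat k p by rewrite hat_spoke_self// ltrDl divr_gt0// wt_gt0.
have pint : (triangle a)° p.
  apply/(interior_triangle_hatE nd cint) => j.
  have [->|->|->] := ord3_cases k j; rewrite ?hS ?hP ?subr_gt0//.
  by apply: lt_trans hk; rewrite subr_gt0.
have ch j : continuous (hat j) by apply: (@pol_continuous _ 1); exact: hat_pol.
have near_lt j : hat j p < hat k p -> \forall x \near p, hat j x < hat k x.
  move=> h; have cd : continuous (fun x => hat k x - hat j x).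
    by move=> x; exact: (cvgB (ch k x) (ch j x)).
  have : \forall x \near p, 0 < hat k x - hat j x by apply: (cvgr_gt _ (cd p)); rewrite subr_gt0.
  by apply: filterS => x; rewrite subr_gt0.
have nS : \forall x \near p, hat (ordS k) x < hat k x by apply: near_lt; rewrite hS.
have nP : \forall x \near p, hat (ord_pred k) x < hat k x by apply: near_lt; rewrite hP.
have nJ : \forall x \near p, 0 < J k p * J k x.
  have cd : continuous (fun x => J k p * J k x) by move=> x; exact: (cvgM (cvg_cst _) (cJ k x)).
  by apply: (cvgr_gt _ (cd p)); rewrite -expr2 exprn_even_gt0.
have [e e0 eP] := nbhs_square (filterI nJ (filterI nS nP)).
have [d0 d00 tst] := box_test pint.
pose d := Num.min d0 e.
have dd0 : 0 < d by rewrite lt_min d00 e0.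
(* On the box the density keeps its sign, and [hat k] exceeds the two other hats, which excludes the
   other spokes. *)
have bi x : box p d x != 0 ->
    [/\ 0 < J k p * J k x, hat (ordS k) x < hat k x & hat (ord_pred k) x < hat k x].
  move=> /box_neq0[x0 x1]; have [//|//|? []//] := eP x.
  - by apply: lt_le_trans x0 _; rewrite ge_min lexx orbT.
  - by apply: lt_le_trans x1 _; rewrite ge_min lexx orbT.
pose L := kink a c k.
(* [G n] vanishes once n times the absolute value of [L x] reaches 1, and is the constant
   [flat 0 1 * flat 0 1] on the spoke, where [L] is 0. *)
pose G n x := flat 0 (1 + n%:R * L x) * flat 0 (1 + - n%:R * L x) : R.
have CG n m : Cn m (G n).
  have h (q : R) : Cn m (flat 0 \o (fun x => 1 + q * L x)).
    by apply: Cn_flat; apply: polD; [exact: pol_cst|apply: polZ; exact: kink_pol].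
  exact: Cn_mul (h n%:R) (h (- n%:R)).
pose F n x := box p d x * G n x.
have tF n : test_function (triangle a) (F n) by apply: tst => //; rewrite ge_min lexx.
have cF n : continuous (F n) by exact: Cn_continuous (Cn_mul (box_Cn 0 p d) (CG n 0%N)).
have F1 n x : `|F n x| <= 1.
  rewrite ger0_norm /F /G; first by rewrite !mulr_ile1 ?mulr_ge0 ?flat_ge0 ?flat0_le1 ?box_ge0 ?box_le1.
  by rewrite !mulr_ge0 ?flat_ge0 ?box_ge0.
have F0 x : L x != 0 -> \forall n \near \oo, F n x = 0.
  move=> Lx; exists (Num.bound (`|L x|^-1)) => // n /= nb.
  have nL : 1 <= n%:R * `|L x|.
    rewrite -ler_pdivrMr ?normr_gt0// div1r.
    apply: (le_trans (ltW (archi_boundP _))); first by rewrite invr_ge0.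
    by rewrite ler_nat.
  rewrite /F /G; have [L0|L0] := leP 0 (L x).
    by rewrite ger0_norm// in nL; rewrite [flat _ (1 + - _ * _)]flat_eq0 ?mulr0//; lra.
  by rewrite ltr0_norm// in nL; rewrite [flat _ (1 + _ * _)]flat_eq0 ?mul0r ?mulr0//; lra.
pose K := fun x => J k x * (box p d x * (flat 0 1 * flat 0 1)).
(* On a spoke other than [k], [hat k] is equal to one of the two other hats, so the box vanishes
   there and only the spoke [k] contributes. *)
have EF n : \sum_k' SI k' (fun x => J k' x * F n x) = SI k K.
  rewrite (bigD1 k)//= big1 ?addr0 => [|j jk].
    apply: spoke_integral_eq => t _; rewrite /K /F /G.
    by rewrite /L kink_spoke// !mulr0 addr0.
  rewrite (@spoke_integral_eq _ _ _ _ _ (fun _ => 0)) => [|t _].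
    by rewrite /spoke_integral Rintegral_cst// mul0r.
  rewrite /F; have [->|/bi[_ h1 h2]] := eqVneq (box p d (c + t *: spoke j)) 0.
    by rewrite mul0r mulr0.
  have [E|E|E] := ord3_cases k j; first by rewrite E eqxx in jk.
    by move: h2; rewrite E !hat_spoke ?ltxx// eq_sym ?iS ?SP.
  by move: h1; rewrite E !hat_spoke ?ltxx// eq_sym ?iP ?PS.
have gci i : integrable2 (ct a c i) g.
  have mct := measurable_planar_ct nd cint.
  apply: integrableS gi; last by move=> z; exact: ct_triangle.
    rewrite (_ : planar (triangle a) =
        planar (ct a c 0) `|` planar (ct a c 1) `|` planar (ct a c 2)).
      by apply: measurableU; [apply: measurableU|]; exact: mct.
    by apply/seteqP; split=> z; rewrite /planar/= (triangle_ctU nd cint).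
  exact: mct.
have lim1 := bintegral_vanish gci cF F1 F0.
have cp i : integrable2 (ct a c i) (sven_piece (u i)).
  rewrite (_ : sven_piece (u i) = fun _ => sven_piece (u i) 0).
    by apply: integrable2_ct; exact: (@cst_continuous V R).
  by apply/funext => x; exact: sven_piece_cst.
have lim2 := bintegral_vanish cp cF F1 F0.
have E n : bintegral a c (fun i x => sven_piece (u i) x * F n x) -
    bintegral a c (fun i x => g x * F n x) = Num.sg (tdet a) * SI k K.
  rewrite -(ug _ (tF n)) (sven_weak nd cint pu mu (tF n)) EF.
  by rewrite opprB addrCA subrr addr0.
have sgK : Num.sg (tdet a) * SI k K = 0.
  apply: (@cvg_unique _ (@norm_hausdorff _ R) ((fun _ : nat => Num.sg (tdet a) * SI k K) @ \oo)).
    exact: cvg_cst.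
  rewrite -(subr0 (0 : R)) (_ : (fun _ => _) = fun n =>
    bintegral a c (fun i x => sven_piece (u i) x * F n x) - bintegral a c (fun i x => g x * F n x)).
    exact: (cvgB lim2 lim1).
  by apply/funext => n; rewrite E.
have cb : continuous (box p d) := Cn_continuous (box_Cn 0 p d).
have cK : continuous K.
  by move=> x; exact: (cvgM (cJ k x) (cvgM (cb x) (cvg_cst _))).
have c0 : continuous (fun _ : V => 0 : R) by exact: (@cst_continuous V R 0).
have cJK : continuous (fun x => J k p * K x + 0).
  by move=> x; exact: (cvgD (cvgM (cvg_cst _) (cK x)) (cvg_cst _)).
(* Multiplication by [J k p] makes the integrand nonnegative on the spoke and positive at [p]. *)
have := spoke_integral_lin a c k (J k p) cK c0.
have -> : SI k K = 0 by move/eqP: sgK; rewrite mulf_eq0 sgr_eq0 (negbTE nd) => /eqP.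
rewrite mulr0 add0r => /eqP; rewrite gt_eqF//.
rewrite [X in X < _](_ : _ = 0); last by rewrite /spoke_integral Rintegral_cst// mul0r.
apply: (@spoke_integral_gt0 _ _ s) => //.
  move=> t _; rewrite addr0 /K; set x := c + t *: _.
  have [->|/bi[h _ _]] := eqVneq (box p d x) 0; first by rewrite !(mul0r, mulr0).
  by rewrite mulrA; apply: mulr_ge0; [exact: ltW|rewrite !mulr_ge0 ?box_ge0 ?flat_ge0].
rewrite addr0 /K -/p mulrA; apply: mulr_gt0; first by rewrite -expr2 exprn_even_gt0.
by apply: mulr_gt0; [exact: box_gt0|apply: mulr_gt0; exact: flat_gt0].
Qed.

End SvenCharacterization.

(** * Derivatives of polynomials and restrictions to lines *)

Section PolynomialDerivatives.
Variable R : realType.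
Local Notation V := 'cV[R]_2.
Implicit Types (x v w O : V) (f g : V -> R).

Lemma is_derive_pol r f x v : pol r f -> is_derive x v f ('D_v f x).
Proof. by move=> pf; apply/derivableP; exact: pol_derivable pf. Qed.

Lemma pol_derive_lin r f g (k : R) v x : pol r f -> pol r g ->
  'D_v (fun y => k * f y + g y) x = k * 'D_v f x + 'D_v g x.
Proof.
move=> pf pg; have kd : is_derive x v (fun _ : V => k) 0 by exact: is_derive_cst.
have [_ ->] := is_derive_add (is_derive_mul kd (is_derive_pol x v pf)) (is_derive_pol x v pg).
by rewrite mul0r add0r.
Qed.

Lemma pol_derive_comm r f v w x : pol r f -> 'D_v ('D_w f) x = 'D_w ('D_v f) x.
Proof.
elim: r f x => [|r IH] f x.
  move=> [k fk]; have D z : 'D_z f = cst 0.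
    by apply/funext => y; rewrite (_ : f = cst k) ?derive_cst//; exact/funext.
  by rewrite !D !derive_cst.
move=> [k [g [h [pg ph fE]]]].
have dc (l : R) y z : is_derive y z (fun _ : V => l) 0 by exact: is_derive_cst.
have D z : 'D_z f = fun y => (z 0 0 * g y + y 0 0 * 'D_z g y) + (z 1 0 * h y + y 1 0 * 'D_z h y).
  apply/funext => y; rewrite (_ : f = fun x => k + x 0 0 * g x + x 1 0 * h x); last exact/funext.
  have [_ ->] := is_derive_add (is_derive_add (dc k y z)
    (is_derive_mul (is_derive_coord y z 0) (is_derive_pol y z pg)))
    (is_derive_mul (is_derive_coord y z 1) (is_derive_pol y z ph)).
  by rewrite add0r.
have D2 y z : 'D_z ('D_y f) x =
    (y 0 0 * 'D_z g x + (z 0 0 * 'D_y g x + x 0 0 * 'D_z ('D_y g) x)) +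
    (y 1 0 * 'D_z h x + (z 1 0 * 'D_y h x + x 1 0 * 'D_z ('D_y h) x)).
  rewrite D; have part (m : 'I_2) q : pol r q -> is_derive x z (fun t => y m 0 * q t + t m 0 * 'D_y q t)
      ((0 * q x + y m 0 * 'D_z q x) + (z m 0 * 'D_y q x + x m 0 * 'D_z ('D_y q) x)).
    move=> pq; apply: is_derive_add; first exact: is_derive_mul (dc _ _ _) (is_derive_pol _ _ pq).
    exact: is_derive_mul (is_derive_coord x z m) (is_derive_pol _ _ (pol_derive y pq)).
  have [_ ->] := is_derive_add (part 0 g pg) (part 1 h ph).
  by rewrite !mul0r !add0r.
rewrite !D2 (IH g x pg) (IH h x ph).
move: ('D_w ('D_v g) x) ('D_w ('D_v h) x) ('D_v g x) ('D_w g x) ('D_v h x) ('D_w h x).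
by move=> *; ring.
Qed.

Lemma pol3_line f O v : pol 3 f -> exists c0 c1 c2 c3 : R, forall s : R,
  f (O + s *: v) = c0 + c1 * s + c2 * s ^+ 2 + c3 * s ^+ 3 /\
  'D_v f (O + s *: v) = c1 + c2 *+ 2 * s + c3 *+ 3 * s ^+ 2.
Proof.
move=> pf; have [p sp pE] := pol_line O v pf.
exists p`_0, p`_1, p`_2, p`_3 => s; split.
  by rewrite pE (horner_coef_wide _ sp) !big_ord_recl big_ord0 /= /bump /=; ring.
have [_ <-] := is_derive_line (is_derive_pol (O + s *: v) v pf).
rewrite (_ : (fun t => _) = horner p); last exact/funext.
have [_ ->] := is_derive_poly p s; rewrite (@horner_coef_wide _ 3).
  by rewrite !big_ord_recl big_ord0 /= /bump /= !coef_deriv /=; ring.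
by rewrite (leq_trans (size_poly _ _))//; case: (size p) sp.
Qed.

Lemma pol_derive_line0 r f O v (s : R) : pol r f -> (forall t : R, f (O + t *: v) = 0) ->
  'D_v f (O + s *: v) = 0.
Proof.
move=> pf f0; have [_ <-] := is_derive_line (is_derive_pol (O + s *: v) v pf).
by rewrite (_ : (fun t => _) = cst 0) ?derive_cst//; exact/funext.
Qed.

Lemma pol_derive_coords r f x v : pol r f ->
  'D_v f x = v 0 0 * 'D_(e_ R 0) f x + v 1 0 * 'D_(e_ R 1) f x.
Proof. by move=> pf; apply: derive_coords; exact: pol_differentiable pf. Qed.

End PolynomialDerivatives.

(** * Factors attached to edges and spokes *)

Section EdgesAndSpokes.
Variables (R : realType) (a : 'I_3 -> 'cV[R]_2) (c : 'cV[R]_2).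
Hypothesis nd : tdet a != 0.
Hypothesis cint : (triangle a)° c.
Local Notation V := 'cV[R]_2.
Implicit Types (x v w : V) (i j k : 'I_3) (f : V -> R).
Local Notation spoke := (spoke a c).
Local Notation hat := (hat a c).
Local Notation dhat := (dhat a c).
Local Notation wt := (wt a c).

Lemma edge_neq0 i : a (ord_pred i) - a (ordS i) != 0.
Proof.
apply/eqP => e; have := bary_vertex nd i i; rewrite eqxx /bary.
move/eqP: e; rewrite subr_eq0 => /eqP ->.
by rewrite /cross [X in _ - X]mulrC subrr mul0r => /esym/eqP; rewrite oner_eq0.
Qed.

(** The cross product with the edge in [pol_div] is [hat i] times the constant [tdet a * wt i],
    which is moved into the quotient. *)
Lemma edge_div i r f : pol r f ->
  (forall s, 0 < s -> s < 1 -> f (a (ordS i) + s *: (a (ord_pred i) - a (ordS i))) = 0) ->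
  exists2 q, pol r.-1 q & forall x, f x = hat i x * q x.
Proof.
move=> pf /(pol_line_eq0 pf) f0; have [q pq fE] := pol_div (edge_neq0 i) pf f0.
exists (fun x => tdet a * wt i * q x) => [|x]; first exact: polZ.
rewrite fE mulrA; congr (_ * _); rewrite mulrCA /hat divfK ?wt_neq0// /bary mulrC divfK//.
by rewrite /cross !mxE; ring.
Qed.

(** The pieces agree on the spoke, hence on its whole line: [s] is an arbitrary real number. *)
Lemma matching_spoke r (g : 'I_3 -> V -> R) k (s : R) : (forall i, pol r (g i)) ->
  matching a c g -> g (ordS k) (c + s *: spoke k) = g (ord_pred k) (c + s *: spoke k).
Proof.
move=> pg mg; apply/eqP; rewrite -subr_eq0; apply/eqP.
have pd : pol r (fun x => g (ordS k) x - g (ord_pred k) x) by exact: polB.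
apply: (pol_line_eq0 pd) => t t0 t1.
have [|h1 h2] := @ct_spokes _ _ _ nd cint k t; first by rewrite !ltW.
by rewrite (mg _ _ _ h1 h2) subrr.
Qed.

Definition dkink k v : R := dhat (ordS k) v - dhat (ord_pred k) v.

(** [dkink k] kills [spoke k], so it is proportional to [cross (spoke k)]. The factor is read on the
    next spoke, where [dkink k] is the inverse of [wt (ordS k)]. *)
Definition kslope k : R := (wt (ordS k))^-1 / cross (spoke k) (spoke (ordS k)).

Lemma cross_spokeS k : cross (spoke k) (spoke (ordS k)) != 0.
Proof.
have := cross_spokes c nd (ord_pred k).
by rewrite ord_predK ord_predP3 => ->; rewrite mulf_neq0// wt_neq0.
Qed.

Lemma kslope_neq0 k : kslope k != 0.
Proof. by rewrite mulf_neq0// invr_eq0 ?wt_neq0// cross_spokeS. Qed.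

Lemma dkinkE k v : dkink k v = kslope k * cross (spoke k) v.
Proof.
have [Sk Pk SP] := ordS3_neq k.
have PS : (ord_pred k == ordS k) = false by rewrite eq_sym.
have t0 : dkink k (spoke k) = 0 by rewrite /dkink !dhat_spoke// Sk Pk !mul0r subrr.
have t1 : dkink k (spoke (ordS k)) = (wt (ordS k))^-1.
  by rewrite /dkink !dhat_spoke// eqxx PS mul0r sub0r opprK subrK div1r.
have lin (s : R) y z : dkink k (s *: y + z) = s * dkink k y + dkink k z.
  by rewrite /dkink !dhat_lin//; ring.
have z0 : dkink k 0 = 0 by have := lin (-1) 0 0; rewrite scaler0 addr0 mulN1r addNr.
rewrite {1}(cross_decomp v (cross_spokeS k)) lin t0 mulr0 add0r -[X in dkink k X]addr0 lin t1 z0.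
by rewrite addr0 /kslope mulrAC [RHS]mulrC mulrA mulrAC.
Qed.

End EdgesAndSpokes.

Lemma mulmx2E (R : realType) (M : 'M[R]_2) (v : 'cV[R]_2) (i : 'I_2) :
  (M *m v) i 0 = M i 0 * v 0 0 + M i 1 * v 1 0.
Proof.
rewrite mxE !big_ord_recl big_ord0 addr0; congr (_ * _ + M i _ * v _ _); exact: val_inj.
Qed.

(** Write [r] as a combination of [p] and [q], with nonzero coefficients. The quadratic form at [r]
    is then a nonzero multiple of the polar value [m] of [p] and [q]; so m = 0, and the form
    vanishes on the basis [p], [q]. *)
Lemma sym_conic_eq0 (R : realType) (M : 'M[R]_2) (p q r : 'cV[R]_2) : M^T = M ->
  cross p q != 0 -> cross q r != 0 -> cross r p != 0 ->
  dot (M *m p) p = 0 -> dot (M *m q) q = 0 -> dot (M *m r) r = 0 -> M = 0.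
Proof.
move=> sM pq qr rp; have m10 : M 1 0 = M 0 1 by rewrite -[in LHS]sM mxE.
have E (z : 'cV[R]_2) : dot (M *m z) z =
    M 0 0 * z 0 0 ^+ 2 + M 0 1 * z 0 0 * z 1 0 *+ 2 + M 1 1 * z 1 0 ^+ 2.
  by rewrite /dot !mulmx2E m10; ring.
rewrite !E {E}; move: pq qr rp; rewrite /cross.
move: (p 0 0) (p 1 0) (q 0 0) (q 1 0) (r 0 0) (r 1 0) => p0 p1 q0 q1 r0 r1 pq qr rp.
move EA: (M 0 0) => A; move EB: (M 0 1) => B; move EC: (M 1 1) => C Ep Eq Er.
pose m := A * p0 * q0 + B * (p0 * q1 + p1 * q0) + C * p1 * q1.
have m0 : m = 0.
  apply: (mulfI (mulf_neq0 qr rp)).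
  (* The quadratic form applied to cross(p,q) r = - cross(q,r) p - cross(r,p) q. *)
  have h : (p0 * q1 - p1 * q0) ^+ 2 * (A * r0 ^+ 2 + B * r0 * r1 *+ 2 + C * r1 ^+ 2) =
    (q0 * r1 - q1 * r0) ^+ 2 * (A * p0 ^+ 2 + B * p0 * p1 *+ 2 + C * p1 ^+ 2) +
    (r0 * p1 - r1 * p0) ^+ 2 * (A * q0 ^+ 2 + B * q0 * q1 *+ 2 + C * q1 ^+ 2) +
    (q0 * r1 - q1 * r0) * (r0 * p1 - r1 * p0) * m *+ 2 by rewrite /m; ring.
  move: h; rewrite Ep Eq Er !mulr0 !add0r => /esym/eqP.
  by rewrite mulrn_eq0/= => /eqP ->.
have Z X : (p0 * q1 - p1 * q0) ^+ 2 * X = 0 -> X = 0.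
  by move/eqP; rewrite mulf_eq0 expf_eq0/= (negbTE pq) => /eqP.
(* The entries are recovered by expanding the unit vectors on [p] and [q], with cross(p,q) as common
   denominator. *)
have A0 : A = 0.
  apply: Z; have -> : (p0 * q1 - p1 * q0) ^+ 2 * A =
    q1 ^+ 2 * (A * p0 ^+ 2 + B * p0 * p1 *+ 2 + C * p1 ^+ 2) +
    p1 ^+ 2 * (A * q0 ^+ 2 + B * q0 * q1 *+ 2 + C * q1 ^+ 2) - p1 * q1 * m *+ 2.
    by rewrite /m; ring.
  by rewrite Ep Eq m0; ring.
have C0 : C = 0.
  apply: Z; have -> : (p0 * q1 - p1 * q0) ^+ 2 * C =
    q0 ^+ 2 * (A * p0 ^+ 2 + B * p0 * p1 *+ 2 + C * p1 ^+ 2) +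
    p0 ^+ 2 * (A * q0 ^+ 2 + B * q0 * q1 *+ 2 + C * q1 ^+ 2) - p0 * q0 * m *+ 2.
    by rewrite /m; ring.
  by rewrite Ep Eq m0; ring.
have B0 : B = 0.
  apply: Z; have -> : (p0 * q1 - p1 * q0) ^+ 2 * B =
    (p0 * q1 + p1 * q0) * m - q0 * q1 * (A * p0 ^+ 2 + B * p0 * p1 *+ 2 + C * p1 ^+ 2) -
    p0 * p1 * (A * q0 ^+ 2 + B * q0 * q1 *+ 2 + C * q1 ^+ 2).
    by rewrite /m; ring.
  by rewrite Ep Eq m0; ring.
apply/matrixP => i j; rewrite mxE.
by have [->|->] := ord2P i; have [->|->] := ord2P j; rewrite ?m10 ?EA ?EB ?EC.
Qed.

Section PolynomialsOnLines.
Variable R : realType.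
Local Notation V := 'cV[R]_2.
Implicit Types (O v : V) (f : V -> R).

Lemma pol1_line f O v (s : R) : pol 1 f -> f (O + s *: v) = (1 - s) * f O + s * f (O + v).
Proof. by move=> /pol1P[k [l [m fE]]]; rewrite !fE !mxE; ring. Qed.

Lemma pol2_line f O v : pol 2 f -> exists c0 c1 c2 : R, forall s : R,
  f (O + s *: v) = c0 + c1 * s + c2 * s ^+ 2.
Proof.
move=> pf; have [p sp pE] := pol_line O v pf; exists p`_0, p`_1, p`_2 => s.
by rewrite pE (horner_coef_wide _ sp) !big_ord_recl big_ord0 /= /bump /=; ring.
Qed.

End PolynomialsOnLines.

(** * Edges in arclength, for either orientation *)

Section Edges.
Variables (R : realType) (a : 'I_3 -> 'cV[R]_2) (c : 'cV[R]_2) (o : 'I_3 -> bool).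
Hypothesis nd : tdet a != 0.
Hypothesis cint : (triangle a)° c.
Local Notation V := 'cV[R]_2.
Implicit Types (x v w : V) (i j k : 'I_3) (f : V -> R).
Local Notation spoke := (spoke a c).
Local Notation hat := (hat a c).
Local Notation dhat := (dhat a c).
Local Notation wt := (wt a c).
Local Notation elen := (elen a o).
Local Notation tau := (tau a o).
Local Notation nu := (nu a o).
Local Notation edge_pt := (edge_pt a o).
Local Notation src := (edge_src a o).
Local Notation tgt := (edge_tgt a o).

Lemma edge_cases i :
  (src i = a (ordS i) /\ tgt i = a (ord_pred i)) \/
  (src i = a (ord_pred i) /\ tgt i = a (ordS i)).
Proof. by rewrite /edge_src /edge_tgt; case: (o i); [right|left]. Qed.

Lemma elen_gt0 i : 0 < elen i.
Proof.
have d0 : tgt i - src i != 0.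
  have [[-> ->]|[-> ->]] := edge_cases i; first exact: edge_neq0.
  by rewrite -opprB oppr_eq0; exact: edge_neq0.
rewrite /elen /enorm sqrtr_gt0 /dot -!expr2; move: d0; set z := _ - _ => z0.
rewrite lt_neqAle addr_ge0 ?sqr_ge0// andbT eq_sym paddr_eq0 ?sqr_ge0// !sqrf_eq0.
by apply: contraNN z0 => /andP[/eqP z1 /eqP z2]; apply/eqP/cv2P; rewrite [RHS]mxE.
Qed.

Lemma elen_neq0 i : elen i != 0. Proof. by rewrite gt_eqF// elen_gt0. Qed.

Lemma elen_tau i : elen i *: tau i = tgt i - src i.
Proof. by rewrite /tau scalerA divff ?scale1r// elen_neq0. Qed.

Lemma edge_pt0 i : edge_pt i 0 = src i.
Proof. by rewrite /edge_pt scale0r addr0. Qed.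

Lemma edge_pt1 i : edge_pt i (elen i) = tgt i.
Proof. by rewrite /edge_pt elen_tau addrC subrK. Qed.

(** Links the parametrisation by ordered vertices, used for divisibility, with the oriented
    arclength of the degrees of freedom. *)
Lemma edge_ptP i (s : R) : exists t : R,
  a (ordS i) + s *: (a (ord_pred i) - a (ordS i)) = edge_pt i t.
Proof.
have [[es et]|[es et]] := edge_cases i; last first.
  exists ((1 - s) * elen i); rewrite /edge_pt -scalerA elen_tau es et.
  by apply: cv2P; rewrite !mxE; ring.
by exists (s * elen i); rewrite /edge_pt -scalerA elen_tau es et.
Qed.

Lemma dot_tau i : dot (tau i) (tau i) = 1.
Proof.
have e : dot (tgt i - src i) (tgt i - src i) = elen i ^+ 2.
  by rewrite sqr_sqrtr// /dot -!expr2 addr_ge0// sqr_ge0.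
apply: (mulfI (mulf_neq0 (elen_neq0 i) (elen_neq0 i))).
rewrite mulr1 -[RHS]expr2 -e -elen_tau /dot !mxE; ring.
Qed.

Lemma edge_basis i v : exists p q : R, v = p *: tau i + q *: nu i.
Proof.
exists (dot v (tau i)), (dot v (nu i)); have := dot_tau i.
rewrite /nu; move: (tau i) => t; rewrite /dot => t1.
by apply: cv2P; rewrite !mxE /=; [rewrite -[LHS]mulr1|rewrite -[LHS]mulr1]; rewrite -t1; ring.
Qed.

Lemma dhat_tau i : dhat i (tau i) = 0.
Proof.
have h j : j != i -> hat i (a j) = 0.
  by move=> ji; rewrite (hat_vertex c nd) eq_sym (negbTE ji) mul0r.
have [Si Pi _] := ordS3_neq i.
have e : hat i (tgt i) = hat i (src i).
  by have [[-> ->]|[-> ->]] := edge_cases i; rewrite !h// ?Si ?Pi.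
have E : hat i (tgt i) = hat i (src i) + elen i * dhat i (tau i).
  by rewrite -edge_pt1 /edge_pt hat_shift.
apply: (mulfI (elen_neq0 i)); apply: (addrI (hat i (src i))).
by rewrite -E e mulr0 addr0.
Qed.

Lemma hat_edge i (s : R) : hat i (edge_pt i s) = 0.
Proof.
rewrite /edge_pt hat_shift// dhat_tau mulr0 addr0.
have [Si Pi _] := ordS3_neq i.
have [[-> _]|[-> _]] := edge_cases i; rewrite (hat_vertex c nd) eq_sym ?Si ?Pi mul0r //.
Qed.

(** [dhat i] already kills [tau i]; if it also killed [nu i] it would be zero, but it is -1 on a
    spoke that ends on the edge. *)
Lemma dhat_nu i : dhat i (nu i) != 0.
Proof.
apply/eqP => n0; have [p [q e]] := edge_basis i (spoke i).
have [Si _ _] := ordS3_neq i.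
have [p' [q' e']] := edge_basis i (spoke (ordS i)).
have z0 : dhat i 0 = 0 by rewrite /dhat /dbary /cross !mxE; ring.
have := dhat_spoke nd cint i (ordS i); rewrite eq_sym Si mul0r sub0r e'.
rewrite dhat_lin// dhat_tau -[q' *: _]addr0 dhat_lin// n0 z0 !mulr0 !addr0 => /eqP.
by rewrite eq_sym oppr_eq0 oner_eq0.
Qed.

Lemma edge_factor i r f : pol r f -> (forall s, f (edge_pt i s) = 0) ->
  exists2 q, pol r.-1 q & forall x, f x = hat i x * q x.
Proof.
by move=> pf f0; apply: (edge_div nd cint pf) => s _ _; have [t ->] := edge_ptP i s.
Qed.

(** [hat i] vanishes on the edge, so the normal derivative there determines the cofactor. *)
Lemma edge_factor_derive i r f w (s : R) q : pol r q -> (forall x, f x = hat i x * q x) ->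
  'D_w f (edge_pt i s) = dhat i w * q (edge_pt i s).
Proof.
move=> pq fE; rewrite (_ : f = fun x => hat i x * q x); last exact/funext.
have [_ ->] := is_derive_mul (is_derive_hat c nd i (edge_pt i s) w) (is_derive_pol (edge_pt i s) w pq).
by rewrite hat_edge mul0r addr0.
Qed.

Lemma spoke_vertex k : c + 1 *: spoke k = a k.
Proof. by rewrite scale1r /spoke addrC subrK. Qed.

Lemma ct_vertex i j : i != j -> ct a c i (a j).
Proof. by move=> ij; rewrite -(spoke_vertex j); apply: ct_spoke => //; exact: ler01. Qed.

Lemma vertex_edge i j : i != j -> exists s, a j = edge_pt i s.
Proof.
move=> ij; have [E|E|E] := ord3_cases i j; first by rewrite E eqxx in ij.
  by have [t e] := edge_ptP i 0; exists t; rewrite -e E scale0r addr0.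
by have [t e] := edge_ptP i 1; exists t; rewrite -e E scale1r addrC subrK.
Qed.

End Edges.

(** * Uniqueness of scalar Clough-Tocher functions *)

Section CloughTocherUniqueness.
Variables (R : realType) (a : 'I_3 -> 'cV[R]_2) (c : 'cV[R]_2) (o : 'I_3 -> bool).
Hypothesis nd : tdet a != 0.
Hypothesis cint : (triangle a)° c.
Local Notation V := 'cV[R]_2.
Implicit Types (x v w : V) (i j k : 'I_3) (f : V -> R).
Local Notation spoke := (spoke a c).
Local Notation hat := (hat a c).
Local Notation dhat := (dhat a c).
Local Notation wt := (wt a c).
Local Notation elen := (elen a o).
Local Notation tau := (tau a o).
Local Notation nu := (nu a o).
Local Notation edge_pt := (edge_pt a o).

(** An affine piece that vanishes at both ends of its outer edge is a multiple of [hat i]. The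
    multiple is its value at [c], and these values agree. *)
Lemma edge_pieces_cst (q : 'I_3 -> V -> R) : (forall i, pol 1 (q i)) ->
  (forall k, q (ordS k) c = q (ord_pred k) c) ->
  (forall k, q (ordS k) (a k) = 0) -> (forall k, q (ord_pred k) (a k) = 0) ->
  exists m : R, forall i x, q i x = m * hat i x.
Proof.
move=> pq qc qS qP.
have qh i : exists m : R, forall x, q i x = m * hat i x.
  have [|r [m rm] qE] := edge_factor (o := o) nd cint (i := i) (pq i).
    move=> s; have e : elen i != 0 := elen_neq0 o nd i.
    have hv j : i != j -> q i (a j) = 0.
      move=> ij; have [E|E|E] := ord3_cases j i; first by rewrite E eqxx in ij.
        by rewrite E.
      by rewrite E.
    have [Si Pi _] := ordS3_neq i.
    have h1 : q i (edge_src a o i) = 0.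
      by have [[-> _]|[-> _]] := edge_cases a o i; rewrite hv// eq_sym ?Si ?Pi.
    have h2 : q i (edge_tgt a o i) = 0.
      by have [[_ ->]|[_ ->]] := edge_cases a o i; rewrite hv// eq_sym ?Si ?Pi.
    rewrite /edge_pt -[s](divfK e) -scalerA elen_tau//.
    by rewrite pol1_line// h1 [X in q i X]addrC subrK h2 !mulr0 addr0.
  by exists m => x; rewrite qE rm mulrC.
have [m mE] := choice qh.
have mc i : q i c = m i by rewrite mE (hat_c nd cint) mulr1.
have mm i : m i = m 0.
  have [S0 S1 S2] := ordS3E; have [P0 P1 P2] := ord_pred3E.
  have := qc 1; have := qc 2; rewrite S1 S2 P1 P2 !mc => e2 e1.
  by have [->|->|->] := ord3P i.
by exists (m 0) => i x; rewrite mE mm.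
Qed.

Lemma clough_tocher_eq0 (g : 'I_3 -> V -> R) : (forall i, pol 3 (g i)) ->
  matching a c g -> (forall w, matching a c (fun i => 'D_w (g i))) ->
  (forall i s, g i (edge_pt i s) = 0) ->
  (forall i s, 'D_(nu i) (g i) (edge_pt i s) = 0) ->
  forall i x, g i x = 0.
Proof.
move=> pg mg mD g0 n0.
(* Vanishing on the edge gives one factor; the vanishing normal derivative is a nonzero multiple of
   the cofactor there and gives the second. *)
have fac i : exists2 r, pol 1 r & forall x, g i x = hat i x ^+ 2 * r x.
  have [q pq gE] := edge_factor nd cint (pg i) (g0 i).
  have [|r pr qE] := edge_factor (o := o) nd cint (i := i) pq.
    move=> s; apply: (mulfI (dhat_nu o nd cint i)); rewrite mulr0.
    by rewrite -(edge_factor_derive o nd (nu i) s pq gE) n0.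
  by exists r => // x; rewrite gE qE mulrA.
have [r rP] := choice (fun i => let: ex_intro2 r p e := fac i in ex_intro _ r (conj p e)).
have pr i : pol 1 (r i) by have [] := rP i.
have gE i x : g i x = hat i x ^+ 2 * r i x by have [] := rP i.
have DgE i w x : 'D_w (g i) x = hat i x * (dhat i w * r i x *+ 2 + hat i x * 'D_w (r i) x).
  have dh := is_derive_hat c nd i x w.
  rewrite (_ : g i = fun x => (hat i x * hat i x) * r i x); last first.
    by apply/funext => y; rewrite gE expr2.
  have [_ ->] := is_derive_mul (is_derive_mul dh dh) (is_derive_pol x w (pr i)).
  ring.
have hS k (s : R) : hat (ordS k) (c + s *: spoke k) = 1 - s.
  by rewrite (hat_spoke nd cint)//; have [->] := ordS3_neq k.
have hP k (s : R) : hat (ord_pred k) (c + s *: spoke k) = 1 - s.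
  by rewrite (hat_spoke nd cint)//; have [_ ->] := ordS3_neq k.
have h0 (s : R) : s < 1 -> 1 - s != 0 by move=> s1; rewrite subr_eq0 gt_eqF.
have rSP k s : r (ordS k) (c + s *: spoke k) = r (ord_pred k) (c + s *: spoke k).
  apply/eqP; rewrite -subr_eq0; apply/eqP; move: s.
  apply: (pol_line_eq0 (polB (pr (ordS k)) (pr (ord_pred k)))) => s _ s1.
  have := matching_spoke nd cint k s pg mg; rewrite !gE hS hP.
  by move=> /(mulfI (expf_neq0 2 (h0 _ s1))) ->; rewrite subrr.
have rho i w : exists d, forall x, 'D_w (r i) x = d.
  by have := pol_derive w (pr i).
(* The jump of the derivative across the spoke, divided by 1 - s. It is obtained for s < 1 and holds
   for all [s], being affine along the spoke. *)
have spk k s w : (dkink a c k w * r (ordS k) (c + s *: spoke k)) *+ 2 +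
    (1 - s) * ('D_w (r (ordS k)) c - 'D_w (r (ord_pred k)) c) = 0.
  have [dS ES] := rho (ordS k) w; have [dP EP] := rho (ord_pred k) w.
  rewrite ES EP.
  have pf : pol 1 (fun x => dkink a c k w *+ 2 * r (ordS k) x + (dS - dP) * hat (ordS k) x).
    by apply: polD; apply: polZ => //; exact: hat_pol.
  have -> : (dkink a c k w * r (ordS k) (c + s *: spoke k)) *+ 2 + (1 - s) * (dS - dP) =
      dkink a c k w *+ 2 * r (ordS k) (c + s *: spoke k) + (dS - dP) * hat (ordS k) (c + s *: spoke k).
    by rewrite hS mulrnAl [(1 - s) * _]mulrC.
  apply: (pol_line_eq0 pf) => {}s _ s1; rewrite hS.
  have := matching_spoke nd cint k s (fun i => pol_derive w (pg i)) (mD w).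
  rewrite !DgE hS hP => /(mulfI (h0 _ s1)); rewrite ES EP -rSP /dkink.
  move: (r _ _) (dhat _ _) (dhat _ _) => p d d' /eqP; rewrite -subr_eq0 => /eqP e.
  by rewrite -[RHS]e; ring.
have k0 k : dkink a c k (spoke (ordS k)) != 0.
  by rewrite dkinkE// mulf_neq0 ?kslope_neq0// cross_spokeS.
(* At s = 1 the second term disappears, leaving the cofactor at the vertex times a nonzero
   [dkink]. *)
have rS k : r (ordS k) (a k) = 0.
  have := spk k 1 (spoke (ordS k)); rewrite spoke_vertex subrr mul0r addr0 => /eqP.
  by rewrite mulrn_eq0/= mulf_eq0 (negbTE (k0 k)) => /eqP.
have rP0 k : r (ord_pred k) (a k) = 0.
  by have := rSP k 1; rewrite spoke_vertex rS => <-.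
have [|m rm] := edge_pieces_cst pr _ rS rP0.
  by move=> k; have := rSP k 0; rewrite scale0r addr0.
(* At s = 0, with each cofactor equal to [m] times [hat], the two terms are 2 and 1 times the same
   product of [dkink] and [m]: hence the factor 3. *)
have m0 : m = 0.
  have Dr i w : 'D_w (r i) c = m * dhat i w.
    rewrite (_ : r i = fun x => m * hat i x); last by apply/funext => x; exact: rm.
    have dm : is_derive c w (fun _ : V => m) 0 by exact: is_derive_cst.
    by have [_ ->] := is_derive_mul dm (is_derive_hat c nd i c w); rewrite mul0r add0r.
  have := spk 0 0 (spoke (ordS 0)); rewrite scale0r addr0 subr0 mul1r rm (hat_c nd cint) !Dr -mulrBr.
  rewrite -/(dkink _ _ _ _) mulr1 => e.
  have : dkink a c 0 (spoke (ordS 0)) * m *+ 3 = 0 by rewrite -[RHS]e; ring.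
  by move/eqP; rewrite mulrn_eq0/= mulf_eq0 (negbTE (k0 0)) => /eqP.
by move=> i x; rewrite gE rm m0 mul0r mulr0.
Qed.

End CloughTocherUniqueness.

(** * Degrees of freedom on A0 *)

Section DegreesOfFreedom0.
Variables (R : realType) (a : 'I_3 -> 'cV[R]_2) (c : 'cV[R]_2) (o : 'I_3 -> bool).
Hypothesis nd : tdet a != 0.
Hypothesis cint : (triangle a)° c.
Local Notation V := 'cV[R]_2.
Implicit Types (x v w : V) (i j k : 'I_3) (f : V -> R).
Local Notation elen := (elen a o).
Local Notation tau := (tau a o).
Local Notation nu := (nu a o).
Local Notation edge_pt := (edge_pt a o).

Lemma A0P (u : 'I_3 -> V -> V) : A0 a c u <-> forall l : 'I_2,
  [/\ forall i, pol 3 (fun x => u i x l 0), matching a c (fun i x => u i x l 0) &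
      forall w, matching a c (fun i => 'D_w (fun x => u i x l 0))].
Proof.
split=> [[pu c1] l|h].
  have [mu mD] := (C1P nd cint pu).1 c1.
  have pl i : pol 3 (fun x => u i x l 0) := (polyfun_mxP 3 (u i)).1 (pu i) l 0.
  split=> // [i j x xi xj|w i j x xi xj]; first by rewrite (mu _ _ _ xi xj).
  have E (m : 'I_2) : 'D_(e_ R m) (fun x => u i x l 0) x = 'D_(e_ R m) (fun x => u j x l 0) x.
    by rewrite -!(derive_polyfunE _ _ _ _ (pu _)) (mD m _ _ _ xi xj).
  by rewrite (pol_derive_coords x w (pl i)) (pol_derive_coords x w (pl j)) !E.
have pu i : polyfun 3 (u i).
  by apply/polyfun_mxP => l m; rewrite ord1; have [+ _ _] := h l; exact.
split=> //; apply/(C1P nd cint pu); split=> [i j x xi xj|k i j x xi xj].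
  by apply/colP => l; have [_ m _] := h l; exact: m xi xj.
apply/colP => l; have [_ _ m] := h l.
rewrite (derive_polyfunE _ _ _ _ (pu i)) (derive_polyfunE _ _ _ _ (pu j)).
exact: m xi xj.
Qed.

Lemma A0_subspace : Defs.subspace (A0 a c).
Proof.
have C0 (l : 'I_2) (z : V -> R) : z = cst 0 -> pol 3 z by move=> ->; exact: pol_cst.
split=> [|r u v /A0P Au /A0P Av]; apply/A0P => l.
  have E i : (fun x => (0 : 'I_3 -> V -> V) i x l 0) = cst 0 :> (V -> R).
    by apply/funext => x; rewrite mxE.
  split=> [i|i j x _ _|w i j x _ _]; [exact: C0 l _ (E i)|by rewrite !mxE|by rewrite !E].
have [pu mu du] := Au l; have [pv mv dv] := Av l.
have E i : (fun x => (r *: u + v) i x l 0) = fun x => r * u i x l 0 + v i x l 0.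
  by apply/funext => x; rewrite !mxE.
split=> [i|i j x xi xj|w i j x xi xj].
- by rewrite E; apply: polD => //; exact: polZ.
- by rewrite !mxE (mu _ _ _ xi xj) (mv _ _ _ xi xj).
- rewrite !E (pol_derive_lin r w x (pu i) (pv i)) (pol_derive_lin r w x (pu j) (pv j)).
  by rewrite (du w _ _ _ xi xj) (dv w _ _ _ xi xj).
Qed.

Lemma gradE r (u : V -> V) x (k l : 'I_2) : polyfun r u ->
  grad u x k l = 'D_(e_ R l) (fun y => u y k 0) x.
Proof. by move=> pu; rewrite mxE (derive_polyfunE _ _ _ _ pu). Qed.

Lemma continuous_edge i (f : V -> R) : continuous f -> continuous (fun s : R => f (edge_pt i s)).
Proof. by move=> cf; exact: continuous_line. Qed.

Lemma dofs0_lin d : linear_form_on (A0 a c) (dofs0 a o d).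
Proof.
move=> r u v [pu _] [pv _].
have puv i : polyfun 3 ((r *: u + v) i : V -> V).
  apply/polyfun_mxP => l m.
  have E : (fun x => (r *: u + v) i x l m) = fun x => r * u i x l m + v i x l m.
    by apply/funext => x; rewrite !mxE.
  rewrite E; apply: polD; [apply: polZ|]; exact: (polyfun_mxP 3 _).1.
have D i w x (k : 'I_2) : ('D_w ((r *: u + v) i) x) k 0 = r * ('D_w (u i) x) k 0 + ('D_w (v i) x) k 0.
  rewrite !(derive_polyfunE _ _ _ _ (puv i), derive_polyfunE _ _ _ _ (pu i), derive_polyfunE _ _ _ _ (pv i)).
  rewrite -(pol_derive_lin r w x ((polyfun_mxP 3 (u i)).1 (pu i) k 0) ((polyfun_mxP 3 (v i)).1 (pv i) k 0)).
  by congr ('D_w _ x); apply/funext => y; rewrite !mxE.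
case: d => [[[j k]|[j [k l]]]|[i k]] /=.
- by rewrite /at_vertex !mxE.
- by rewrite /at_vertex /grad !mxE D.
- have cD (z : 'I_3 -> V -> V) : PP 3 z -> continuous (fun s => ('D_(nu i) (z i) (edge_pt i s)) k 0).
    move=> pz; have := (polyfun_mxP _ _).1 (polyfun_derive (nu i) (pz i)) k 0.
    by move=> /pol_continuous cz; exact: (@continuous_edge i _ cz).
  rewrite /edge_integral -(Rintegral_segment_lin _ _ (cD u pu) (cD v pv)).
  by apply: eq_Rintegral => s _; rewrite D.
Qed.

(** On an edge, each component is a cubic with zero Hermite data, and its normal derivative is a
    quadratic with zero end values and zero integral. Both vanish, which is what [clough_tocher_eq0]
    asks. *)
Lemma dofs0_eq0 u : A0 a c u -> (forall d, dofs0 a o d u = 0) -> u = 0.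
Proof.
move=> Au d0; apply/funext => i; apply/funext => x; apply/colP => l; rewrite [RHS]mxE.
have [pu _] := Au; have /A0P/(_ l)[pg mg mD] := Au.
(* Each degree of freedom at a vertex reads a single piece; matching carries values and gradients to
   the other piece containing that vertex. *)
have vx j k : j != k -> u j (a k) l 0 = 0 /\ forall w, 'D_w (fun x => u j x l 0) (a k) = 0.
  move=> jk; have Sk : ordS k != k by have [->] := ordS3_neq k.
  have xj := ct_vertex nd cint jk; have xk := ct_vertex nd cint Sk; split.
    by have := d0 (inl (inl (k, l))); rewrite /= /at_vertex => <-; exact: mg xj xk.
  move=> w; rewrite (mD w _ _ _ xj xk) (pol_derive_coords _ w (pg (ordS k))).
  have g m : 'D_(e_ R m) (fun x => u (ordS k) x l 0) (a k) = 0.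
    by rewrite -(gradE _ _ _ (pu (ordS k))); exact: (d0 (inl (inr (k, (l, m))))).
  by rewrite !g !mulr0 addr0.
have vends j (z : V) : z = edge_src a o j \/ z = edge_tgt a o j ->
    u j z l 0 = 0 /\ forall w, 'D_w (fun x => u j x l 0) z = 0.
  have [Sj Pj _] := ordS3_neq j; move=> ez; have h : z = a (ordS j) \/ z = a (ord_pred j).
    by have [[es et]|[es et]] := edge_cases a o j; case: ez => ->; rewrite ?es ?et; auto.
  by case: h => ->; apply: vx; rewrite eq_sym ?Sj ?Pj.
apply: (clough_tocher_eq0 (o := o) nd cint pg mg mD); move=> {}i s; have e0 := elen_neq0 o nd i.
  have [c0 [c1 [c2 [c3 E]]]] := pol3_line (edge_src a o i) (tau i) (pg i).
  have [v0 /(_ (tau i)) w0] := vends i _ (or_introl erefl).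
  have [v1 /(_ (tau i)) w1] := vends i _ (or_intror erefl).
  have := E 0; have := E (elen i); rewrite -[_ + _]/(edge_pt i (elen i)) -[_ + 0 *: _]/(edge_pt i 0).
  rewrite edge_pt1// edge_pt0 v0 v1 w0 w1 => -[E1 E2] [E3 E4].
  rewrite /edge_pt (E s).1; have z0 : c0 = 0 by rewrite E3; ring.
  have z1 : c1 = 0 by rewrite E4; ring.
  rewrite z0 z1 in E1 E2 *.
  have z3 : c3 = 0.
    apply: (mulIf (expf_neq0 3 e0)); rewrite mul0r.
    (* Length times end slope minus twice the end value isolates the cubic coefficient. *)
    transitivity (elen i * (0 + c2 *+ 2 * elen i + c3 *+ 3 * elen i ^+ 2) -
      (0 + 0 * elen i + c2 * elen i ^+ 2 + c3 * elen i ^+ 3) *+ 2); first ring.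
    by rewrite -E1 -E2; ring.
  rewrite z3 in E1 *; have z2 : c2 = 0.
    by apply: (mulIf (expf_neq0 2 e0)); rewrite mul0r E1; ring.
  by rewrite z2; ring.
have [c0 [c1 [c2 E]]] := pol2_line (edge_src a o i) (tau i) (pol_derive (nu i) (pg i)).
have [_ /(_ (nu i)) w0] := vends i _ (or_introl erefl).
have [_ /(_ (nu i)) w1] := vends i _ (or_intror erefl).
have := E 0; have := E (elen i); rewrite -[_ + _]/(edge_pt i (elen i)) -[_ + 0 *: _]/(edge_pt i 0).
rewrite edge_pt1// edge_pt0 w0 w1 => E1 E2.
have := d0 (inr (i, l)); rewrite /= /edge_integral.
under eq_Rintegral => t _ do rewrite (derive_polyfunE _ _ _ _ (pu i)) E.
have := Rintegral_segment_cubic c0 c1 c2 0 (ltW (elen_gt0 o nd i)).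
under eq_Rintegral => t _ do rewrite mul0r addr0.
move=> -> E3; rewrite /edge_pt E.
have z0 : c0 = 0 by rewrite E2; ring.
rewrite z0 in E1 E3 *.
have z2 : c2 = 0.
  apply: (mulIf (expf_neq0 3 e0)); rewrite mul0r.
  (* Three lengths times the end value minus six times the integral isolates the quadratic
     coefficient. *)
  transitivity (elen i * 3%:R * (0 + c1 * elen i + c2 * elen i ^+ 2) -
    6%:R * (0 * elen i + c1 * elen i ^+ 2 / 2 + c2 * elen i ^+ 3 / 3 + 0 * elen i ^+ 4 / 4)).
    by field.
  by rewrite -E1 E3; ring.
rewrite z2 in E1 *; have z1 : c1 = 0.
  by apply: (mulIf e0); rewrite mul0r E1; ring.
by rewrite z1; ring.
Qed.

End DegreesOfFreedom0.

(** * Uniqueness in the space with integrable sven *)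

Section SvenSpaceUniqueness.
Variables (R : realType) (a : 'I_3 -> 'cV[R]_2) (c : 'cV[R]_2) (o : 'I_3 -> bool).
Hypothesis nd : tdet a != 0.
Hypothesis cint : (triangle a)° c.
Local Notation V := 'cV[R]_2.
Implicit Types (x v w : V) (i j k : 'I_3) (f : V -> R) (u : 'I_3 -> V -> 'M[R]_2).
Local Notation spoke := (spoke a c).
Local Notation hat := (hat a c).
Local Notation dhat := (dhat a c).
Local Notation wt := (wt a c).
Local Notation elen := (elen a o).
Local Notation tau := (tau a o).
Local Notation nu := (nu a o).
Local Notation edge_pt := (edge_pt a o).

(** Replaces the distributional condition by polynomial identities on the spokes, on which
    linearity, explicit fields and uniqueness can all be checked by computation. *)
Lemma A1P u : A1 a c u <-> [/\ forall i, polyfun 2 (u i), forall i x, (u i x)^T = u i x,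
  matching a c u & forall k s, sven_jump a c u k (c + s *: spoke k) = 0].
Proof.
split=> [[pu su c0 iu]|[pu su mu ju]].
  have mu := (C0P nd cint (fun i => @continuous_polyfun _ _ _ _ _ (pu i))).1 c0.
  by split=> // k s; exact: sven_integrable_jump.
split=> //; first exact/(C0P nd cint (fun i => @continuous_polyfun _ _ _ _ _ (pu i))).
apply: (sven_integrable_cst nd cint (w := fun i => sven_piece (u i) 0)).
rewrite (_ : (fun i _ => _) = fun i x => sven_piece (u i) x).
  by apply: sven_eq_piece => // k s _; exact: ju.
by apply/funext => i; apply/funext => x; rewrite [RHS]sven_piece_cst.
Qed.

Lemma sven_eq_A1 u : A1 a c u -> sven_eq a c u (fun i _ => sven_piece (u i) 0).
Proof.
move=> /A1P[pu su mu ju]; rewrite (_ : (fun i _ => _) = fun i x => sven_piece (u i) x).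
  by apply: sven_eq_piece => // k s _; exact: ju.
by apply/funext => i; apply/funext => x; rewrite [RHS]sven_piece_cst.
Qed.

(** Across a spoke, continuity kills the tangential part of the jump of the gradient, leaving a
    matrix [M] times a multiple of [cross (spoke k)]. Of [M], sven only retains the quadratic form
    in the direction of the spoke. *)
Lemma sven_jump_conic u k x (m : R) (M : 'M[R]_2) :
  (forall p q l, 'D_(e_ R l) (fun y => u (ord_pred k) y p q) x -
    'D_(e_ R l) (fun y => u (ordS k) y p q) x = m * cross (spoke k) (e_ R l) * M p q) ->
  sven_jump a c u k x = - m * dot (M *m spoke k) (spoke k).
Proof.
move=> E; rewrite /sven_jump !E /cross /dot !mulmx2E !mxE /=; ring.
Qed.

Lemma dhatE i v : exists2 p, p != 0 & dhat i v = p * cross (tau i) v.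
Proof.
have e0 := elen_neq0 o nd i.
have w0 := wt_neq0 nd cint i.
have h (s : R) : s != 0 -> a (ordS i) - a (ord_pred i) = s *: tau i ->
    exists2 p, p != 0 & dhat i v = p * cross (tau i) v.
  move=> s0 E; exists (- s / tdet a / wt i); first by rewrite !mulf_neq0 ?oppr_eq0 ?invr_eq0.
  rewrite /dhat /dbary E; move: (tau i) => t; rewrite /cross !mxE.
  by move: (tdet a) (wt i) nd w0 => d w d0 w0; field; rewrite d0 w0.
have [[es et]|[es et]] := edge_cases a o i.
  by apply: (h (- elen i)); rewrite ?oppr_eq0// scaleNr elen_tau// es et opprB.
by apply: (h (elen i)) => //; rewrite elen_tau// es et.
Qed.

Lemma cross_tau_neq0 i v : dhat i v != 0 -> cross (tau i) v != 0.
Proof. by have [p p0 ->] := dhatE i v; apply: contraNneq => ->; rewrite mulr0. Qed.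

Lemma crossC (R' : realType) (v w : 'cV[R']_2) : cross v w = - cross w v.
Proof. by rewrite /cross; ring. Qed.

Lemma cross_tau k : cross (tau (ordS k)) (tau (ord_pred k)) != 0.
Proof.
apply: cross_tau_neq0; apply/eqP => d0.
have e0 : elen (ord_pred k) != 0 := elen_neq0 o nd _.
have w0 := wt_neq0 nd cint (ordS k).
have hz (s : R) v : dhat (ordS k) (s *: v) = s * dhat (ordS k) v.
  by rewrite /dhat /dbary /cross !mxE; ring.
have d1 : dhat (ordS k) (elen (ord_pred k) *: tau (ord_pred k)) = 0.
  by rewrite hz d0 mulr0.
have h v w : dhat (ordS k) (v - w) = hat (ordS k) v - hat (ordS k) w.
  by rewrite /dhat /hat dbary_sub// mulrBl.
have [Sk _ _] := ordS3_neq k.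
have hk : hat (ordS k) (a k) = 0 by rewrite (hat_vertex c nd) Sk mul0r.
have hS : hat (ordS k) (a (ordS k)) = (wt (ordS k))^-1 by rewrite (hat_vertex c nd) eqxx div1r.
have iw : (wt (ordS k))^-1 != 0 by rewrite invr_eq0.
move: d1; rewrite elen_tau// h.
have [[-> ->]|[-> ->]] := edge_cases a o (ord_pred k);
  rewrite ord_predK ord_predP3 hk hS ?subr0 ?sub0r => /eqP; rewrite ?oppr_eq0 (negbTE iw) //.
Qed.

Lemma cross_tau_spoke i k : i != k -> cross (tau i) (spoke k) != 0.
Proof.
move=> ik; apply: cross_tau_neq0; rewrite dhat_spoke// (negbTE ik) mul0r sub0r.
by rewrite oppr_eq0 oner_neq0.
Qed.

(** At a vertex the cofactor [Q] has a quadratic form that vanishes along the two edges, by the edge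
    conditions, and along the spoke, by the jump condition. Once [Q] is [M] times [hat], the three
    spokes at [c] play the same role for [M]. *)
Lemma sven_space_eq0 u : (forall i, polyfun 2 (u i)) -> (forall i x, (u i x)^T = u i x) ->
  matching a c u -> (forall k s, sven_jump a c u k (c + s *: spoke k) = 0) ->
  (forall i s, u i (edge_pt i s) = 0) ->
  (forall i s, dot ('D_(nu i) (u i) (edge_pt i s) *m tau i) (tau i) = 0) ->
  forall i x, u i x = 0.
Proof.
move=> pu su mu ju u0 n0.
have pe i p q : pol 2 (fun x => u i x p q) := (polyfun_mxP 2 (u i)).1 (pu i) p q.
have fac (t : 'I_3 * 'I_2 * 'I_2) : exists r, pol 1 r /\
    forall x, u t.1.1 x t.1.2 t.2 = hat t.1.1 x * r x.
  have [|r pr rE] := edge_factor nd cint (o := o) (i := t.1.1) (pe t.1.1 t.1.2 t.2).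
    by move=> s; rewrite u0 mxE.
  by exists r.
have [r rP] := choice fac.
(* The cofactors of the entries are chosen separately; averaging makes the symmetry of [Q]
   immediate, and the symmetry of [u] leaves the product with [hat] unchanged. *)
pose Q i x : 'M[R]_2 := \matrix_(p, q) ((r (i, p, q) x + r (i, q, p) x) / 2).
have pQ i p q : pol 1 (fun x => Q i x p q).
  apply: pol_ext (polZ 2^-1 (polD (rP (i, p, q)).1 (rP (i, q, p)).1)) => x.
  by rewrite mxE mulrC.
have uE i x p q : u i x p q = hat i x * Q i x p q.
  have e : u i x q p = u i x p q by rewrite -[in LHS](su i x) mxE.
  by rewrite mxE mulrA mulrDr -(rP (i, p, q)).2 -(rP (i, q, p)).2 /= e; field.
have sQ i x : (Q i x)^T = Q i x by apply/matrixP => p q; rewrite !mxE addrC.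
have DuE i w x p q : 'D_w (fun y => u i y p q) x = dhat i w * Q i x p q +
    hat i x * 'D_w (fun y => Q i y p q) x.
  rewrite (_ : (fun y => u i y p q) = fun y => hat i y * Q i y p q); last exact/funext.
  by have [_ ->] := is_derive_mul (is_derive_hat c nd i x w) (is_derive_pol x w (pQ i p q)).
have eQ i s : dot (Q i (edge_pt i s) *m tau i) (tau i) = 0.
  apply: (mulfI (dhat_nu o nd cint i)); rewrite mulr0 -[RHS](n0 i s).
  rewrite /dot !mulmx2E !(derive_polyfunE _ _ _ _ (pu i)) !DuE hat_edge// !mul0r !addr0.
  ring.
have hS k (s : R) : hat (ordS k) (c + s *: spoke k) = 1 - s.
  by rewrite (hat_spoke nd cint)//; have [->] := ordS3_neq k.
have hP k (s : R) : hat (ord_pred k) (c + s *: spoke k) = 1 - s.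
  by rewrite (hat_spoke nd cint)//; have [_ ->] := ordS3_neq k.
have QSP k s : Q (ordS k) (c + s *: spoke k) = Q (ord_pred k) (c + s *: spoke k).
  apply/matrixP => p q; apply/eqP; rewrite -subr_eq0; apply/eqP; move: s.
  apply: (pol_line_eq0 (polB (pQ (ordS k) p q) (pQ (ord_pred k) p q))) => s _ s1.
  have mpq : matching a c (fun i x => u i x p q) by move=> i j x xi xj; rewrite (mu _ _ _ xi xj).
  have := matching_spoke nd cint k s (fun i => pe i p q) mpq; rewrite !uE hS hP.
  have s0 : 1 - s != 0 by rewrite subr_eq0 gt_eqF.
  by move=> /(mulfI s0) ->; rewrite subrr.
have kd k w : dhat (ord_pred k) w - dhat (ordS k) w = - kslope a c k * cross (spoke k) w.
  by rewrite mulNr -dkinkE// /dkink opprB.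
have Qk k : Q (ordS k) (a k) = 0.
  have [Sk Pk _] := ordS3_neq k.
  have QP : Q (ord_pred k) (a k) = Q (ordS k) (a k).
    by have := QSP k 1; rewrite spoke_vertex.
  apply: (sym_conic_eq0 (p := tau (ordS k)) (q := tau (ord_pred k)) (r := spoke k)) => //.
  - exact: cross_tau.
  - by apply: cross_tau_spoke; rewrite Pk.
  - by rewrite crossC oppr_eq0; apply: cross_tau_spoke; rewrite Sk.
  - by have [|s ->] := @vertex_edge _ a o nd (ordS k) k; [rewrite Sk|exact: eQ].
  - by rewrite -QP; have [|s ->] := @vertex_edge _ a o nd (ord_pred k) k; [rewrite Pk|exact: eQ].
  - have := ju k 1; rewrite spoke_vertex (sven_jump_conic (m := - kslope a c k) (M := Q (ordS k) (a k))).
      by move=> /eqP; rewrite opprK mulf_eq0 (negbTE (kslope_neq0 nd cint k)) => /eqP.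
    have hSk : hat (ordS k) (a k) = 0 by rewrite -(spoke_vertex a c) hS subrr.
    have hPk : hat (ord_pred k) (a k) = 0 by rewrite -(spoke_vertex a c) hP subrr.
    by move=> p q l; rewrite !DuE hSk hPk !mul0r !addr0 QP -mulrBl kd.
have QPk k : Q (ord_pred k) (a k) = 0.
  by have := QSP k 1; rewrite spoke_vertex Qk => <-.
have mP (t : 'I_2 * 'I_2) : exists m : R, forall i x, Q i x t.1 t.2 = m * hat i x.
  apply: (edge_pieces_cst o nd cint (q := fun i x => Q i x t.1 t.2)) => [i|k|k|k]; first exact: pQ.
  - by have := QSP k 0; rewrite scale0r addr0 => ->.
  - by rewrite Qk mxE.
  - by rewrite QPk mxE.
have [m mE] := choice mP.
have [M sM ME] : exists2 M : 'M[R]_2, M^T = M & forall p q, m (p, q) = M p q.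
  by exists (Q 0 c) => [|p q]; [exact: sQ|rewrite (mE (p, q)) (hat_c nd cint) mulr1].
have QE i x p q : Q i x p q = M p q * hat i x by rewrite (mE (p, q)) ME.
have Dc i w p q : 'D_w (fun y => Q i y p q) c = M p q * dhat i w.
  rewrite (_ : (fun y => Q i y p q) = fun x => M p q * hat i x); last by apply/funext => x; exact: QE.
  have dm : is_derive c w (fun _ : V => M p q) 0 by exact: is_derive_cst.
  by have [_ ->] := is_derive_mul dm (is_derive_hat c nd i c w); rewrite mul0r add0r.
(* The pieces are now [hat] squared times [M], and the derivative of the square at [c] brings the
   factor 2. *)
have Mk k : dot (M *m spoke k) (spoke k) = 0.
  have := ju k 0; rewrite scale0r addr0 (sven_jump_conic (m := - kslope a c k *+ 2) (M := M)).
    move=> /eqP; rewrite mulf_eq0 oppr_eq0 mulrn_eq0/= oppr_eq0 (negbTE (kslope_neq0 nd cint k)).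
    by move=> /eqP.
  move=> p q l; rewrite !DuE !Dc !QE !(hat_c nd cint) mulrnAl -kd.
  by move: (dhat _ _) (dhat _ _) (M p q) => y z t; ring.
have M0 : M = 0.
  have [S0 S1 S2] := ordS3E; have cs := cross_spokeS nd cint.
  have := cs 0; have := cs 1; have := cs 2; rewrite S0 S1 S2 => c2 c1 c0.
  by apply: (sym_conic_eq0 (p := spoke 0) (q := spoke 1) (r := spoke 2)).
by move=> i x; apply/matrixP => p q; rewrite uE QE M0 !mxE mul0r mulr0.
Qed.

End SvenSpaceUniqueness.

Lemma pol_quad (R : realType) r (M : 'cV[R]_2 -> 'M[R]_2) v w : polyfun r M ->
  pol r (fun x => dot (M x *m v) w).
Proof.
move=> pM; have pe p q : pol r (fun x => M x p q) := (polyfun_mxP r M).1 pM p q.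
have E x : (v 0 0 * w 0 0) * M x 0 0 + (v 1 0 * w 0 0) * M x 0 1 +
    ((v 0 0 * w 1 0) * M x 1 0 + (v 1 0 * w 1 0) * M x 1 1) = dot (M x *m v) w.
  by rewrite /dot !mulmx2E; ring.
by apply: pol_ext E _; apply: polD; apply: polD; apply: polZ.
Qed.

Lemma dot_mul_lin (R : realType) (r : R) (M N : 'M[R]_2) v w :
  dot ((r *: M + N) *m v) w = r * dot (M *m v) w + dot (N *m v) w.
Proof. by rewrite /dot !mulmx2E !mxE; ring. Qed.

Lemma polyfun_lin (R : realType) d m n (r : R) (f g : 'cV[R]_2 -> 'M[R]_(m, n)) :
  polyfun d f -> polyfun d g -> polyfun d (fun x => r *: f x + g x).
Proof.
move=> pf pg; apply/polyfun_mxP => i j.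
apply: pol_ext (polD (polZ r ((polyfun_mxP d f).1 pf i j)) ((polyfun_mxP d g).1 pg i j)) => x.
by rewrite !mxE.
Qed.

Lemma polyfun_derive_lin (R : realType) d m n (r : R) (f g : 'cV[R]_2 -> 'M[R]_(m, n)) v x :
  polyfun d f -> polyfun d g ->
  'D_v (fun x => r *: f x + g x) x = r *: 'D_v f x + 'D_v g x.
Proof.
move=> pf pg; apply/matrixP => i j.
rewrite (derive_polyfunE _ _ _ _ (polyfun_lin r pf pg)) !mxE.
rewrite (derive_polyfunE _ _ _ _ pf) (derive_polyfunE _ _ _ _ pg).
rewrite -(pol_derive_lin r v x ((polyfun_mxP d f).1 pf i j) ((polyfun_mxP d g).1 pg i j)).
by congr ('D_v _ x); apply/funext => y; rewrite !mxE.
Qed.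

(** * Linearity of sven, of the jumps and of the edge pairing *)

Section DegreesOfFreedom1.
Variables (R : realType) (a : 'I_3 -> 'cV[R]_2) (c : 'cV[R]_2) (o : 'I_3 -> bool).
Hypothesis nd : tdet a != 0.
Hypothesis cint : (triangle a)° c.
Local Notation V := 'cV[R]_2.
Implicit Types (x : V) (i j k : 'I_3) (f : V -> R) (u v : 'I_3 -> V -> 'M[R]_2).
Local Notation elen := (elen a o).
Local Notation tau := (tau a o).
Local Notation nu := (nu a o).
Local Notation edge_pt := (edge_pt a o).
Local Notation spoke := (spoke a c).

Lemma sven_piece_lin d (r : R) (f g : V -> 'M[R]_2) x : polyfun d f -> polyfun d g ->
  sven_piece (fun x => r *: f x + g x) x = r * sven_piece f x + sven_piece g x.
Proof.
move=> pf pg; have pe (h : V -> 'M[R]_2) p q : polyfun d h -> pol d (fun y : V => h y p q).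
  by move=> ph; exact: (polyfun_mxP d h).1.
have D2 p q l m : 'D_(e_ R l) ('D_(e_ R m) (fun y => (r *: f y + g y) p q)) x =
    r * 'D_(e_ R l) ('D_(e_ R m) (fun y => f y p q)) x + 'D_(e_ R l) ('D_(e_ R m) (fun y => g y p q)) x.
  rewrite -(pol_derive_lin r _ x (pol_derive _ (pe f p q pf)) (pol_derive _ (pe g p q pg))).
  congr ('D_(e_ R l) _ x); apply/funext => y.
  rewrite -(pol_derive_lin r _ y (pe f p q pf) (pe g p q pg)).
  by congr ('D_(e_ R m) _ y); apply/funext => z; rewrite !mxE.
have id (a1 a2 a3 a4 b1 b2 b3 b4 : R) : (r * a1 + b1) + (r * a2 + b2) - (r * a3 + b3) - (r * a4 + b4) =
    r * (a1 + a2 - a3 - a4) + (b1 + b2 - b3 - b4) by ring.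
have sub (y1 y2 z1 z2 : R) : y1 = z1 -> y2 = z2 -> y1 - y2 = z1 - z2 by move=> -> ->.
have add (y1 y2 z1 z2 : R) : y1 = z1 -> y2 = z2 -> y1 + y2 = z1 + z2 by move=> -> ->.
apply: etrans (id _ _ _ _ _ _ _ _).
exact: (sub _ _ _ _ (sub _ _ _ _ (add _ _ _ _ (D2 0 0 1 1) (D2 1 1 0 0)) (D2 1 0 1 0)) (D2 0 1 0 1)).
Qed.

Lemma sven_jump_lin d (r : R) u v k x : (forall i, polyfun d (u i)) -> (forall i, polyfun d (v i)) ->
  sven_jump a c (r *: u + v) k x = r * sven_jump a c u k x + sven_jump a c v k x.
Proof.
move=> pu pv; have pe (h : 'I_3 -> V -> 'M[R]_2) i p q :
    (forall i, polyfun d (h i)) -> pol d (fun y : V => h i y p q).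
  by move=> ph; exact: (polyfun_mxP d (h i)).1.
have D i p q l : 'D_(e_ R l) (fun y => (r *: u + v) i y p q) x =
    r * 'D_(e_ R l) (fun y => u i y p q) x + 'D_(e_ R l) (fun y => v i y p q) x.
  rewrite -(pol_derive_lin r _ x (pe u i p q pu) (pe v i p q pv)).
  by congr ('D_(e_ R l) _ x); apply/funext => z; rewrite !mxE.
have id (e0 e1 a1 a2 a3 a4 b1 b2 b3 b4 a1' a2' a3' a4' b1' b2' b3' b4' : R) :
    e1 * (r * a1 + b1 - (r * a1' + b1')) + e0 * (r * a2 + b2 - (r * a2' + b2')) -
    e1 * (r * a3 + b3 - (r * a3' + b3')) - e0 * (r * a4 + b4 - (r * a4' + b4')) =
    r * (e1 * (a1 - a1') + e0 * (a2 - a2') - e1 * (a3 - a3') - e0 * (a4 - a4')) +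
    (e1 * (b1 - b1') + e0 * (b2 - b2') - e1 * (b3 - b3') - e0 * (b4 - b4')) by ring.
pose S := ordS k; pose P := ord_pred k.
have sub (y1 y2 z1 z2 : R) : y1 = z1 -> y2 = z2 -> y1 - y2 = z1 - z2 by move=> -> ->.
have mul (e y z : R) : y = z -> e * y = e * z by move=> ->.
have add (y1 y2 z1 z2 : R) : y1 = z1 -> y2 = z2 -> y1 + y2 = z1 + z2 by move=> -> ->.
apply: etrans (id _ _ _ _ _ _ _ _ _ _ _ _ _ _ _ _ _ _).
exact: (sub _ _ _ _ (sub _ _ _ _ (add _ _ _ _
  (mul _ _ _ (sub _ _ _ _ (D P 0 0 1) (D S 0 0 1))) (mul _ _ _ (sub _ _ _ _ (D P 1 1 0) (D S 1 1 0))))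
  (mul _ _ _ (sub _ _ _ _ (D P 1 0 0) (D S 1 0 0)))) (mul _ _ _ (sub _ _ _ _ (D P 0 1 1) (D S 0 1 1)))).
Qed.

Lemma A1_subspace : Defs.subspace (A1 a c).
Proof.
split=> [|r u v /A1P-/(_ nd cint)[pu su mu ju] /A1P-/(_ nd cint)[pv sv mv jv]].
  apply/(A1P nd cint); split=> [i|i x|i j x _ _|k s].
  - by apply/polyfun_mxP => p q; apply: pol_ext (pol_cst 2 0) => x; rewrite mxE.
  - by apply/matrixP => p q; rewrite !mxE.
  - by [].
  - have D p q l i : 'D_(e_ R l) (fun y => (0 : 'I_3 -> V -> 'M[R]_2) i y p q) (c + s *: spoke k) = 0.
      by rewrite (_ : (fun y => _) = cst 0) ?derive_cst//; apply/funext => y; rewrite mxE.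
    by rewrite /sven_jump !D !subrr !mulr0 addr0 !subr0.
apply/(A1P nd cint); split=> [i|i x|i j x xi xj|k s].
- exact: polyfun_lin.
- apply/matrixP => p q; have := congr1 (fun M : 'M[R]_2 => M p q) (su i x).
  by have := congr1 (fun M : 'M[R]_2 => M p q) (sv i x); rewrite !mxE => -> ->.
- by congr (r *: _ + _); [exact: mu xi xj|exact: mv xi xj].
- by rewrite (sven_jump_lin r k _ pu pv) ju jv mulr0 addr0.
Qed.

Definition pairing_density i (m : (R -> R^o) * R^o) (u : V -> 'M[R]_2) (s : R) : R :=
  let t := tau i in let n := nu i in let x := edge_pt i s in
  dot (u x *m t) t * m.2
  + 'D_t (fun y => dot (u y *m t) n : R^o) x * m.1 s
  - dot (u x *m t) n * derive1 m.1 s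
  - dot ('D_n u x *m t) t * m.1 s.

Lemma edge_test_derive (m : (R -> R^o) * R^o) (k l : R) : (forall s, m.1 s = k + l * s) ->
  forall s, derive1 m.1 s = l.
Proof.
move=> mE s; rewrite derive1E.
have dk : is_derive s (1 : R) (fun _ : R => k) 0 by exact: is_derive_cst.
have dl : is_derive s (1 : R) (fun _ : R => l) 0 by exact: is_derive_cst.
rewrite (_ : m.1 = (fun s : R => k + l * s)); last exact/funext.
have [_ ->] := is_deriveD dk (is_deriveM dl (is_derive_id s (1 : R))).
by rewrite /GRing.scale/=; ring.
Qed.

Lemma continuous_pairing_density d i m (u : V -> 'M[R]_2) : polyfun d u ->
  edge_tests m -> continuous (pairing_density i m u).
Proof.
move=> pu [k [l mE]].
have ce f : continuous f -> continuous (fun s : R => f (edge_pt i s)) by exact: continuous_edge.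
have c1 : continuous (fun s : R => dot (u (edge_pt i s) *m tau i) (tau i)).
  exact: (ce _ (pol_continuous (pol_quad (tau i) (tau i) pu))).
have c2 : continuous (fun s : R => dot (u (edge_pt i s) *m tau i) (nu i)).
  exact: (ce _ (pol_continuous (pol_quad (tau i) (nu i) pu))).
have c3 := ce _ (pol_continuous (pol_derive (tau i) (pol_quad (tau i) (nu i) pu))).
have c4 := ce _ (pol_continuous (pol_quad (tau i) (tau i) (polyfun_derive (nu i) pu))).
have cm : continuous (fun s : R => k + l * s).
  by move=> s; exact: (cvgD (cvg_cst _) (cvgM (cvg_cst _) cvg_id)).
rewrite (_ : pairing_density i m u = fun s =>
  dot (u (edge_pt i s) *m tau i) (tau i) * m.2
  + 'D_(tau i) (fun y => dot (u y *m tau i) (nu i)) (edge_pt i s) * (k + l * s)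
  - dot (u (edge_pt i s) *m tau i) (nu i) * l
  - dot ('D_(nu i) u (edge_pt i s) *m tau i) (tau i) * (k + l * s)).
  move=> s; exact: (cvgB (cvgB (cvgD (cvgM (c1 s) (cvg_cst _)) (cvgM (c3 s) (cm s)))
    (cvgM (c2 s) (cvg_cst _))) (cvgM (c4 s) (cm s))).
by apply/funext => s; rewrite /pairing_density/= mE (edge_test_derive mE).
Qed.

Lemma edge_pairing_lin_field d i m (r : R) (u v : V -> 'M[R]_2) : polyfun d u -> polyfun d v ->
  edge_tests m ->
  edge_pairing a o i m (fun x => r *: u x + v x) = r * edge_pairing a o i m u + edge_pairing a o i m v.
Proof.
move=> pu pv tm; have cu := continuous_pairing_density (i := i) pu tm.
have cv := continuous_pairing_density (i := i) pv tm.
rewrite /edge_pairing /edge_integral -(Rintegral_segment_lin r _ cu cv).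
apply: eq_Rintegral => s _; rewrite /pairing_density /= !dot_mul_lin (polyfun_derive_lin _ _ _ pu pv).
rewrite dot_mul_lin.
have -> : 'D_(tau i) (fun y => dot ((r *: u y + v y) *m tau i) (nu i) : R^o) (edge_pt i s) =
    r * 'D_(tau i) (fun y => dot (u y *m tau i) (nu i)) (edge_pt i s) +
    'D_(tau i) (fun y => dot (v y *m tau i) (nu i)) (edge_pt i s).
  have E : (fun y => dot ((r *: u y + v y) *m tau i) (nu i)) =
      (fun y => r * dot (u y *m tau i) (nu i) + dot (v y *m tau i) (nu i)).
    by apply/funext => y; exact: dot_mul_lin.
  apply: (etrans (congr1 (fun h : V -> R => 'D_(tau i) h (edge_pt i s)) E)).
  exact: (pol_derive_lin r _ _ (pol_quad (tau i) (nu i) pu) (pol_quad (tau i) (nu i) pv)).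
have id (a1 a2 a3 a4 b1 b2 b3 b4 y z t : R) :
  (r * a1 + b1) * y + (r * a2 + b2) * z - (r * a3 + b3) * t - (r * a4 + b4) * z =
  r * (a1 * y + a2 * z - a3 * t - a4 * z) + (b1 * y + b2 * z - b3 * t - b4 * z) by ring.
exact: id.
Qed.

Lemma edge_tests_subspace : Defs.subspace (@edge_tests R).
Proof.
split=> [|r m n [k [l mE]] [k' [l' nE]]]; first by exists 0, 0 => s; rewrite mul0r addr0.
exists (r * k + k'), (r * l + l') => s.
by transitivity (r * m.1 s + n.1 s) => //; rewrite mE nE; ring.
Qed.

(** Linearity in the test pair allows convenient tests in place of the members of the given basis
    [bM]. *)
Lemma edge_pairing_lin_test d i (u : V -> 'M[R]_2) : polyfun d u ->
  linear_form_on (@edge_tests R) (fun m => edge_pairing a o i m u).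
Proof.
move=> pu r m n tm tn; have cm := continuous_pairing_density (i := i) pu tm.
have cn := continuous_pairing_density (i := i) pu tn.
rewrite /edge_pairing /edge_integral -(Rintegral_segment_lin r _ cm cn).
have [k [l mE]] := tm; have [k' [l' nE]] := tn.
have E s : (r *: m + n).1 s = (r * k + k') + (r * l + l') * s.
  by transitivity (r * m.1 s + n.1 s) => //; rewrite mE nE; ring.
apply: eq_Rintegral => s _; rewrite /pairing_density /=.
rewrite !(edge_test_derive E) !(edge_test_derive mE) !(edge_test_derive nE).
have id (a1 a2 a3 a4 y y' z z' t t' : R) :
  a1 * (r * y + y') + a2 * (r * z + z') - a3 * (r * t + t') - a4 * (r * z + z') =
  r * (a1 * y + a2 * z - a3 * t - a4 * z) + (a1 * y' + a2 * z' - a3 * t' - a4 * z') by ring.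
exact: id.
Qed.

End DegreesOfFreedom1.

(** * Injectivity of the degrees of freedom on A1 *)

Section UnisolvenceInjectivity.
Variables (R : realType) (a : 'I_3 -> 'cV[R]_2) (c : 'cV[R]_2) (o : 'I_3 -> bool).
Variable bM : 'I_3 -> 'I_3 -> (R -> R^o) * R^o.
Hypothesis nd : tdet a != 0.
Hypothesis cint : (triangle a)° c.
Hypothesis basM : forall i, is_basis (@edge_tests R) (bM i).
Local Notation V := 'cV[R]_2.
Implicit Types (x : V) (i j k : 'I_3) (f : V -> R) (u v : 'I_3 -> V -> 'M[R]_2).
Local Notation elen := (elen a o).
Local Notation tau := (tau a o).
Local Notation nu := (nu a o).
Local Notation edge_pt := (edge_pt a o).
Local Notation spoke := (spoke a c).
Local Notation eqI g := (@eq_Rintegral _ (measurableTypeR R) R (@lebesgue_measure R) _ g).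

Lemma dofs1_lin d : linear_form_on (A1 a c) (dofs1 a o bM d).
Proof.
move=> r u v /(A1P nd cint)[pu _ _ _] /(A1P nd cint)[pv _ _ _].
case: d => [[[j k]|[i k]]|[i k]] /=.
- rewrite /at_vertex /sym_coord !(tnth_nth 0).
  by have [->|->|->] := ord3P k; rewrite /= !mxE.
- have [tb _ _] := basM i; exact: edge_pairing_lin_field (pu i) (pv i) (tb k).
- have cE z : PP 2 z -> continuous (fun s => ((z i : V -> 'M[R]_2) (edge_pt i s) *m nu i) k 0).
    move=> pz; have pe p q := (polyfun_mxP 2 (z i : V -> 'M[R]_2)).1 (pz i) p q.
    have cz : continuous (fun x => ((z i : V -> 'M[R]_2) x *m nu i) k 0).
      apply: (@pol_continuous _ 2).
      apply: pol_ext (polD (polZ (nu i 0 0) (pe k 0)) (polZ (nu i 1 0) (pe k 1))) => x.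
      by rewrite mulmx2E; ring.
    exact: (@continuous_edge R a o i _ cz).
  rewrite /edge_integral -(Rintegral_segment_lin r _ (cE u pu) (cE v pv)).
  by apply: eq_Rintegral => s _; rewrite !mulmx2E !mxE; ring.
Qed.

Lemma edge_pairing_eq0 i (u : V -> 'M[R]_2) m : polyfun 2 u ->
  (forall k, edge_pairing a o i (bM i k) u = 0) -> edge_tests m -> edge_pairing a o i m u = 0.
Proof.
move=> pu b0 tm; have [tb _ gen] := basM i; have [k ->] := gen m tm.
rewrite (linear_form_on_sum (@edge_tests_subspace R) k (edge_pairing_lin_test a o i pu) tb).
by rewrite big1 // => j _; rewrite b0 mulr0.
Qed.

(** On an edge of length l, zero end values give u = t (t - l) B. The moments of u nu give B nu = 0
    and the test (0, 1) gives a zero tangential component, so B = 0. Once [u] vanishes on the edge,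
    only the last term of the pairing remains: an affine function orthogonal to all affine
    functions. *)
Lemma dofs1_eq0 u : A1 a c u -> (forall d, dofs1 a o bM d u = 0) -> u = 0.
Proof.
move=> /(A1P nd cint)[pu su mu ju] d0; apply/funext => i; apply/funext => x.
have pe j p q : pol 2 (fun x => u j x p q) := (polyfun_mxP 2 (u j)).1 (pu j) p q.
have vx j k : j != k -> u j (a k) = 0.
  move=> jk; have Sk : ordS k != k by have [->] := ordS3_neq k.
  rewrite (mu _ _ _ (ct_vertex nd cint jk) (ct_vertex nd cint Sk)).
  have h l : sym_coord (u (ordS k) (a k)) l = 0 := d0 (inl (inl (k, l))).
  have := h 0; have := h 1; have := h 2; rewrite /sym_coord !(tnth_nth 0) /= => h11 h01 h00.
  apply/matrixP => p q; rewrite [RHS]mxE; have [->|->] := ord2P p; have [->|->] := ord2P q => //.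
  by rewrite -su mxE.
have vends j (z : V) : z = edge_src a o j \/ z = edge_tgt a o j -> u j z = 0.
  have [Sj Pj _] := ordS3_neq j; move=> ez; have h : z = a (ordS j) \/ z = a (ord_pred j).
    by have [[es et]|[es et]] := edge_cases a o j; case: ez => ->; rewrite ?es ?et; auto.
  by case: h => ->; apply: vx; rewrite eq_sym ?Sj ?Pj.
have tst (k l m : R) : @edge_tests R (fun s => k + l * s : R^o, m) by exists k, l.
have pair j (k l m : R) := edge_pairing_eq0 (pu j) (fun t => d0 (inl (inr (j, t)))) (tst k l m).
have u0 j s : u j (edge_pt j s) = 0.
  have e0 := elen_neq0 o nd j; set l := elen j in e0.
  have l0 : 0 < l := elen_gt0 o nd j.
  have l1 : l + 1 != 0 by rewrite gt_eqF// ltr_wpDl// ltW.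
  (* The coefficient of t (t - l) is read at t = l + 1, where this product is l + 1. The point lies
     beyond the edge, where the polynomial piece is still defined. *)
  pose B := (l + 1)^-1 *: u j (edge_pt j (l + 1)).
  have uB (t : R) p q : u j (edge_pt j t) p q = t * (t - l) * B p q.
    have [c0 [c1 [c2 E]]] := pol2_line (edge_src a o j) (tau j) (pe j p q).
    have := E 0; have := E l; rewrite -[_ + _]/(edge_pt j l) -[_ + 0 *: _]/(edge_pt j 0).
    rewrite edge_pt1// edge_pt0 (vends j _ (or_introl erefl)) (vends j _ (or_intror erefl)) !mxE.
    move=> E1 E2.
    have z0 : c0 = 0 by rewrite E2; ring.
    have z1 : c1 = - c2 * l.
      apply: (mulIf e0); transitivity ((c0 + c1 * l + c2 * l ^+ 2) - c2 * l ^+ 2).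
        by rewrite z0; ring.
      by rewrite -E1; ring.
    by rewrite /edge_pt !E z0 z1; field.
  have sB : B^T = B by rewrite /B linearZ/= su.
  have bub (b : R) : \int[@lebesgue_measure R]_(t in `[0, l]) (t * (t - l) * b) = - l ^+ 3 / 6 * b.
    have := Rintegral_segment_cubic 0 (- l * b) b 0 (ltW l0).
    rewrite (eqI (fun t : R => t * (t - l) * b)) => [->|t _]; first by field.
    ring.
  have k0 : - l ^+ 3 / 6 != 0 by rewrite mulf_neq0 ?oppr_eq0 ?expf_neq0// invr_eq0 pnatr_eq0.
  have Bn p : (B *m nu j) p 0 = 0.
    have := d0 (inr (j, p)); rewrite /= /edge_integral.
    rewrite (eqI (fun t : R => t * (t - l) * (B *m nu j) p 0)) => [|t _].
      by rewrite bub => /eqP; rewrite mulf_eq0 (negbTE k0) => /eqP.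
    by rewrite !mulmx2E !uB; ring.
  have Bnn w : dot (B *m nu j) w = 0 by rewrite /dot !Bn !mul0r addr0.
  have Btt : dot (B *m tau j) (tau j) = 0.
    have := pair j 0 0 1; rewrite /edge_pairing /edge_integral.
    rewrite (eqI (fun t : R => t * (t - l) * dot (B *m tau j) (tau j))) => [|t _].
      by rewrite bub => /eqP; rewrite mulf_eq0 (negbTE k0) => /eqP.
    rewrite /= (edge_test_derive (m := (fun s => 0 + 0 * s : R^o, 1)) (k := 0) (l := 0))//.
    have id (X D Y Z q : R) : X * 1 + D * (0 + 0 * q) - Y * 0 - Z * (0 + 0 * q) = X by ring.
    apply: (etrans (id _ _ _ _ _)); rewrite /dot !mulmx2E !uB; ring.
  have dt := dot_tau o nd j.
  have ctn : cross (tau j) (nu j) = 1 by rewrite -dt /cross /dot !mxE /=; ring.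
  have B0 : B = 0.
    (* The third direction is the sum of the two frame vectors; B nu = 0 and the symmetry of [B]
       make the form vanish on it. *)
    apply: (sym_conic_eq0 (p := tau j) (q := nu j) (r := tau j + nu j)) => //.
    - by rewrite ctn oner_neq0.
    - have -> : cross (nu j) (tau j + nu j) = - cross (tau j) (nu j) by rewrite /cross !mxE; ring.
      by rewrite ctn oppr_eq0 oner_neq0.
    - have -> : cross (tau j + nu j) (tau j) = - cross (tau j) (nu j) by rewrite /cross !mxE; ring.
      by rewrite ctn oppr_eq0 oner_neq0.
    - have Btn : dot (B *m tau j) (nu j) = dot (B *m nu j) (tau j).
        have b10 : B 1 0 = B 0 1 by rewrite -[in LHS]sB mxE.
        by rewrite /dot !mulmx2E b10; ring.
      have -> : dot (B *m (tau j + nu j)) (tau j + nu j) = dot (B *m tau j) (tau j) +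
          dot (B *m tau j) (nu j) + dot (B *m nu j) (tau j + nu j).
        by rewrite mulmxDr; move: (B *m _) (B *m _) => y z; rewrite /dot !mxE; ring.
      by rewrite Btn !Bnn Btt !addr0.
  by apply/matrixP => p q; rewrite uB B0 !mxE mulr0.
apply: (sven_space_eq0 (o := o) nd cint pu su mu ju u0) => {}i s.
pose g x := dot ('D_(nu i) (u i) x *m tau i) (tau i).
have pg : pol 1 g by exact: pol_quad (polyfun_derive (nu i) (pu i)).
have gE t : g (edge_pt i t) = g (edge_src a o i) + (g (edge_src a o i + tau i) - g (edge_src a o i)) * t.
  have id (y z : R) : (1 - t) * y + t * z = y + (z - y) * t by ring.
  exact: etrans (pol1_line (edge_src a o i) (tau i) t pg) (id _ _).
move: gE; move: (g (edge_src _ _ _)) (g (_ + _)) => p q gE.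
(* The test (- k - l s, 0), its sign cancelling that of the last term; the other terms vanish with
   [u] on the edge. *)
have pr (k l : R) : \int[@lebesgue_measure R]_(t in `[0, elen i]) ((p + (q - p) * t) * (k + l * t)) = 0.
  have := pair i (- k) (- l) 0; rewrite /edge_pairing /edge_integral => E; rewrite -[RHS]E.
  apply: eq_Rintegral => t _.
  rewrite /= (edge_test_derive (m := (fun s => - k + - l * s : R^o, 0)) (k := - k) (l := - l))//.
  rewrite u0 mul0mx.
  have D0 : 'D_(tau i) (fun y => dot (u i y *m tau i) (nu i) : R^o) (edge_pt i t) = 0.
    apply: (pol_derive_line0 _ (pol_quad (tau i) (nu i) (pu i))) => z.
    by rewrite -/(edge_pt i z) u0 mul0mx /dot !mxE !mul0r addr0.
  rewrite D0 -/(g _) gE /dot !mxE; ring.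
rewrite -/(g _) gE; set l := elen i in pr; have l0 : l != 0 := elen_neq0 o nd i.
have l1 : 0 <= l by rewrite ltW// elen_gt0.
have := pr 1 0; rewrite (eqI (fun t : R => p + (q - p) * t + 0 * t ^+ 2 + 0 * t ^+ 3)) => [|t _]; last by ring.
rewrite Rintegral_segment_cubic// => E0.
have := pr 0 1; rewrite (eqI (fun t : R => 0 + p * t + (q - p) * t ^+ 2 + 0 * t ^+ 3)) => [|t _]; last by ring.
rewrite Rintegral_segment_cubic// => E1.
move: (q - p) E0 E1 => r E0 E1.
have r0 : r = 0.
  apply: (mulIf (expf_neq0 3 l0)); rewrite mul0r.
  (* Twelve times the first moment minus 6 l times the integral eliminates [p] and leaves r l^3. *)
  transitivity (12%:R * (0 * l + p * l ^+ 2 / 2 + r * l ^+ 3 / 3 + 0 * l ^+ 4 / 4) -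
    6%:R * l * (p * l + r * l ^+ 2 / 2 + 0 * l ^+ 3 / 3 + 0 * l ^+ 4 / 4)); first by field.
  by rewrite E0 E1; ring.
rewrite r0 mul0r addr0; apply: (mulIf l0); rewrite mul0r -[RHS]E0 r0; ring.
Qed.

End UnisolvenceInjectivity.

(** * Piecewise constants: the space A2 *)

Section DegreesOfFreedom2.
Variables (R : realType) (a : 'I_3 -> 'cV[R]_2) (c : 'cV[R]_2).
Variable bP : 'I_3 -> 'cV[R]_2 -> R^o.
Hypothesis nd : tdet a != 0.
Hypothesis cint : (triangle a)° c.
Hypothesis basP : is_basis (@polyfun R 1 R^o) bP.
Local Notation V := 'cV[R]_2.
Implicit Types (x : V) (i j k : 'I_3).
Local Notation wt := (wt a c).
Local Notation hat := (hat a c).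

Lemma A2P (u : 'I_3 -> V -> R^o) : A2 u <-> exists m : 'I_3 -> R, u = fun i _ => m i.
Proof.
split=> [pu|[m ->] i]; last by apply/polyfunP; exists (m i).
have h i : exists m : R, forall x, u i x = m by exact: polyfun_pol (pu i).
by have [m mE] := choice h; exists m; apply/funext => i; apply/funext => x.
Qed.

Lemma A2_subspace : Defs.subspace (@A2 R).
Proof.
split=> [|r u v /A2P[m ->] /A2P[m' ->]]; apply/A2P; first by exists (fun _ => 0).
by exists (fun i => r * m i + m' i).
Qed.

(** The area of the cell, half the absolute value of [tdet a] times [wt i], multiplied by the mean
    of the three vertex values. *)
Lemma integral2_affine i (f : V -> R) : pol 1 f -> integral2 (ct a c i) f =
  `|tdet a| * wt i * ((f (a (ordS i)) + f (a (ord_pred i)) + f c) / 6).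
Proof.
move=> pf; rewrite (integral2_ct nd cint i (pol_continuous pf)); congr (_ * _).
have -> : f \o ctmap a c i = fun z => f c + (f (a (ordS i)) - f c) * z.1 +
    (f (a (ord_pred i)) - f c) * z.2.
  apply/funext => z; have /pol1P[k [l [m E]]] := pf.
  by rewrite /= !E /ctmap /spoke !mxE; ring.
by rewrite sint_affine; field.
Qed.

Lemma polyfun1_subspace : Defs.subspace (@polyfun R 1 R^o).
Proof.
split=> [|r f g /polyfunP pf /polyfunP pg]; apply/polyfunP; first exact: (pol_cst 1 0).
exact: polD (polZ r pf) pg.
Qed.

Lemma bintegral_scale (m : 'I_3 -> R) (f : V -> R) : continuous f ->
  bintegral a c (fun i x => m i * f x) = \sum_i m i * integral2 (ct a c i) f.
Proof.
move=> cf; apply: eq_bigr => i _; rewrite /integral2 RintegralZl//.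
  exact: measurable_planar_ct.
exact: integrable2_ct.
Qed.

Lemma dofs2_lin d : linear_form_on (@A2 R) (dofs2 a c bP d).
Proof.
move=> r u v /A2P[m ->] /A2P[m' ->]; rewrite /dofs2.
have [tb _ _] := basP; have cb := pol_continuous (polyfun_pol (tb d)).
rewrite !(bintegral_scale _ cb) (bintegral_scale (fun i => r * m i + m' i) cb).
by rewrite mulr_sumr -big_split; apply: eq_bigr => i _ /=; ring.
Qed.

(** Testing with 1 shows that the m_i [wt i] sum to 0. Testing with [hat j] repeats this sum and
    adds the terms of the cells containing the vertex [a j], that is, of all cells but [j]. These
    terms therefore sum to 0 as well, and m_j is left alone. *)
Lemma dofs2_eq0 u : A2 u -> (forall d, dofs2 a c bP d u = 0) -> u = 0.
Proof.
move=> /A2P[m ->] d0; have [tb _ gen] := basP.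
have h (f : V -> R^o) : polyfun 1 f -> \sum_i m i * integral2 (ct a c i) f = 0.
  pose l (f : V -> R^o) : R := \sum_i m i * integral2 (ct a c i) f.
  have ll : linear_form_on (@polyfun R 1 R^o) l.
    move=> r g g' /polyfun_pol pg /polyfun_pol pg'; rewrite /l mulr_sumr -big_split.
    apply: eq_bigr => i _ /=; have pgg : pol 1 (fun x => r * g x + g' x) by exact: polD (polZ r pg) pg'.
    by rewrite (integral2_affine i pg) (integral2_affine i pg') (integral2_affine i pgg); ring.
  move=> /gen[k ->]; rewrite -/(l _) (linear_form_on_sum polyfun1_subspace k ll tb).
  rewrite big1// => j _; have := d0 j; rewrite /dofs2.
  by rewrite (bintegral_scale _ (pol_continuous (polyfun_pol (tb j)))) -/(l _) => ->; rewrite mulr0.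
have D0 : `|tdet a| != 0 by rewrite normr_eq0.
have I1 : \sum_i m i * wt i = 0.
  have /h := pol_polyfun (pol_cst 1 (1 : R)); rewrite (eq_bigr (fun i => (`|tdet a| / 2) * (m i * wt i))).
    by rewrite -mulr_sumr => /eqP; rewrite mulf_eq0 mulf_eq0 (negbTE D0) invr_eq0 pnatr_eq0/= => /eqP.
  by move=> i _; rewrite (integral2_affine i (pol_cst 1 1)); field.
apply/funext => j; apply/funext => x; rewrite [RHS]/(0 : R).
have pj : pol 1 (hat j) by exact: hat_pol.
have w0 := wt_neq0 nd cint.
have E i : m i * integral2 (ct a c i) (hat j) =
    (`|tdet a| / 6) * (m i * wt i + (j != i)%:R * (m i * wt i / wt j)).
  rewrite (integral2_affine i pj) !(hat_vertex c nd) (hat_c nd cint).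
  have [iS iP SP] := ordS3_neq i; have PS : (ord_pred i == ordS i) = false by rewrite eq_sym.
  have Si : (i == ordS i) = false by rewrite eq_sym.
  have Pi : (i == ord_pred i) = false by rewrite eq_sym.
  move: (wt j) (w0 j) => w wn; have [->|->|->] := ord3_cases i j;
  by rewrite !eqxx ?(iS, iP, SP, PS, Si, Pi) /=; field.
have /h := pol_polyfun pj; under eq_bigr do rewrite E.
rewrite -mulr_sumr => /eqP; rewrite mulf_eq0 mulf_eq0 (negbTE D0) invr_eq0 pnatr_eq0/=.
rewrite big_split/= I1 add0r (bigD1 j)//= eqxx mul0r add0r => /eqP I2.
have I3 : \sum_(i < 3 | i != j) m i * wt i = 0.
  apply: (mulIf (invr_neq0 (w0 j))); rewrite mul0r mulr_suml -[RHS]I2.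
  by apply: eq_bigr => i ij; rewrite eq_sym ij mul1r.
move: I1; rewrite (bigD1 j)//= I3 addr0 => /eqP; rewrite mulf_eq0 (negbTE (w0 j)) orbF => /eqP //.
Qed.

Definition cell_basis i : 'I_3 -> V -> R^o := fun j _ => (i == j)%:R.

Lemma cell_basis_A2 i : A2 (cell_basis i).
Proof. by apply/A2P; exists (fun j => (i == j)%:R). Qed.

Lemma cell_basis_free (k : 'I_3 -> R) : \sum_i k i *: cell_basis i = 0 -> forall i, k i = 0.
Proof.
move=> /(congr1 (fun g : 'I_3 -> V -> R^o => g ^~ 0)) E i.
have := congr1 (fun g : 'I_3 -> R => g i) E; rewrite /= !fct_sumE (bigD1 i)//= big1 ?addr0.
  by move=> e; transitivity (k i * (i == i)%:R); [rewrite eqxx mulr1|exact: e].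
by move=> j ji; transitivity (k j * (j == i)%:R) => //; rewrite (negbTE ji) mulr0.
Qed.

End DegreesOfFreedom2.

Lemma pol_derive_scaled_add (R : realType) r (f g : 'cV[R]_2 -> R) (k : R) v x :
  pol r f -> pol r g ->
  'D_v (fun y => k * (f y + g y)) x = k * ('D_v f x + 'D_v g x).
Proof.
move=> pf pg; have kd : is_derive x v (fun _ : 'cV[R]_2 => k) 0 by exact: is_derive_cst.
have [_ ->] := is_derive_mul kd (is_derive_add (is_derive_pol x v pf) (is_derive_pol x v pg)).
by rewrite mul0r add0r.
Qed.

(** * Deformations, rigid motions and compatibility *)

Section DeformationComplex.
Variables (R : realType) (a : 'I_3 -> 'cV[R]_2) (c : 'cV[R]_2).
Hypothesis nd : tdet a != 0.
Hypothesis cint : (triangle a)° c.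
Local Notation V := 'cV[R]_2.
Implicit Types (x y t : V) (i j k : 'I_3) (f : V -> R) (u v : 'I_3 -> V -> V).
Local Notation spoke := (spoke a c).

Lemma def_E r u i x (p q : 'I_2) : polyfun r (u i) -> def_ u i x p q =
  2^-1 * ('D_(e_ R q) (fun y => u i y p 0) x + 'D_(e_ R p) (fun y => u i y q 0) x).
Proof. by move=> pu; rewrite !mxE -!(gradE _ _ _ pu) !mxE. Qed.

Lemma def_pol r u i (p q : 'I_2) : polyfun r (u i) -> pol r.-1 (fun x => def_ u i x p q).
Proof.
move=> pu; have pe l : pol r (fun x => u i x l 0) by exact: (polyfun_mxP r (u i)).1.
apply: pol_ext (polZ 2^-1 (polD (pol_derive (e_ R q) (pe p)) (pol_derive (e_ R p) (pe q)))) => x.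
by rewrite (def_E _ _ _ pu).
Qed.

Lemma def_derive r u i x (p q l : 'I_2) : polyfun r (u i) ->
  'D_(e_ R l) (fun y => def_ u i y p q) x =
  2^-1 * ('D_(e_ R l) ('D_(e_ R q) (fun y => u i y p 0)) x +
          'D_(e_ R l) ('D_(e_ R p) (fun y => u i y q 0)) x).
Proof.
move=> pu; have pe m : pol r (fun x => u i x m 0) by exact: (polyfun_mxP r (u i)).1.
rewrite -(pol_derive_scaled_add _ _ _ (pol_derive (e_ R q) (pe p)) (pol_derive (e_ R p) (pe q))).
congr ('D_(e_ R l) _ x); apply/funext => y; exact: def_E pu.
Qed.

Lemma def_lin r (s : R) u v : (forall i, polyfun r (u i)) -> (forall i, polyfun r (v i)) ->
  def_ (s *: u + v) = s *: def_ u + def_ v.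
Proof.
move=> pu pv; apply/funext => i; apply/funext => x; apply/matrixP => p q.
have pe (h : 'I_3 -> V -> V) l : (forall i, polyfun r (h i)) -> pol r (fun x => h i x l 0).
  by move=> ph; exact: (polyfun_mxP r (h i)).1.
have puv : polyfun r ((s *: u + v) i) by exact: polyfun_lin.
have D l m : 'D_(e_ R l) (fun y => (s *: u + v) i y m 0) x =
    s * 'D_(e_ R l) (fun y => u i y m 0) x + 'D_(e_ R l) (fun y => v i y m 0) x.
  rewrite -(pol_derive_lin s _ x (pe u m pu) (pe v m pv)).
  by congr ('D_(e_ R l) _ x); apply/funext => z; rewrite !mxE.
have E : (s *: def_ u + def_ v) i x p q = s * def_ u i x p q + def_ v i x p q.
  transitivity ((s *: def_ u i x + def_ v i x) p q) => //.
  by move: (def_ u i x) (def_ v i x) => M N; rewrite !mxE.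
have id (h y1 y2 z1 z2 w1 w2 : R) : w1 = s * y1 + z1 -> w2 = s * y2 + z2 ->
  h * (w1 + w2) = s * (h * (y1 + y2)) + h * (z1 + z2) by move=> -> ->; ring.
have Eu := def_E x p q (pu i); have Ev := def_E x p q (pv i).
transitivity (s * def_ u i x p q + def_ v i x p q); last exact: esym E.
apply: (etrans (etrans (def_E x p q puv) (id _ _ _ _ _ _ _ (D q p) (D p q)))).
exact: esym (congr2 (fun y z : R => s * y + z) Eu Ev).
Qed.

(** The Saint-Venant compatibility identity: third derivatives cancel once their order is
    exchanged. *)
Lemma sven_piece_def r u i x : polyfun r (u i) -> sven_piece (def_ u i) x = 0.
Proof.
move=> pu; have pe m : pol r (fun x => u i x m 0) by exact: (polyfun_mxP r (u i)).1.
pose h (p m l n : 'I_2) := 'D_(e_ R n) ('D_(e_ R l) ('D_(e_ R m) (fun y => u i y p 0))) x.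
have E p q l n : 'D_(e_ R n) ('D_(e_ R l) (fun y => def_ u i y p q)) x =
    2^-1 * (h p q l n + h q p l n).
  have p1 := pol_derive (e_ R l) (pol_derive (e_ R q) (pe p)).
  have p2 := pol_derive (e_ R l) (pol_derive (e_ R p) (pe q)).
  rewrite /h -(pol_derive_scaled_add _ _ _ p1 p2).
  congr ('D_(e_ R n) _ x); apply/funext => y; exact: def_derive pu.
have hC p m l n : h p m l n = h p l m n.
  have F : 'D_(e_ R l) ('D_(e_ R m) (fun y => u i y p 0)) = 'D_(e_ R m) ('D_(e_ R l) (fun y => u i y p 0)).
    by apply/funext => y; exact: (pol_derive_comm _ _ _ (pe p)).
  exact: (congr1 (fun f : V -> R => 'D_(e_ R n) f x) F).
have hC' p m l n : h p m l n = h p m n l.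
  exact: (pol_derive_comm _ _ _ (pol_derive (e_ R m) (pe p))).
have id (y1 y2 y3 y4 y5 y6 : R) : y2 = y1 -> y4 = y1 -> y3 = y5 -> y6 = y5 ->
    2^-1 * (y1 + y1) + 2^-1 * (y5 + y5) - 2^-1 * (y3 + y4) - 2^-1 * (y2 + y6) = 0.
  by move=> -> -> -> ->; field.
rewrite /sven_piece (E 0 0 1 1) (E 1 1 0 0) (E 1 0 0 1) (E 0 1 1 0).
exact: id (etrans (hC' 0 1 1 0) (hC 0 1 0 1)) (hC 0 1 0 1)
  (etrans (hC' 1 0 0 1) (hC 1 0 1 0)) (hC 1 0 1 0).
Qed.

(** The spoke condition is the point. The gradient is continuous, so the jump [H] of the second
    derivatives kills the direction of the spoke; with the symmetry of second derivatives this makes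
    the density vanish. *)
Lemma def_A1 u : A0 a c u -> A1 a c (def_ u).
Proof.
move=> Au; have [pu _] := Au; apply/(A1P nd cint).
have pe i l : pol 3 (fun x => u i x l 0) by exact: (polyfun_mxP 3 (u i)).1.
have mD l w : matching a c (fun i => 'D_w (fun x => u i x l 0)).
  by have /(A0P nd cint)/(_ l)[_ _] := Au; exact.
split=> [i|i x|i j x xi xj|k s].
- by apply/polyfun_mxP => p q; exact: def_pol (pu i).
- apply/matrixP => p q; rewrite mxE; apply: (etrans (def_E x q p (pu i))).
  by rewrite addrC; exact: esym (def_E x p q (pu i)).
- apply/matrixP => p q; apply: (etrans (def_E x p q (pu i))).
  apply: etrans (esym (def_E x p q (pu j))).
  have sm (y z y' z' : R) : y = y' -> z = z' -> 2^-1 * (y + z) = 2^-1 * (y' + z') by move=> -> ->.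
  exact: sm (mD p (e_ R q) i j x xi xj) (mD q (e_ R p) i j x xi xj).
pose t := spoke k; set x := c + s *: t.
pose h i (p m l : 'I_2) := 'D_(e_ R l) ('D_(e_ R m) (fun y => u i y p 0)) x.
pose H p m l := h (ord_pred k) p m l - h (ordS k) p m l.
have sb (y z y' z' : R) : y = y' -> z = z' -> y - z = y' - z' by move=> -> ->.
have HC p m l : H p m l = H p l m.
  exact: sb (pol_derive_comm _ _ x (pe _ p)) (pol_derive_comm _ _ x (pe _ p)).
(* The jump of a first derivative is zero along the whole line of the spoke, hence so is its
   derivative in that direction. *)
have Ht p m : t 0 0 * H p m 0 + t 1 0 * H p m 1 = 0.
  pose f y := (-1) * 'D_(e_ R m) (fun y => u (ordS k) y p 0) y + 'D_(e_ R m) (fun y => u (ord_pred k) y p 0) y.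
  have p1 := pol_derive (e_ R m) (pe (ordS k) p).
  have p2 := pol_derive (e_ R m) (pe (ord_pred k) p).
  have pf : pol 2 f by apply: polD => //; exact: polZ.
  have f0 (z : R) : f (c + z *: t) = 0.
    have id0 (y y' : R) : y = y' -> -1 * y + y' = 0 by move=> ->; ring.
    exact: id0 (matching_spoke nd cint k z (fun i => pol_derive (e_ R m) (pe i p)) (mD p (e_ R m))).
  have id (t0 t1 a0 b0 a1 b1 d0 d1 d : R) : d0 = -1 * a0 + b0 -> d1 = -1 * a1 + b1 ->
      d = t0 * d0 + t1 * d1 -> d = 0 -> t0 * (b0 - a0) + t1 * (b1 - a1) = 0.
    by move=> -> -> -> <-; ring.
  exact: id (pol_derive_lin (-1) (e_ R 0) x p1 p2) (pol_derive_lin (-1) (e_ R 1) x p1 p2)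
    (pol_derive_coords x t pf) (pol_derive_line0 s pf f0).
have E p q l : 'D_(e_ R l) (fun y => def_ u (ord_pred k) y p q) x -
    'D_(e_ R l) (fun y => def_ u (ordS k) y p q) x = 2^-1 * (H p q l + H q p l).
  have id (y1 y2 z1 z2 : R) : 2^-1 * (y1 + y2) - 2^-1 * (z1 + z2) = 2^-1 * ((y1 - z1) + (y2 - z2)).
    by rewrite -mulrBr opprD addrACA.
  apply: etrans (id _ _ _ _).
  exact: sb (def_derive x p q l (pu _)) (def_derive x p q l (pu _)).
have id (e0 e1 a1 a2 a3 a4 b1 b2 b3 b4 : R) : a1 = b1 -> a2 = b2 -> a3 = b3 -> a4 = b4 ->
  e1 * a1 + e0 * a2 - e1 * a3 - e0 * a4 = e1 * b1 + e0 * b2 - e1 * b3 - e0 * b4.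
  by move=> -> -> -> ->.
apply: (etrans (id _ _ _ _ _ _ _ _ _ _ (E 0 0 1) (E 1 1 0) (E 1 0 0) (E 0 1 1))).
have -> : cross (e_ R 1) (spoke k) = - t 0 0 by rewrite /cross !mxE /= /t; ring.
have -> : cross (e_ R 0) (spoke k) = t 1 0 by rewrite /cross !mxE /= /t; ring.
have := Ht 0 0; have := Ht 1 0; have := Ht 0 1; have := Ht 1 1.
rewrite (HC 0 1 0) (HC 1 1 0).
move: (H 0 0 0) (H 0 0 1) (H 0 1 1) (H 1 0 0) (H 1 0 1) (H 1 1 1) (t 0 0) (t 1 0).
move=> h000 h001 h011 h100 h101 h111 t0 t1 e11 e01 e10 e00.
(* The density is half the difference of two instances of [Ht]. *)
transitivity (2^-1 * ((t0 * h100 + t1 * h101) - (t0 * h001 + t1 * h011))); first by field.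
by rewrite e10 e01 subrr mulr0.
Qed.

Lemma rigid_eq0 (p : V) (b : R) x y : p + b *: Defs.rot x = 0 -> p + b *: Defs.rot y = 0 ->
  x != y -> p = 0 /\ b = 0.
Proof.
move=> ex ey xy; have e : b *: Defs.rot (x - y) = 0.
  have -> : b *: Defs.rot (x - y) = (p + b *: Defs.rot x) - (p + b *: Defs.rot y).
    by apply: cv2P; rewrite !mxE /=; ring.
  by rewrite ex ey subrr.
have b0 : b = 0.
  apply: contraNeq xy => b0; move/eqP: e; rewrite scaler_eq0 (negbTE b0)/= => /eqP e.
  have e0 := congr1 (fun v : V => v 0 0) e; have e1 := congr1 (fun v : V => v 1 0) e.
  rewrite !mxE /= in e0 e1; apply/eqP/cv2P; lra.
by rewrite b0 scale0r addr0 in ex.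
Qed.

Lemma pol_cst_of_derive r f : pol r f -> (forall (l : 'I_2) x, 'D_(e_ R l) f x = 0) ->
  forall x, f x = f 0.
Proof.
move=> pf d0 x; have dl (s : R) : is_derive s (1 : R) (fun t : R => f (0 + t *: x)) 0.
  have -> : 0 = 'D_x f (0 + s *: x) by rewrite (pol_derive_coords _ _ pf) !d0 !mulr0 addr0.
  exact: is_derive_line (is_derive_pol _ _ pf).
have := @is_derive_0_is_cst _ (fun t : R => f (0 + t *: x)) 1 0 dl.
by rewrite scale1r scale0r !add0r.
Qed.

(** The diagonal gives D_0 g_0 = D_1 g_1 = 0 and the off-diagonal entry gives D_0 g_1 = - D_1 g_0.
    Exchanging derivatives, D_1 g_0 has zero gradient; it is a constant -b, and both components are
    affine. *)
Lemma def_eq0_piece r u i : polyfun r (u i) -> (forall x, def_ u i x = 0) ->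
  exists (p : V) (b : R), forall x, u i x = p + b *: Defs.rot x.
Proof.
move=> pu d0; have pe m : pol r (fun x => u i x m 0) by exact: (polyfun_mxP r (u i)).1.
pose g m := fun y => u i y m 0.
have e p q x : 'D_(e_ R q) (g p) x + 'D_(e_ R p) (g q) x = 0.
  have := congr1 (fun M : 'M[R]_2 => M p q) (d0 x); rewrite (def_E _ _ _ pu) [RHS]mxE => /eqP.
  by rewrite mulf_eq0 invr_eq0 pnatr_eq0/= => /eqP.
have diag l x : 'D_(e_ R l) (g l) x = 0 by have := e l l x; lra.
have diagf l : 'D_(e_ R l) (g l) = cst 0 by apply/funext => x; exact: diag.
have offf : 'D_(e_ R 0) (g 1) = fun x => (-1) * 'D_(e_ R 1) (g 0) x + 0.
  by apply/funext => x; have := e 0 1 x; lra.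
have z0 w x : 'D_w (cst 0 : V -> R) x = 0 by exact: derive_cst.
have p01 := pol_derive (e_ R 1) (pe 0).
have bE : forall x, 'D_(e_ R 1) (g 0) x = 'D_(e_ R 1) (g 0) 0.
  apply: (pol_cst_of_derive p01) => l x; have [->|->] := ord2P l.
    by rewrite (pol_derive_comm _ _ _ (pe 0)) -/(g 0) diagf z0.
  have := pol_derive_lin (-1) (e_ R 1) x p01 (pol_cst r.-1 0).
  rewrite -offf (pol_derive_comm _ _ _ (pe 1)) -/(g 1) diagf z0.
  by rewrite (_ : 'D_(e_ R 1) (fun=> 0) x = 0) ?addr0; [lra|exact: derive_cst].
pose b := - 'D_(e_ R 1) (g 0) 0.
have aff (m : 'I_2) (s : R) (n : 'I_2) : (forall l x, 'D_(e_ R l) (g m) x = s * (e_ R l) n 0) ->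
    forall x, g m x = g m 0 + s * x n 0.
  move=> h x; have pc := pol_le (leq_addl r 1) (pol_coord R n).
  have ph : pol (r + 1) (fun x => (- s) * x n 0 + g m x).
    by apply: polD; [exact: polZ|exact: pol_le (leq_addr 1 r) (pe m)].
  have := pol_cst_of_derive ph; move=> /(_ _ x) F.
  have /F : forall l x, 'D_(e_ R l) (fun x => (- s) * x n 0 + g m x) x = 0.
    move=> l y; rewrite (pol_derive_lin _ _ _ pc (pol_le (leq_addr 1 r) (pe m))) h.
    by have [_ ->] := is_derive_coord y (e_ R l) n; ring.
  by rewrite [X in _ = - s * X + _ -> _]mxE; lra.
exists (vec2 (g 0 0) (g 1 0)), b => x; apply: cv2P; rewrite !mxE/=.
  rewrite mulrN -mulNr opprK; apply: aff => l y; have [->|->] := ord2P l.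
    by rewrite diag !mxE mulr0.
  by rewrite bE !mxE mulr1.
apply: aff => l y; have [->|->] := ord2P l; last by rewrite diag !mxE mulr0.
apply: (etrans (congr1 (fun f : V -> R => f y) offf)).
by rewrite bE !mxE mulr1 addr0 mulN1r.
Qed.

Lemma spoke_neq0 k : spoke k != 0.
Proof.
apply: contraNneq (cross_spokeS nd cint k) => ->.
by rewrite /cross !mxE !mul0r subrr.
Qed.

(** Each piece is a rigid motion. Two pieces that agree on a spoke agree at two distinct points,
    which determine a rigid motion. *)
Lemma def_eq0 u : A0 a c u -> def_ u = 0 -> exists2 r, @rigid_motions R r & u = fun _ => r.
Proof.
move=> Au d0; have [pu _] := Au.
have h i : exists pb : V * R, forall x, u i x = pb.1 + pb.2 *: Defs.rot x.
  have [|p [b E]] := def_eq0_piece (pu i); last by exists (p, b).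
  by move=> x; rewrite d0.
have [m mE] := choice h.
have eqk k : m (ordS k) = m (ord_pred k).
  have mu l := let: And3 _ m _ := (A0P nd cint u).1 Au l in m.
  have pe l i : pol 3 (fun x => u i x l 0) by exact: (polyfun_mxP 3 (u i)).1.
  have e s : u (ordS k) (c + s *: spoke k) = u (ord_pred k) (c + s *: spoke k).
    by apply/colP => l; exact: (matching_spoke nd cint k s (pe l) (mu l)).
  have d s : ((m (ordS k)).1 - (m (ord_pred k)).1) +
      ((m (ordS k)).2 - (m (ord_pred k)).2) *: Defs.rot (c + s *: spoke k) = 0.
    rewrite scalerBl addrACA -opprD -!mE e subrr //.
  have [|/eqP e1 /eqP e2] := rigid_eq0 (d 0) (d 1).
    rewrite scale0r addr0 scale1r -subr_eq0 opprD addNKr oppr_eq0; exact: spoke_neq0.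
  by move: e1 e2; rewrite !subr_eq0 => /eqP e1 /eqP e2; apply/eqP; rewrite -pair_eqE/= e1 e2 !eqxx.
have [S0 S1 S2] := ordS3E; have [P0 P1 P2] := ord_pred3E.
have := eqk 1; have := eqk 2; rewrite S1 S2 P1 P2 => e2 e1.
exists (fun x => (m 0).1 + (m 0).2 *: Defs.rot x); first by exists (m 0).1, (m 0).2.
apply/funext => i; apply/funext => x; rewrite mE.
by have [->|->|->] := ord3P i; rewrite ?e1 -?e2.
Qed.

Lemma def_rigid (r : V -> V) : rigid_motions r -> def_ (fun _ : 'I_3 => r) = 0.
Proof.
move=> [p [b rE]]; apply/funext => i; apply/funext => x; apply/matrixP => l m.
have pr : polyfun 1 r.
  apply/polyfun_mxP => q q'; rewrite ord1; apply/pol1P.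
  have [->|->] := ord2P q; [exists (p 0 0), 0, (- b)|exists (p 1 0), b, 0] => y;
    by rewrite rE !mxE /=; ring.
have D w q : 'D_w (fun y => r y q 0) x = b * (Defs.rot w) q 0.
  have -> : (fun y => r y q 0) = fun y => p q 0 + (if q == 0 then 0 else b) * y 0 0 +
      (if q == 0 then - b else 0) * y 1 0.
    by apply/funext => y; rewrite rE !mxE /=; have [->|->] := ord2P q => /=; ring.
  have [_ ->] := is_derive_pol1 (p q 0) (if q == 0 then 0 else b) (if q == 0 then - b else 0) x w.
  by rewrite !mxE; have [->|->] := ord2P q => /=; ring.
rewrite (@def_E 1 (fun _ => r) i x l m pr) !D [RHS]mxE.
by have [->|->] := ord2P l; have [->|->] := ord2P m; rewrite !mxE /=; ring.
Qed.

Lemma rigid_A0 (r : V -> V) : rigid_motions r -> A0 a c (fun _ => r).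
Proof.
move=> [p [b rE]]; apply/(A0P nd cint) => l; split=> // i; apply: (pol_le (r := 1)) => //.
apply/pol1P; have [->|->] := ord2P l; [exists (p 0 0), 0, (- b)|exists (p 1 0), b, 0] => y;
  by rewrite rE !mxE /=; ring.
Qed.

Lemma rigid_triangle_eq0 (r : V -> V) : rigid_motions r -> (forall x, triangle a x -> r x = 0) -> r = 0.
Proof.
move=> [p [b rE]] r0; have tv i : triangle a (a i).
  by apply/(triangleE nd) => j; rewrite (bary_vertex nd) ler0n.
have [|||p0 b0] := @rigid_eq0 p b (a 0) (a 1).
- by rewrite -rE r0.
- by rewrite -rE r0.
- apply/eqP => e; have := bary_vertex nd 0 1; rewrite -e bary_vertex// => /eqP.
  by rewrite oner_eq0.
by apply/funext => x; rewrite rE p0 b0 scale0r addr0.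
Qed.

End DeformationComplex.

Lemma pol_deriveZ (R : realType) r (f : 'cV[R]_2 -> R) (k : R) v x : pol r f ->
  'D_v (fun y => k * f y) x = k * 'D_v f x.
Proof.
move=> pf; have kd : is_derive x v (fun _ : 'cV[R]_2 => k) 0 by exact: is_derive_cst.
by have [_ ->] := is_derive_mul kd (is_derive_pol x v pf); rewrite mul0r add0r.
Qed.

(** * One bubble per cell *)

Section Bubbles.
Variables (R : realType) (a : 'I_3 -> 'cV[R]_2) (c : 'cV[R]_2).
Hypothesis nd : tdet a != 0.
Hypothesis cint : (triangle a)° c.
Local Notation V := 'cV[R]_2.
Implicit Types (x y v w : V) (i j k : 'I_3) (f : V -> R).
Local Notation spoke := (spoke a c).

(** Any two distinct cells are cyclic neighbours of a common index [k], and [ct_meet] puts their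
    intersection on the spoke [k]. *)
Lemma matching_spokes (W : Type) (g : 'I_3 -> V -> W) :
  (forall k s, g (ordS k) (c + s *: spoke k) = g (ord_pred k) (c + s *: spoke k)) -> matching a c g.
Proof.
move=> h i j x xi xj; have [E|E|E] := ord3_cases i j; first by rewrite E.
  have [||s [_ _ ->]] := ct_meet nd cint (k := ord_pred i) (x := x).
  - by rewrite ord_predK.
  - by rewrite ord_predP3 -E.
  by rewrite E -ord_predP3 -h ord_predK.
have [||s [_ _ ->]] := ct_meet nd cint (k := ordS i) (x := x).
- by rewrite ordSS3 -E.
- by rewrite ordSK.
by rewrite E -ordSS3 h ordSK.
Qed.

Definition lvl v x : R := cross v (x - c).

Lemma lvl_pol v : pol 1 (lvl v).
Proof.
apply/pol1P; exists (v 1 0 * c 0 0 - v 0 0 * c 1 0), (- v 1 0), (v 0 0) => x.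
by rewrite /lvl /cross !mxE; ring.
Qed.

Lemma is_derive_lvl v w x : is_derive x w (lvl v) (cross v w).
Proof.
have -> : lvl v = fun y => (v 1 0 * c 0 0 - v 0 0 * c 1 0) + (- v 1 0) * y 0 0 + v 0 0 * y 1 0.
  by apply/funext => y; rewrite /lvl /cross !mxE; ring.
by apply: is_derive_eq (is_derive_pol1 _ _ _ x w) _; rewrite /cross; ring.
Qed.

Lemma lvl_line v w (s : R) : lvl v (c + s *: w) = s * cross v w.
Proof. by rewrite /lvl /cross !mxE; ring. Qed.

(** The symmetrised tensor product of the two linear forms that vanish on the spokes of the cell
    [j]. *)
Definition bubble_mx j : 'M[R]_2 := \matrix_(k, l)
  (2^-1 * (cross (spoke (ordS j)) (e_ R k) * cross (spoke (ord_pred j)) (e_ R l)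
         + cross (spoke (ordS j)) (e_ R l) * cross (spoke (ord_pred j)) (e_ R k))).

Definition bubble_fun j i x : R :=
  (i == j)%:R * (lvl (spoke (ordS j)) x * lvl (spoke (ord_pred j)) x).

(* Across a spoke [t], [sven_jump] is proportional to [dot (bubble_mx j *m t) t],
   which vanishes for the two spokes bounding the cell [j]. *)
Definition bubble j i x : 'M[R]_2 := bubble_fun j i x *: bubble_mx j.

Lemma bubble_fun_pol j i : pol 2 (bubble_fun j i).
Proof. exact: polZ (polM (lvl_pol _) (lvl_pol _)). Qed.

Lemma bubble_fun_derive j i w x : 'D_w (bubble_fun j i) x =
  (i == j)%:R * (cross (spoke (ordS j)) w * lvl (spoke (ord_pred j)) x +
                 cross (spoke (ord_pred j)) w * lvl (spoke (ordS j)) x).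
Proof.
have dm : is_derive x w (fun _ : V => (i == j)%:R : R) 0 by exact: is_derive_cst.
have [_ ->] := is_derive_mul dm (is_derive_mul (is_derive_lvl (spoke (ordS j)) w x)
  (is_derive_lvl (spoke (ord_pred j)) w x)).
by rewrite mul0r add0r; congr (_ * (_ + _)); rewrite mulrC.
Qed.

Lemma bubble_fun_derive2 j i v w x : 'D_v ('D_w (bubble_fun j i)) x =
  (i == j)%:R * (cross (spoke (ordS j)) w * cross (spoke (ord_pred j)) v +
                 cross (spoke (ord_pred j)) w * cross (spoke (ordS j)) v).
Proof.
have dc (m : R) : is_derive x v (fun _ : V => m) 0 by exact: is_derive_cst.
have -> : 'D_w (bubble_fun j i) = fun x => (i == j)%:R *
    (cross (spoke (ordS j)) w * lvl (spoke (ord_pred j)) x +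
     cross (spoke (ord_pred j)) w * lvl (spoke (ordS j)) x).
  by apply/funext => y; exact: bubble_fun_derive.
have [_ ->] := is_derive_mul (dc (i == j)%:R) (is_derive_add
  (is_derive_mul (dc (cross (spoke (ordS j)) w)) (is_derive_lvl (spoke (ord_pred j)) v x))
  (is_derive_mul (dc (cross (spoke (ord_pred j)) w)) (is_derive_lvl (spoke (ordS j)) v x))).
by rewrite !mul0r !add0r.
Qed.

Lemma bubble_fun_spoke j k (s : R) i : i != k -> bubble_fun j i (c + s *: spoke k) = 0.
Proof.
move=> ik; rewrite /bubble_fun !lvl_line; have [E|] := eqVneq i j; last by rewrite mul0r.
have c0 v : cross v v = 0 by rewrite /cross; ring.
have [F|F|F] := ord3_cases j k; first by rewrite E F eqxx in ik.
  by rewrite F c0 mulr0 mul0r mulr0.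
by rewrite F c0 !mulr0.
Qed.

Lemma bubble_entry j i x p q : bubble j i x p q = bubble_mx j p q * bubble_fun j i x.
Proof. by rewrite /bubble; move: (bubble_mx j) => M; rewrite mxE mulrC. Qed.

Lemma bubble_derive j i w x p q :
  'D_w (fun y => bubble j i y p q) x = bubble_mx j p q * 'D_w (bubble_fun j i) x.
Proof.
rewrite -(pol_deriveZ _ _ _ (bubble_fun_pol j i)); move: (bubble_entry j i) => E.
have F : (fun y => bubble j i y p q) = (fun y => bubble_mx j p q * bubble_fun j i y).
  by apply/funext => y; exact: E.
exact: (congr1 (fun f : V -> R => 'D_w f x) F).
Qed.

(** On its cell the scalar factor has Hessian twice [bubble_mx j], so sven is four times the
    determinant of that matrix, that is, minus the squared cross product of the two spokes. *)
Lemma sven_piece_bubble j i x : sven_piece (bubble j i) x =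
  - (i == j)%:R * cross (spoke (ordS j)) (spoke (ord_pred j)) ^+ 2.
Proof.
have D2 p q v w : 'D_v ('D_w (fun y => bubble j i y p q)) x = bubble_mx j p q *
  ((i == j)%:R * (cross (spoke (ordS j)) w * cross (spoke (ord_pred j)) v +
                  cross (spoke (ord_pred j)) w * cross (spoke (ordS j)) v)).
  rewrite -(bubble_fun_derive2 j i v w x) -(pol_deriveZ _ _ _ (pol_derive w (bubble_fun_pol j i))).
  have F : 'D_w (fun y => bubble j i y p q) = (fun y => bubble_mx j p q * 'D_w (bubble_fun j i) y).
    by apply/funext => y; exact: bubble_derive.
  exact: (congr1 (fun f : V -> R => 'D_v f x) F).
have id (y1 y2 y3 y4 z1 z2 z3 z4 : R) : y1 = z1 -> y2 = z2 -> y3 = z3 -> y4 = z4 ->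
    y1 + y2 - y3 - y4 = z1 + z2 - z3 - z4 by move=> -> -> -> ->.
apply: (etrans (id _ _ _ _ _ _ _ _ (D2 0 0 (e_ R 1) (e_ R 1)) (D2 1 1 (e_ R 0) (e_ R 0))
  (D2 1 0 (e_ R 1) (e_ R 0)) (D2 0 1 (e_ R 0) (e_ R 1)))).
have mE p q : bubble_mx j p q =
    2^-1 * (cross (spoke (ordS j)) (e_ R p) * cross (spoke (ord_pred j)) (e_ R q)
          + cross (spoke (ordS j)) (e_ R q) * cross (spoke (ord_pred j)) (e_ R p)) by rewrite mxE.
rewrite !mE; move: (spoke (ordS j)) (spoke (ord_pred j)) => p q.
rewrite /cross !mxE /=; move: (p 0 0) (p 1 0) (q 0 0) (q 1 0) ((i == j)%:R) => p0 p1 q0 q1 d.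
by field.
Qed.

Lemma bubble_mx_sym j : (bubble_mx j)^T = bubble_mx j.
Proof. by apply/matrixP => p q; rewrite !mxE addrC. Qed.

Lemma bubble_mx_conic j v :
  dot (bubble_mx j *m v) v = cross (spoke (ordS j)) v * cross (spoke (ord_pred j)) v.
Proof.
have mE p q : bubble_mx j p q =
    2^-1 * (cross (spoke (ordS j)) (e_ R p) * cross (spoke (ord_pred j)) (e_ R q)
          + cross (spoke (ordS j)) (e_ R q) * cross (spoke (ord_pred j)) (e_ R p)) by rewrite mxE.
rewrite /dot !mulmx2E !mE; move: (spoke (ordS j)) (spoke (ord_pred j)) => p q.
by rewrite /cross !mxE /=; field.
Qed.

(** The scalar factor vanishes on both spokes of the cell, whence continuity. On those two spokes
    the quadratic form of [bubble_mx j] is zero; across the third one both pieces are zero and there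
    is no jump. *)
Lemma bubble_A1 j : A1 a c (bubble j).
Proof.
apply/(A1P nd cint); split=> [i|i x||k s].
- apply/polyfun_mxP => p q.
  by apply: pol_ext (polZ (bubble_mx j p q) (bubble_fun_pol j i)) => x; rewrite bubble_entry.
- by rewrite /bubble linearZ/= bubble_mx_sym.
- apply: matching_spokes => k s; have [iS iP _] := ordS3_neq k.
  by rewrite /bubble !bubble_fun_spoke ?iS ?iP.
have c0 v : cross v v = 0 by rewrite /cross; ring.
have jmp (m : R) : (forall l, 'D_(e_ R l) (bubble_fun j (ord_pred k)) (c + s *: spoke k) -
      'D_(e_ R l) (bubble_fun j (ordS k)) (c + s *: spoke k) = m * cross (spoke k) (e_ R l)) ->
    m = 0 \/ cross (spoke (ordS j)) (spoke k) * cross (spoke (ord_pred j)) (spoke k) = 0 ->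
    sven_jump a c (bubble j) k (c + s *: spoke k) = 0.
  move=> h m0; rewrite (sven_jump_conic (m := m) (M := bubble_mx j)).
    by rewrite bubble_mx_conic; case: m0 => ->; rewrite ?oppr0 ?mul0r ?mulr0.
  move=> p q l; have sb (y z y' z' : R) : y = y' -> z = z' -> y - z = y' - z' by move=> -> ->.
  apply: (etrans (sb _ _ _ _ (bubble_derive j _ _ _ p q) (bubble_derive j _ _ _ p q))).
  by rewrite -mulrBr h mulrC.
have [kj|kj|kj] := ord3_cases j k.
- apply: (jmp 0); last by left.
  move=> l; rewrite !bubble_fun_derive kj; have [-> -> _] := ordS3_neq j.
  by rewrite !mul0r subrr.
- apply: (jmp (s * cross (spoke (ord_pred j)) (spoke k))); last by right; rewrite kj c0 mul0r.
  move=> l; rewrite !bubble_fun_derive !lvl_line kj ordSK ordSS3 eqxx c0.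
  by have [_ -> _] := ordS3_neq j; rewrite /=; ring.
- apply: (jmp (- s * cross (spoke (ordS j)) (spoke k))); last by right; rewrite kj c0 mulr0.
  move=> l; rewrite !bubble_fun_derive !lvl_line kj ord_predK ord_predP3 eqxx c0.
  by have [-> _ _] := ordS3_neq j; rewrite /=; ring.
Qed.

End Bubbles.

(** * Monomials, Clough-Tocher functions and the basis of A0 *)

Lemma coef_eq0 (R : realType) n (b : 'I_n -> R) :
  (forall s : R, \sum_(i < n) s ^+ i * b i = 0) -> forall i, b i = 0.
Proof.
move=> h i; pose p : {poly R} := \sum_(j < n) b j *: 'X^j.
have p0 : p = 0.
  apply: poly_eq0_itv => s _ _; rewrite -[RHS](h s) horner_sum.
  by apply: eq_bigr => j _; rewrite !hornerE mulrC.
have := congr1 (fun q : {poly R} => q`_i) p0; rewrite coef0 coef_sum (bigD1 i)//= coefZ coefXn eqxx mulr1.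
rewrite big1 ?addr0// => j ji; rewrite coefZ coefXn.
by rewrite (_ : (i == j :> nat) = false) ?mulr0//; apply: contraNF ji => /eqP/val_inj ->.
Qed.

Definition mono_idx : finType := {i : 'I_4 & 'I_(3 - i).+1}.

Lemma card_mono_idx : #|{: mono_idx}| = 10.
Proof.
by rewrite card_tagged sumnE big_map big_enum /= !big_ord_recl big_ord0 /= !card_ord.
Qed.

Section MonomialFamily.
Variable R : realType.
Local Notation V := 'cV[R]_2.

Definition mono (p : mono_idx) (x : V) : R := x 0 0 ^+ (tag p) * x 1 0 ^+ (tagged p).

Lemma mono_pol p : pol 3 (mono p).
Proof.
case: p => i j; rewrite /mono /=.
apply: (@pol_le _ (i * 1 + j * 1)%N 3); last exact: polM (pol_exp _ (pol_coord _ _)) (pol_exp _ (pol_coord _ _)).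
by rewrite !muln1; have := ltn_ord i; have := ltn_ord j; rewrite !ltnS => h1 h2; rewrite -leq_subRL.
Qed.

Lemma mono_free (k : mono_idx -> R) : (forall x, \sum_p k p * mono p x = 0) -> forall p, k p = 0.
Proof.
move=> h [i j]; pose F (i : 'I_4) (j : 'I_(3 - i).+1) := k (Tagged (fun i : 'I_4 => 'I_(3 - i).+1) j).
have E (s t : R) : \sum_(i < 4) s ^+ i * (\sum_(j < (3 - i).+1) t ^+ j * F i j) = 0.
  rewrite -[RHS](h (vec2 s t)).
  under eq_bigr => i' _ do rewrite big_distrr /=.
  rewrite (sig_big_dep (fun _ => true) (fun _ _ => true)
    (fun (i : 'I_4) (j : 'I_(3 - i).+1) => s ^+ i * (t ^+ j * F i j)))/=.
  apply: eq_bigr => -[i' j'] _; rewrite /mono /F !mxE /=; ring.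
have E1 t i' := coef_eq0 (fun s => E s t) i'.
exact: (coef_eq0 (fun t => E1 t i) j).
Qed.

End MonomialFamily.

Section CloughTocherFamily.
Variables (R : realType) (a : 'I_3 -> 'cV[R]_2) (c : 'cV[R]_2).
Hypothesis nd : tdet a != 0.
Hypothesis cint : (triangle a)° c.
Local Notation V := 'cV[R]_2.
Implicit Types (x w : V) (i j k : 'I_3).
Local Notation spoke := (spoke a c).
Local Notation kink := (kink a c).
Local Notation wt := (wt a c).
Local Notation hat := (hat a c).

Lemma kink_sum x : kink 2 x = - kink 0 x - kink 1 x.
Proof.
have [S0 S1 S2] := ordS3E; have [P0 P1 P2] := ord_pred3E.
by rewrite /kink S0 S1 S2 P0 P1 P2; ring.
Qed.

(** The smoothing cofactor criterion: a multiple of the square of [kink k] vanishes on the spoke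
    together with its derivatives. *)
Lemma smooth_of_squares r s (g q : 'I_3 -> V -> R) : (forall i, pol r (g i)) -> (forall k, pol s (q k)) ->
  (forall k x, g (ordS k) x - g (ord_pred k) x = kink k x ^+ 2 * q k x) ->
  matching a c g /\ forall w, matching a c (fun i => 'D_w (g i)).
Proof.
move=> pg pq h; split=> [|w]; apply: (matching_spokes nd cint) => k t; apply/eqP; rewrite -subr_eq0; apply/eqP.
  by rewrite h kink_spoke// expr2 !mul0r.
set x := c + t *: spoke k; have pk := kink_pol c nd k.
transitivity ('D_w (fun y => -1 * g (ord_pred k) y + g (ordS k) y) x).
  by rewrite (pol_derive_lin _ _ _ (pg _) (pg _)); ring.
have F : (fun y => -1 * g (ord_pred k) y + g (ordS k) y) = fun y => (kink k y * kink k y) * q k y.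
  by apply/funext => y; rewrite -expr2 -h; ring.
apply: (etrans (congr1 (fun f : V -> R => 'D_w f x) F)).
have dk := is_derive_pol x w pk.
have [_ ->] := is_derive_mul (is_derive_mul dk dk) (is_derive_pol x w (pq k)).
by rewrite kink_spoke// !(mul0r, mulr0, addr0).
Qed.

(* With [X + Y + Z = 0] for the three kinks, each of the differences of these
   pieces across the spoke where [X], [Y] or [Z] vanishes is divisible by its square. *)
Definition ct_fun (b : 'I_2) i x : R :=
  if i == 0 then kink 2 x ^+ 2 * (if b == 0 then kink 0 x else kink 1 x)
  else if i == 1 then 0
  else kink 0 x ^+ 2 * (if b == 0 then kink 0 x + 2 * kink 1 x else kink 1 x).

Lemma ct_fun_pol b i : pol 3 (ct_fun b i).
Proof.
have pk k : pol 1 (kink k) := kink_pol c nd k.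
have p2 k : pol 2 (fun x => kink k x ^+ 2) := pol_exp 2 (pk k).
by rewrite /ct_fun; have [->|->|->] := ord3P i; have [->|->] := ord2P b;
  first [exact: (pol_cst 3 0)|exact: (polM (p2 2) (pk 0))|exact: (polM (p2 2) (pk 1))|
    exact: (polM (p2 0) (polD (pk 0) (polZ 2 (pk 1))))|exact: (polM (p2 0) (pk 1))].
Qed.

Lemma ct_fun_smooth b : matching a c (ct_fun b) /\ forall w, matching a c (fun i => 'D_w (ct_fun b i)).
Proof.
have pk k : pol 1 (kink k) := kink_pol c nd k.
have [S0 S1 S2] := ordS3E; have [P0 P1 P2] := ord_pred3E.
(* Cofactors of the three differences, using Z = - X - Y; for instance X^2 (X + 2 Y) - Z^2 X = - X
   Y^2. *)
pose q k x : R := if k == 0 then (if b == 0 then - kink 0 x - 2 * kink 1 x else - kink 1 x)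
  else if k == 1 then (if b == 0 then - kink 0 x else - 2 * kink 0 x - kink 1 x)
  else (if b == 0 then kink 0 x else kink 1 x).
have pN f : pol 1 f -> pol 1 (fun x : V => - f x).
  by move=> pf; apply: pol_ext (polZ (-1) pf) => x; rewrite mulN1r.
apply: (@smooth_of_squares 3 1 _ q) => [i|k|k x]; first exact: ct_fun_pol.
  by rewrite /q; have [->|->|->] := ord3P k; have [->|->] := ord2P b;
    first [exact: (pk 0)|exact: (pk 1)|exact: (pN _ (pk 0))|exact: (pN _ (pk 1))|
      exact: (polB (pN _ (pk 0)) (polZ 2 (pk 1)))|exact: (polB (polZ (- 2) (pk 0)) (pk 1))].
by rewrite /q /ct_fun; have [->|->|->] := ord3P k; have [->|->] := ord2P b;
  rewrite ?(S0, S1, S2, P0, P1, P2) /= ?kink_sum; ring.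
Qed.

Definition scal_fun (t : mono_idx + 'I_2) i x : R :=
  match t with inl p => mono p x | inr b => ct_fun b i x end.

Lemma scal_fun_pol t i : pol 3 (scal_fun t i).
Proof. by case: t => [p|b]; [exact: mono_pol|exact: ct_fun_pol]. Qed.

Lemma scal_fun_smooth t : matching a c (scal_fun t) /\
  forall w, matching a c (fun i => 'D_w (scal_fun t i)).
Proof. by case: t => [p|b] //; exact: ct_fun_smooth. Qed.

(** Both Clough-Tocher functions vanish on the cell 1, which isolates the monomials. Their
    polynomials on the cell 0 are then separated by evaluation at [a 1] and [a 0]: at each of these
    points exactly one of them is nonzero. *)
Lemma scal_fun_free (k : mono_idx + 'I_2 -> R) :
  (forall i x, \sum_t k t * scal_fun t i x = 0) -> forall t, k t = 0.
Proof.
move=> h; have h' i x : \sum_p k (inl p) * mono p x + \sum_b k (inr b) * ct_fun b i x = 0.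
  by rewrite -[RHS](h i x) big_sumType.
have k1 p : k (inl p) = 0.
  apply: (mono_free (k := fun p => k (inl p))) => x; rewrite -[RHS](h' 1 x).
  by rewrite [X in _ = _ + X]big1 ?addr0// => b _; rewrite /ct_fun/= mulr0.
have k2 x : k (inr 0) * ct_fun 0 0 x + k (inr 1) * ct_fun 1 0 x = 0.
  rewrite -[RHS](h' 0 x) big1 ?add0r => [|p _]; last by rewrite k1 mul0r.
  by rewrite !big_ord_recl big_ord0 addr0; congr (_ + k (inr _) * ct_fun _ _ _); exact: val_inj.
have w0 i : wt i != 0 by exact: wt_neq0.
have [S0 S1 S2] := ordS3E; have [P0 P1 P2] := ord_pred3E.
have := k2 (a 1); have := k2 (a 0).
rewrite /ct_fun /kink /= S0 S1 S2 P0 P1 P2 !(hat_vertex c nd) /=.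
move: (wt 0) (wt 1) (wt 2) (w0 0) (w0 1) => w w' w'' wn wn'.
rewrite !mul0r !subr0 !sub0r !div1r !sqrrN => e0 e1.
have iw : w^-1 != 0 by rewrite invr_eq0.
have iw' : w'^-1 != 0 by rewrite invr_eq0.
have z0 : k (inr 0) = 0.
  apply: (mulIf (mulf_neq0 (expf_neq0 2 iw') iw')); rewrite mul0r -[RHS]e1; ring.
have z1 : k (inr 1) = 0.
  apply: (mulIf (mulf_neq0 (expf_neq0 2 iw) iw)); rewrite mul0r -[RHS]oppr0 -e0; ring.
by case=> [p|b]; [exact: k1|have [->|->] := ord2P b].
Qed.

(** Ten monomials and two Clough-Tocher functions, for each of two components. *)
Definition hct_idx : finType := ((mono_idx + 'I_2) * 'I_2)%type.

Lemma card_hct_idx : #|{: hct_idx}| = 24.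
Proof. by rewrite card_prod card_sum !card_ord card_mono_idx. Qed.

Definition hct_fun (t : hct_idx) i x : V := scal_fun t.1 i x *: e_ R t.2.

Lemma hct_funE t i x l : hct_fun t i x l 0 = (l == t.2)%:R * scal_fun t.1 i x.
Proof. by rewrite !mxE eqxx andbT mulrC. Qed.

Lemma hct_fun_A0 t : A0 a c (hct_fun t).
Proof.
have [ms ds] := scal_fun_smooth t.1.
apply/(A0P nd cint) => l.
have E i : (fun x => hct_fun t i x l 0) = fun x => (l == t.2)%:R * scal_fun t.1 i x.
  by apply/funext => x; exact: hct_funE.
split=> [i|i j x xi xj|w i j x xi xj].
- by rewrite E; apply: polZ; exact: scal_fun_pol.
- by rewrite !hct_funE (ms _ _ _ xi xj).
- rewrite !E !(pol_deriveZ _ _ _ (scal_fun_pol t.1 _)); congr (_ * _); exact: ds xi xj.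
Qed.

Lemma sum_hct_fun (k : hct_idx -> R) i x l :
  (\sum_t k t *: hct_fun t) i x l 0 = \sum_s k (s, l) * scal_fun s i x.
Proof.
rewrite !fct_sumE summxE.
rewrite (eq_bigr (fun t : hct_idx => k t * ((l == t.2)%:R * scal_fun t.1 i x))); last first.
  by move=> t _; rewrite -hct_funE [in LHS]mxE.
rewrite (eq_bigr (fun t : hct_idx => k (t.1, t.2) * ((l == t.2)%:R * scal_fun t.1 i x))); last by case.
rewrite -(pair_bigA _ (fun s m => k (s, m) * ((l == m)%:R * scal_fun s i x)))/=.
apply: eq_bigr => s _; rewrite (bigD1 l)//= eqxx mul1r big1 ?addr0// => m ml.
by rewrite eq_sym (negbTE ml) mul0r mulr0.
Qed.

Lemma hct_fun_free (k : hct_idx -> R) : \sum_t k t *: hct_fun t = 0 -> forall t, k t = 0.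
Proof.
move=> h [s l]; apply: (scal_fun_free (k := fun s => k (s, l))) => i x.
by rewrite -sum_hct_fun h mxE.
Qed.

End CloughTocherFamily.

(** * The basis of A1 *)

Section SvenFamily.
Variables (R : realType) (a : 'I_3 -> 'cV[R]_2) (c : 'cV[R]_2).
Hypothesis nd : tdet a != 0.
Hypothesis cint : (triangle a)° c.
Local Notation V := 'cV[R]_2.
Implicit Types (x : V) (i j k : 'I_3).
Local Notation spoke := (spoke a c).
Local Notation hct_fun := (hct_fun a c).
Local Notation bubble := (bubble a c).

Definition mono00 : mono_idx := Tagged (fun i : 'I_4 => 'I_(3 - i).+1) (i := 0) 0.
Definition mono10 : mono_idx := Tagged (fun i : 'I_4 => 'I_(3 - i).+1) (i := 1) 0.
Definition mono01 : mono_idx := Tagged (fun i : 'I_4 => 'I_(3 - i).+1) (i := 0) 1.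

(* The other 21 fields [hct_fun t] span a complement of the rigid motions. *)
Definition rigid_idx i : hct_idx :=
  if i == 0 then (inl mono00, 0) else if i == 1 then (inl mono00, 1) else (inl mono10, 1).

(** The three indices freed by the rigid motions are given to the bubbles, so the family keeps 24
    members. Coefficients 0 and 1 encode the distinction of cases, so that sums split linearly. *)
Definition sven_fun (t : hct_idx) : 'I_3 -> V -> 'M[R]_2 :=
  (t \notin codom rigid_idx)%:R *: def_ (hct_fun t) + \sum_j (t == rigid_idx j)%:R *: bubble j.

Lemma rigid_idx_inj : injective rigid_idx.
Proof. by move=> i j; have [->|->|->] := ord3P i; have [->|->|->] := ord3P j. Qed.

Lemma sven_fun_A1 t : A1 a c (sven_fun t).
Proof.
have [s0 sD] := A1_subspace nd cint; apply: sD; first exact: def_A1 (hct_fun_A0 nd cint t).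
exact: (subspace_sum (A1_subspace nd cint) _ (bubble_A1 nd cint)).
Qed.

Lemma def0 : def_ (0 : 'I_3 -> V -> V) = 0.
Proof.
have p0 (i : 'I_3) : polyfun 3 ((0 : 'I_3 -> V -> V) i).
  by apply/polyfun_mxP => l m; apply: pol_ext (pol_cst 3 0) => x; rewrite mxE.
by have := def_lin (-1) p0 p0; rewrite scaler0 addr0 scaleN1r addNr.
Qed.

Lemma def_sum (I : finType) (k : I -> R) (e : I -> 'I_3 -> V -> V) : (forall t, A0 a c (e t)) ->
  A0 a c (\sum_t k t *: e t) /\ def_ (\sum_t k t *: e t) = \sum_t k t *: def_ (e t).
Proof.
move=> eA; have [s0 sD] := A0_subspace nd cint.
apply: (big_rec2 (fun D u => A0 a c u /\ def_ u = D)) => [|t D u _ [Au <-]].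
  by split=> //; exact: def0.
split; first exact: sD.
have [pe _] := eA t; have [pu _] := Au; exact: def_lin pe pu.
Qed.

Lemma sum_sven_fun (k : hct_idx -> R) : \sum_t k t *: sven_fun t =
  def_ (\sum_t (k t * (t \notin codom rigid_idx)%:R) *: hct_fun t) +
  \sum_j k (rigid_idx j) *: bubble j.
Proof.
have [_ ->] := def_sum (fun t => k t * (t \notin codom rigid_idx)%:R) (hct_fun_A0 nd cint).
under eq_bigr => t _ do rewrite scalerDr scalerA scaler_sumr.
rewrite big_split/= exchange_big/=; congr (_ + _); apply: eq_bigr => j _.
under eq_bigr => t _ do rewrite scalerA.
rewrite (bigD1 (rigid_idx j))//= eqxx mulr1 big1 ?addr0// => t /negbTE ->.
by rewrite mulr0 scale0r.
Qed.

(** Deformations contribute nothing and a single bubble lives on the cell [i]: sven reads off the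
    bubble coefficients. *)
Lemma sven_piece_comb w (b : 'I_3 -> R) i x : A0 a c w ->
  sven_piece ((def_ w + \sum_j b j *: bubble j) i) x =
  - b i * cross (spoke (ordS i)) (spoke (ord_pred i)) ^+ 2.
Proof.
move=> Aw; have [pw _] := Aw.
have pd : polyfun 2 (def_ w i) by apply/polyfun_mxP => p q; exact: def_pol (pw i).
have pb j : polyfun 2 (bubble j i).
  by have /(A1P nd cint)[+ _ _ _] := bubble_A1 nd cint j; exact.
have E : (def_ w + \sum_j b j *: bubble j) i = fun y =>
    b 0 *: bubble 0 i y + (b 1 *: bubble 1 i y + (b 2 *: bubble 2 i y + def_ w i y)).
  apply/funext => y; rewrite sum3.
  transitivity (def_ w i y + (b 0 *: bubble 0 i y + b 1 *: bubble 1 i y + b 2 *: bubble 2 i y)) => //.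
  by rewrite addrC -!addrA.
have p2 := polyfun_lin (b 2) (pb 2) pd; have p1 := polyfun_lin (b 1) (pb 1) p2.
rewrite E (sven_piece_lin (b 0) x (pb 0) p1) (sven_piece_lin (b 1) x (pb 1) p2).
rewrite (sven_piece_lin (b 2) x (pb 2) pd) (sven_piece_def _ (pw i)) !sven_piece_bubble.
by have [->|->|->] := ord3P i; rewrite /= ?oppr0 ?mul0r ?mulr0 ?add0r ?addr0; ring.
Qed.

Lemma sven_piece0 i x : sven_piece ((0 : 'I_3 -> V -> 'M[R]_2) i) x = 0.
Proof.
have p0 : polyfun 2 (fun _ : V => 0 : 'M[R]_2).
  by apply/polyfun_mxP => l m; apply: pol_ext (pol_cst 2 0) => y; rewrite mxE.
have F : (fun _ : V => -1 *: (0 : 'M[R]_2) + 0) = (fun _ => 0).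
  by apply/funext => y; rewrite scaler0 addr0.
apply: (etrans (esym (congr1 (fun f => sven_piece f x) F))).
by apply: (etrans (sven_piece_lin (-1) x p0 p0)); rewrite mulN1r addNr.
Qed.

Lemma bubble_coef0 (b : R) i : - b * cross (spoke (ordS i)) (spoke (ord_pred i)) ^+ 2 = 0 -> b = 0.
Proof.
have d0 : cross (spoke (ordS i)) (spoke (ord_pred i)) != 0.
  by rewrite cross_spokes// mulf_neq0// wt_neq0.
by move=> /eqP; rewrite mulf_eq0 expf_eq0/= (negbTE d0) oppr_eq0 orbF => /eqP.
Qed.

(** Applying sven kills the bubble coefficients. Then [def_ w] is zero, so [w] is a rigid motion
    with no component on the removed indices, which forces it to be zero. *)
Lemma sven_fun_free (k : hct_idx -> R) : \sum_t k t *: sven_fun t = 0 -> forall t, k t = 0.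
Proof.
move=> h0; pose k0 t := k t * (t \notin codom rigid_idx)%:R; pose w := \sum_t k0 t *: hct_fun t.
have h : def_ w + \sum_j k (rigid_idx j) *: bubble j = 0 by rewrite -[RHS]h0 sum_sven_fun.
have [Aw _] := def_sum k0 (hct_fun_A0 nd cint).
have kr j : k (rigid_idx j) = 0.
  apply: (bubble_coef0 (i := j)).
  by rewrite -(sven_piece_comb (fun j => k (rigid_idx j)) j 0 Aw) h sven_piece0.
have dw : def_ w = 0.
  by rewrite -[RHS]h big1 ?addr0// => j _; rewrite kr scale0r.
have [r [p [b rE]] wr] := def_eq0 nd cint Aw dw.
pose t' : hct_idx := (inl mono01, 0).
(* Coefficients in the basis [hct_fun] of [w] minus the rigid motion [r]. The rotation (-x_2, x_1)
   occupies two indices: [rigid_idx 2] for its second component and [t'] for its first. *)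
pose k' t := k0 t + (- p 0 0 * (t == rigid_idx 0)%:R + (- p 1 0 * (t == rigid_idx 1)%:R +
  (- b * (t == rigid_idx 2)%:R + b * (t == t')%:R))).
have delta (s : hct_idx) (m : R) : \sum_t (m * (t == s)%:R) *: hct_fun t = m *: hct_fun s.
  rewrite (bigD1 s)//= eqxx mulr1 big1 ?addr0// => t /negbTE ->.
  by rewrite mulr0 scale0r.
have k'0 : forall t, k' t = 0.
  apply: (hct_fun_free nd cint (k := k')).
  under eq_bigr => t _ do rewrite /k' !scalerDl.
  rewrite !big_split/= !delta wr; apply/funext => i; apply/funext => x; apply/colP => l.
  have [S0 S1 S2] := ordS3E.
  transitivity (r x l 0 + (- p 0 0 * hct_fun (rigid_idx 0) i x l 0 + (- p 1 0 * hct_fun (rigid_idx 1) i x l 0 +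
    (- b * hct_fun (rigid_idx 2) i x l 0 + b * hct_fun t' i x l 0)))); first by rewrite !mxE.
  rewrite !hct_funE rE /rigid_idx /= /mono /= !mxE.
  by have [->|->] := ord2P l; rewrite /=; ring.
(* [w] has no component on [rigid_idx 2], where the rotation has coefficient [b]. *)
have b0 : b = 0.
  have := k'0 (rigid_idx 2); rewrite /k' /k0 kr mul0r add0r !(inj_eq rigid_idx_inj) /=.
  by rewrite !mulr0 !add0r mulr1 addr0 => /eqP; rewrite oppr_eq0 => /eqP.
move=> t; have [/codomP[j ->]|tn] := boolP (t \in codom rigid_idx); first exact: kr.
have nt j : (t == rigid_idx j) = false by apply: contraNF tn => /eqP ->; exact: codom_f.
by have := k'0 t; rewrite /k' /k0 tn !nt b0 !mulr0 mul0r !addr0 mulr1.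
Qed.

End SvenFamily.

(** * Dimensions, unisolvence and exactness *)

Theorem theorem6p3 (R : realType) (a : 'I_3 -> 'cV[R]_2) (c : 'cV[R]_2)
    (o : 'I_3 -> bool)
    (bM : 'I_3 -> 'I_3 -> (R -> R^o) * R^o)
    (bP : 'I_3 -> 'cV[R]_2 -> R^o) :
  nondegenerate_triangle a ->
  (triangle a)° c ->
  (forall i, is_basis (@edge_tests R) (bM i)) ->
  is_basis (@polyfun R 1 R^o) bP ->
  [/\ has_dim (A0 a c) 24 /\ unisolvent (A0 a c) (dofs0 a o),
      has_dim (A1 a c) 24 /\ unisolvent (A1 a c) (dofs1 a o bM),
      has_dim (@A2 R) 3 /\ unisolvent (@A2 R) (dofs2 a c bP) &
      (* the maps RM -> A0, def : A0 -> A1 and sven : A1 -> A2 *)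
      [/\ forall r, @rigid_motions R r -> A0 a c (fun _ => r),
          forall u, A0 a c u -> A1 a c (def_ u) &
          forall u, A1 a c u -> exists! v, @A2 R v /\ sven_eq a c u v]
      /\
      (* exactness at RM, A0, A1 and A2 *)
      [/\ forall r, @rigid_motions R r ->
            (forall x, triangle a x -> r x = 0) -> r = 0,
          forall u, A0 a c u ->
            (def_ u = 0 <->
             exists2 r, @rigid_motions R r & u = (fun _ => r)),
          forall u, A1 a c u ->
            (sven_eq a c u 0 <-> exists2 w, A0 a c w & u = def_ w) &
          forall v, @A2 R v -> exists2 u, A1 a c u & sven_eq a c u v]].
Proof.
move=> /nondegenerate_tdet nd cint basM basP.
have sA0 := A0_subspace nd cint; have sA1 := A1_subspace nd cint.
have c0 : #|{: hct_idx}| = #|{: 'I_3 * 'I_2 + 'I_3 * ('I_2 * 'I_2) + 'I_3 * 'I_2}|.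
  by rewrite card_hct_idx !card_sum !card_prod !card_ord.
have c1 : #|{: hct_idx}| = #|{: 'I_3 * 'I_3 + 'I_3 * 'I_3 + 'I_3 * 'I_2}|.
  by rewrite card_hct_idx !card_sum !card_prod !card_ord.
have e0 := hct_fun_A0 nd cint; have f0 := hct_fun_free nd cint.
have e1 := sven_fun_A1 nd cint; have f1 := sven_fun_free nd cint.
have l0 d : linear_form_on (A0 a c) (dofs0 a o d) by exact: dofs0_lin.
have i0 u : A0 a c u -> (forall d, dofs0 a o d u = 0) -> u = 0 by exact: dofs0_eq0.
have l1 d : linear_form_on (A1 a c) (dofs1 a o bM d) by exact: dofs1_lin.
have i1 u : A1 a c u -> (forall d, dofs1 a o bM d u = 0) -> u = 0 by exact: dofs1_eq0.
have l2 d : linear_form_on (@A2 R) (dofs2 a c bP d) by exact: dofs2_lin.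
have i2 u : A2 u -> (forall d, dofs2 a c bP d u = 0) -> u = 0 by exact: dofs2_eq0.
have sv u : A1 a c u -> sven_eq a c u (fun i _ => sven_piece (u i) 0) by exact: sven_eq_A1.
split.
- split; last exact: (unisolvent_forms sA0 c0 e0 f0 (l := dofs0 a o) l0 i0).
  by have := (unisolvent_dim sA0 c0 e0 f0 (l := dofs0 a o) l0 i0); rewrite -c0 card_hct_idx.
- split; last exact: (unisolvent_forms sA1 c1 e1 f1 (l := dofs1 a o bM) l1 i1).
  by have := (unisolvent_dim sA1 c1 e1 f1 (l := dofs1 a o bM) l1 i1); rewrite -c1 card_hct_idx.
- have e2 := @cell_basis_A2 R; have f2 := @cell_basis_free R; have sA2 := @A2_subspace R.
  split; last exact: (unisolvent_forms sA2 erefl e2 f2 (l := dofs2 a c bP) l2 i2).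
  by have := (unisolvent_dim sA2 erefl e2 f2 (l := dofs2 a c bP) l2 i2); rewrite card_ord.
split; split.
- by move=> r; exact: rigid_A0.
- by move=> u; exact: def_A1.
- move=> u Au; exists (fun i _ => sven_piece (u i) 0); split.
    by split; [apply/A2P; exists (fun i => sven_piece (u i) 0)|exact: sv].
  by move=> v [/A2P[m ->] um]; rewrite -(sven_eq_unique nd cint (sv u Au) um).
- by move=> r; exact: rigid_triangle_eq0.
- move=> u Au; split; first exact: (def_eq0 nd cint Au).
  by move=> [r rr ->]; exact: def_rigid.
- move=> u Au; split=> [u0|[w Aw uw]].
    (* In the basis, [u] is a deformation plus bubbles, and the bubble coefficients are proportional
       to the vanishing values of sven. *)
    have [_ _ gen] := (unisolvent_basis sA1 c1 e1 f1 (l := dofs1 a o bM) l1 i1).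
    have [k uE] := gen u Au; rewrite sum_sven_fun// in uE.
    move: uE; set w := \sum_t _ *: _ => uE.
    have [Aw _] := def_sum nd cint (fun t => k t * (t \notin codom rigid_idx)%:R) e0.
    exists w => //; rewrite uE -[RHS]addr0; congr (_ + _); apply: big1 => j _.
    have /(congr1 (fun m => m j)) := sven_eq_unique nd cint (sv u Au) (u0 : sven_eq a c u (fun _ _ => 0)).
    rewrite uE (sven_piece_comb nd cint _ j 0 Aw) => /(bubble_coef0 nd cint) ->.
    by rewrite scale0r.
  have := sv u Au; rewrite (_ : (fun i _ => _) = 0)//.
  apply/funext => i; apply/funext => x; have [pw _] := Aw.
  by rewrite uw (sven_piece_def 0 (pw i)).
- move=> v /A2P[m ->].
  have d0 i : cross (spoke a c (ordS i)) (spoke a c (ord_pred i)) != 0.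
    by rewrite cross_spokes// mulf_neq0// wt_neq0.
  (* On its own cell the bubble [j] has sven equal to minus this square. *)
  pose b j := - m j / cross (spoke a c (ordS j)) (spoke a c (ord_pred j)) ^+ 2.
  (* The zero deformation puts [u] in the form treated by [sven_piece_comb]. *)
  pose u := def_ (0 : 'I_3 -> 'cV[R]_2 -> 'cV[R]_2) + \sum_j b j *: bubble a c j.
  have [A00 _] := sA0.
  have Au : A1 a c u.
    rewrite /u -[X in A1 a c (X + _)]scale1r; apply: sA1.2; first exact: def_A1.
    exact: (subspace_sum sA1 b (bubble_A1 nd cint)).
  exists u => //; have := sv u Au; congr (sven_eq a c u _); apply/funext => i; apply/funext => x.
  rewrite (sven_piece_comb nd cint b i 0 A00) /b.
  by rewrite mulNr divfK ?opprK// expf_neq0.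
Qed.
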